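(* Let $\lambda>0$. As $n\to+\infty$, $$\frac1n\Big(\log\big(\mathbf{Q}^{\triangle\bullet\bullet}_{n,\lfloor n\lambda\rfloor}\big)+2n\log n\Big)\longrightarrow \beta_\lambda,\qquad\text{where}\qquad \beta_\lambda=\log\Big(2e^2\, r_\lambda^2\,\tanh(r_\lambda)^{-2(\lambda+1)}\Big).$$
   Context: Let $ABC$ be the triangle of area 1 with vertices $A=(0,0)$, $B=(2,0)$, $C=(1,1)$. For $N\ge 0$ let $U_1,\dots,U_N$ be i.i.d. uniform points in $ABC$, and let $\mathbf n(N)$ be the number of the points $U_i$ that are vertices of the convex hull of $\{A,B,U_1,\dots,U_N\}$ (so $A$ and $B$ are not counted). For integers $n\ge1$, $m\ge0$, put $\mathbf{Q}^{\triangle\bullet\bullet}_{n,m}=\mathbb P(\mathbf n(n+m)=n)$. The map $\Psi(r)=\frac{\sinh(2r)}{2r}-1$ (with $\Psi(0)=0$) is a continuous increasing bijection of $[0,+\infty)$ onto itself; for $\lambda\ge 0$, $r_\lambda:=\Psi^{-1}(\lambda)$. *)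

(* Defs.v *)
From HB Require Import structures.
From mathcomp Require Import all_boot all_order all_algebra.
From mathcomp Require Import all_classical all_reals all_analysis.

Set Implicit Arguments.
Unset Strict Implicit.
Unset Printing Implicit Defensive.

Import Order.TTheory GRing.Theory Num.Theory.

Local Open Scope classical_set_scope.
Local Open Scope ring_scope.
Local Open Scope convex_scope.

Definition convex_hull (R : numDomainType) (M : lmodType R)
    (S : set (convex_lmodType M)) : set (convex_lmodType M) :=
  smallest (@convex_set R M) S.

(* The vertices of a polygon are its extreme points. *)
Definition extreme_point (R : numDomainType) (M : lmodType R)
    (K : set (convex_lmodType M)) (x : convex_lmodType M) : Prop :=
  K x /\
  forall (y z : convex_lmodType M) (t : {i01 R}),
    K y -> K z -> 0 < t%:num -> t%:num < 1 -> x = y <| t |> z -> y = z.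

(* [R * R] is the measurable space where the random points live;
   [plane R], convertible to it, carries the R-vector space structure. *)
Definition plane (R : realType) : lmodType R := (R^o * R^o)%type.

Definition ptA (R : realType) : R * R := (0, 0).
Definition ptB (R : realType) : R * R := (2, 0).
Definition ptC (R : realType) : R * R := (1, 1).

Definition triangle (R : realType) : set (R * R) :=
  @convex_hull R (plane R) [set ptA R; ptB R; ptC R].
Arguments triangle R : clear implicits.

Definition area (R : realType) : set (R * R) -> \bar R :=
  (@lebesgue_measure R \x @lebesgue_measure R)%E.

Definition uniform_on (R : realType) d (T : measurableType d)
    (P : probability T R) (S : set (R * R))
    (X : {RV P >-> (R * R)%type}) : Prop :=
  forall E : set (R * R), measurable E ->
    (distribution P X E = area (E `&` S) / area S)%E.

Definition mutually_independent (R : realType) d (T : measurableType d)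
    (P : probability T R) d' (T' : measurableType d') (I : finType)
    (X : I -> {RV P >-> T'}) : Prop :=
  forall (J : {set I}) (E : I -> set T'),
    (forall i, i \in J -> measurable (E i)) ->
    (P (\bigcap_(i in [set` J]) (X i @^-1` E i))
       = \prod_(i in J) P (X i @^-1` E i))%E.

(* [A] and [B] themselves are not counted, since only the indices of the
   [u i] are. *)
Definition nb_vertices (R : realType) (N : nat) (u : 'I_N -> R * R) : nat :=
  #|[set i : 'I_N | `[< @extreme_point R (plane R)
       (@convex_hull R (plane R) ([set ptA R; ptB R] `|` range u)) (u i) >]]|.

(* [X] stands for U_1, ..., U_(n+m). *)
Definition Q (R : realType) d (T : measurableType d) (P : probability T R)
    (n m : nat) (X : 'I_(n + m) -> {RV P >-> (R * R)%type}) : R :=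
  fine (P [set w | nb_vertices (fun i => X i w) = n]).

Definition sinh (R : realType) (x : R) : R := (expR x - expR (- x)) / 2.
Definition cosh (R : realType) (x : R) : R := (expR x + expR (- x)) / 2.
Definition tanh (R : realType) (x : R) : R := sinh x / cosh x.

Definition Psi (R : realType) (r : R) : R :=
  if r == 0 then 0 else sinh (2 * r) / (2 * r) - 1.

Definition r_ (R : realType) (lambda : R) : R :=
  'pinv_(fun=> 0) [set r : R | 0 <= r] (@Psi R) lambda.

Definition beta (R : realType) (lambda : R) : R :=
  ln (2 * expR 2 * r_ lambda ^+ 2 * tanh (r_ lambda) `^ (- (2 * (lambda + 1)))).

(* Main.v *)
Require Import Defs.
From HB Require Import structures.
From mathcomp Require Import all_boot all_order all_algebra.
From mathcomp Require Import all_classical all_reals all_analysis.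
From mathcomp Require Import perm measurable_realfun zify ring lra.

(** The argument has three stages: an exact recursion in the number of points,
a two-sided estimate of the generating functions that it defines, and a
saddle-point argument.

Recursion.  A shear turns ABC into the triangle with vertices A = (0,0),
B = (1,0), (1,1).  Among N + 1 uniform points let V be the one seen from A
under the steepest slope; it is the neighbour of A on the convex chain from A
to B.  The points below the chord VB lie inside the triangle AVB and are not
vertices.  The other ones lie in the triangle bounded by VB, the ray AV and the
right side, which an affine map (zoom) sends onto the whole triangle while V
goes to A.  Given V, the surviving points are therefore again independent
and uniform, their number has binomial weights, and integrating over V gives
(chain_probabilitySS), for the probability p(N,k) that N points produce k
vertices,
   p(N+1,k+1) = sum over j <= N of 2(N+1-j)/((N+1)(N+2)) p(j,k).
The measure-theoretic part of the file justifies this step: independent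
samples are reduced to iterated product laws (iid_tuple_law), every point is
the leading one with the same probability (tuple_law_perm, law_leader), and
the survivors are described by tuple_law_thinning.

Generating functions.  With f_k(x) = sum over N of p(N,k) x^(N+1), the recursion
says f_0 = x and x f_(k+1)'' = 2 f_k / (1-x)^2.  In the variable x = tanh(t)^2
this is nearly solved by C_k t^(2k+2) with C_k = 2^k / (k! (k+1)!):
comparing derivatives shows that C_k t^(2k+2) is an upper bound
(chain_poly_le) and that C_k t^(2k+2) (1-x) is a lower bound
(chain_poly_ge).  In order to work with polynomials, j is restricted to
N + 1 - j <= L; this replaces 1/(1-x)^2 by a partial sum of its power
series, whose loss is a factor c^k with c < 1 as close to 1 as needed.

Saddle point.  For N = n + floor(n lambda), keeping a single term of f_n gives
p(N,n) x^(N+1) <= C_n t^(2n+2); after taking logarithms and using Stirling,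
(1/n)(log p(N,n) + 2n log n) is at most log 2 + 2 + rate lambda t up to o(1),
with rate lambda t = 2 log t - (1+lambda) log(tanh(t)^2).  The derivative of the
rate has the sign of Psi t - lambda, so that the best choice is
t = r_lambda, where the bound is beta_lambda.  Conversely, for t slightly
smaller than r_lambda, tilting shows that the terms of f_n of degree above
n (1+lambda) or noticeably below it are exponentially negligible
(sum_tail_le).  As N (N+1) p(N,n) is nondecreasing in N
(chain_coef_ndecr), the remaining terms are controlled by p(N,n) alone,
which gives the matching lower bound (near_ln_chain_coef_ge). *)

Set Implicit Arguments.
Unset Strict Implicit.
Unset Printing Implicit Defensive.

Import Order.TTheory GRing.Theory Num.Theory.
Import numFieldNormedType.Exports.

Local Open Scope classical_set_scope.
Local Open Scope ring_scope.

(** * Exposed points and the first vertex of the chain *)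

Section geometry.
Context {R : realFieldType}.
Implicit Types (f u v w x y z V : R * R) (l : seq (R * R)).

Definition dotp f v : R := f.1 * v.1 + f.2 * v.2.

Definition cross v w : R := v.1 * w.2 - v.2 * w.1.

(** Serves to rotate linear forms slightly, and to make their coefficients
rational. *)
Lemma small_perturbation (T : eqType) (s : seq T) (p q : T -> R) :
  (forall t, t \in s -> 0 < p t) ->
  exists2 e, 0 < e & forall t, t \in s -> 0 < p t + e * q t.
Proof.
suff H : (forall t, t \in s -> 0 < p t) ->
  exists2 e, 0 < e & forall e', 0 < e' <= e -> forall t, t \in s -> 0 < p t + e' * q t.
  move=> /H[e e0 he]; exists e => // t ts; apply: he => //.
  by rewrite e0 lexx.
elim: s => [|t s IH] hp; first by exists 1.
have [|e e0 he] := IH; first by move=> r rs; apply: hp; rewrite inE rs orbT.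
have pt : 0 < p t by apply: hp; rewrite inE eqxx.
have q1 : 0 < 1 + `|q t| by have := normr_ge0 (q t); lra.
exists (Num.min e (p t / (1 + `|q t|))).
  by rewrite lt_min e0 divr_gt0.
move=> e' /andP[e'0]; rewrite le_min => /andP[le1 le2] r.
rewrite inE => /predU1P[->|rs]; last by apply: he => //; rewrite e'0.
move: le2; rewrite ler_pdivlMr// => le2.
have : - (e' * q t) <= e' * `|q t| by rewrite -mulrN ler_pM2l// -normrN ler_norm.
by move: le2; rewrite mulrDr mulr1; lra.
Qed.

Lemma dotp_gt0 v : v != 0 -> 0 < dotp v v.
Proof.
case: v => a b; rewrite /dotp /= => ab.
have h : (a != 0) || (b != 0).
  by apply: contraNT ab; rewrite negb_or !negbK => /andP[/eqP -> /eqP ->].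
have := sqr_ge0 a; have := sqr_ge0 b; rewrite !expr2 => b0 a0.
case/orP: h => h.
  have : 0 < a * a by rewrite -expr2 exprn_even_gt0.
  lra.
have : 0 < b * b by rewrite -expr2 exprn_even_gt0.
lra.
Qed.

(** Gordan's alternative in the plane, for finitely many nonzero vectors: they
lie in an open half-plane, or 0 is a nontrivial nonnegative combination of
three of them. Induction on the list: if the half-plane of the tail misses
[v], it is replaced by one bounded by the line of [v], slightly rotated,
unless there are vectors on both sides of that line or on the line itself, in
which case their combination along the line is balanced by [v]. *)
Lemma gordan l : (forall v, v \in l -> v != 0) ->
  (exists f, forall v, v \in l -> 0 < dotp f v) \/
  exists v1 v2 v3, exists a b c : R,
    [/\ [/\ v1 \in l, v2 \in l & v3 \in l], 0 < a, 0 <= b /\ 0 <= c,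
        a * v1.1 + b * v2.1 + c * v3.1 = 0
      & a * v1.2 + b * v2.2 + c * v3.2 = 0].
Proof.
elim: l => [|v l IH] hl; first by left; exists 0.
have hl' w : w \in l -> w != 0 by move=> wl; apply: hl; rewrite inE wl orbT.
have v0 : v != 0 by apply: hl; rewrite inE eqxx.
have vv := dotp_gt0 v0.
have [[f0 hf0]|[v1 [v2 [v3 [a [b [c [[h1 h2 h3] a0 b0 e1 e2]]]]]]]] := IH hl'; last first.
  right; exists v1, v2, v3, a, b, c.
  by split=> //; rewrite !inE h1 h2 h3 !orbT.
have [f0v|f0v] := ltP 0 (dotp f0 v).
  by left; exists f0 => w; rewrite inE => /predU1P[->//|/hf0].
(* a vector parallel to [v] on which [f0] is positive is a negative multiple
   of [v] *)
have opp u : cross v u = 0 -> 0 < dotp f0 u -> dotp v u <= 0.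
  rewrite /cross /dotp => c0 fu.
  have e : (v.1 * v.1 + v.2 * v.2) * (f0.1 * u.1 + f0.2 * u.2) =
     (v.1 * u.1 + v.2 * u.2) * (f0.1 * v.1 + f0.2 * v.2)
     + (v.1 * u.2 - v.2 * u.1) * (v.1 * f0.2 - v.2 * f0.1) by ring.
  rewrite leNgt; apply/negP => h.
  have := mulr_gt0 vv fu; rewrite /dotp e c0 mul0r addr0.
  by rewrite pmulr_rgt0// ltNge; move: f0v; rewrite /dotp => ->.
have par u : cross v u = 0 ->
    dotp v v * u.1 - dotp v u * v.1 = 0 /\ dotp v v * u.2 - dotp v u * v.2 = 0.
  rewrite /cross /dotp => c0; split.
    have -> : (v.1 * v.1 + v.2 * v.2) * u.1 - (v.1 * u.1 + v.2 * u.2) * v.1 =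
      - v.2 * (v.1 * u.2 - v.2 * u.1) by ring.
    by rewrite c0 mulr0.
  have -> : (v.1 * v.1 + v.2 * v.2) * u.2 - (v.1 * u.1 + v.2 * u.2) * v.2 =
      v.1 * (v.1 * u.2 - v.2 * u.1) by ring.
  by rewrite c0 mulr0.
case: (boolP (has (fun w => cross v w == 0) l)) => [/hasP[w wl /eqP cw]|/hasPn nc].
  right; exists w, v, v, (dotp v v), (- dotp v w), 0.
  have [p1 p2] := par _ cw.
  split; rewrite ?inE ?wl ?eqxx ?orbT//; first by rewrite oppr_ge0 opp// hf0.
    by apply: (etrans _ p1); ring.
  by apply: (etrans _ p2); ring.
case: (boolP (has (fun w => 0 < cross v w) l)) => [/hasP[w wl cw]|/hasPn np]; last first.
  have [|e e0 he] := @small_perturbation _ l (fun w => - cross v w) (dotp v).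
    move=> w wl; have := np _ wl; have := nc _ wl; rewrite -leNgt oppr_gt0 lt_neqAle.
    by move=> -> ->.
  left; exists (v.2 + e * v.1, - v.1 + e * v.2) => w; rewrite inE => /predU1P[->|wl].
    have : 0 < e * dotp v v by rewrite mulr_gt0.
    by rewrite /dotp/=; lra.
  by have := he _ wl; rewrite /dotp /cross/=; lra.
case: (boolP (has (fun w => cross v w < 0) l)) => [/hasP[z zl cz]|/hasPn nn]; last first.
  have [|e e0 he] := @small_perturbation _ l (cross v) (dotp v).
    move=> t tl; have := nn _ tl; have := nc _ tl; rewrite -leNgt lt_neqAle eq_sym.
    by move=> -> ->.
  left; exists (- v.2 + e * v.1, v.1 + e * v.2) => t; rewrite inE => /predU1P[->|tl].
    have : 0 < e * dotp v v by rewrite mulr_gt0.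
    by rewrite /dotp/=; lra.
  by have := he _ tl; rewrite /dotp /cross/=; lra.
pose u := (- cross v z * w.1 + cross v w * z.1, - cross v z * w.2 + cross v w * z.2).
have cu : cross v u = 0 by rewrite /u /cross /=; ring.
have fu : 0 < dotp f0 u.
  have : 0 < - cross v z * dotp f0 w by rewrite mulr_gt0 ?oppr_gt0// hf0.
  have : 0 < cross v w * dotp f0 z by rewrite mulr_gt0// hf0.
  by rewrite /u /dotp/=; lra.
have [p1 p2] := par _ cu.
right; exists w, z, v, (dotp v v * - cross v z), (dotp v v * cross v w), (- dotp v u).
split.
- by rewrite !inE wl zl eqxx !orbT.
- by rewrite mulr_gt0// oppr_gt0.
- by rewrite oppr_ge0 opp// mulr_ge0// ltW.
- by apply: (etrans _ p1); rewrite /u/=; ring.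
- by apply: (etrans _ p2); rewrite /u/=; ring.
Qed.

Definition gap f x y : R := f.1 * (y.1 - x.1) + f.2 * (y.2 - x.2).

(** An exposed point is one at which some linear form is strictly minimal;
over a finite list this is the same as an extreme point of the convex hull,
and it is much easier to transport along affine maps. Repetitions of [x] in
the list are harmless. *)
Definition exposed l x : Prop :=
  exists f, forall y, y \in l -> y != x -> 0 < gap f x y.

Lemma exposed_mem l l' x : l =i l' -> exposed l x -> exposed l' x.
Proof. by move=> ll' [f hf]; exists f => y; rewrite -ll'; exact: hf. Qed.

Lemma exposed_sub l l' x : {subset l <= l'} -> exposed l' x -> exposed l x.
Proof. by move=> ll' [f hf]; exists f => y /ll'; exact: hf. Qed.

Lemma exposed_affine (phi : R * R -> R * R) (a1 a2 b11 b12 b21 b22 : R) l x :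
  (forall u, phi u = (a1 + b11 * u.1 + b12 * u.2, a2 + b21 * u.1 + b22 * u.2)) ->
  b11 * b22 - b12 * b21 != 0 ->
  exposed (map phi l) (phi x) <-> exposed l x.
Proof.
move=> phiE d0.
have phi_inj : injective phi.
  move=> [u1 u2] [v1 v2]; rewrite !phiE/= => -[e1 e2].
  have w1 : b11 * (u1 - v1) + b12 * (u2 - v2) = 0 by lra.
  have w2 : b21 * (u1 - v1) + b22 * (u2 - v2) = 0 by lra.
  have z1 : (b11 * b22 - b12 * b21) * (u1 - v1) = 0.
    transitivity (b22 * (b11 * (u1 - v1) + b12 * (u2 - v2)) - b12 * (b21 * (u1 - v1) + b22 * (u2 - v2))); first ring.
    by rewrite w1 w2 !mulr0 subrr.
  have z2 : (b11 * b22 - b12 * b21) * (u2 - v2) = 0.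
    transitivity (b11 * (b21 * (u1 - v1) + b22 * (u2 - v2)) - b21 * (b11 * (u1 - v1) + b12 * (u2 - v2))); first ring.
    by rewrite w1 w2 !mulr0 subrr.
  move/eqP: z1; rewrite mulf_eq0 (negbTE d0)/= subr_eq0 => /eqP ->.
  by move/eqP: z2; rewrite mulf_eq0 (negbTE d0)/= subr_eq0 => /eqP ->.
split=> [[f hf]|[f hf]].
  exists (f.1 * b11 + f.2 * b21, f.1 * b12 + f.2 * b22) => y yl yx.
  have := hf (phi y); rewrite map_f// (inj_eq phi_inj) => /(_ isT yx).
  by rewrite /gap !phiE /=; congr (0 < _); ring.
exists ((f.1 * b22 - f.2 * b21) / (b11 * b22 - b12 * b21),
        (f.2 * b11 - f.1 * b12) / (b11 * b22 - b12 * b21)) => y /mapP[z zl ->].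
rewrite (inj_eq phi_inj) => zx; have := hf _ zl zx.
by rewrite /gap !phiE /=; congr (0 < _); field.
Qed.

(** The corners (0,0) and (1,0) take part in the hull but are not counted. *)
Definition chain_vertices l : nat :=
  count (fun x => `[< exposed ((0, 0) :: (1, 0) :: l) x >]) l.

(** The last condition says that the slope of [u] seen from A = (0,0) is
smaller than that of [V]. *)
Definition below_ray V u : bool := [&& 0 < u.2, u.1 < 1 & u.2 * V.1 < V.2 * u.1].

Definition above_chord V u : bool := V.2 * (1 - u.1) < u.2 * (1 - V.1).

(** The affine map sending V to A, fixing B, and sending the point (1, V.2 /
V.1) where the ray AV meets the right side of the triangle to (1,1). *)
Definition zoom V u : R * R :=
  ((u.1 - V.1) / (1 - V.1), (u.2 - V.2 * (1 - (u.1 - V.1) / (1 - V.1))) * (V.1 / V.2)).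

Definition in_triangle V : bool := [&& 0 < V.2, V.2 < V.1 & V.1 < 1].

Lemma exposed_zoom V l x : in_triangle V ->
  exposed ((0, 0) :: (1, 0) :: map (zoom V) l) (zoom V x) <->
  exposed (V :: (1, 0) :: l) x.
Proof.
case: V => s0 c0 /and3P[/= c0_gt0 cs s1].
have n1 : 1 - s0 != 0 by lra.
have n2 : c0 != 0 by lra.
have n3 : s0 != 0 by lra.
have zE u : zoom (s0, c0) u = (- s0 / (1 - s0) + (1 - s0)^-1 * u.1 + 0 * u.2,
   - s0 / (1 - s0) + s0 / (1 - s0) * u.1 + s0 / c0 * u.2).
  by rewrite /zoom/=; congr (_, _); field; rewrite ?n1 ?n2.
have d0 : (1 - s0)^-1 * (s0 / c0) - 0 * (s0 / (1 - s0)) != 0.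
  by rewrite mul0r subr0 mulf_neq0// ?invr_eq0// mulf_neq0// invr_eq0.
rewrite -(exposed_affine ((s0, c0) :: (1, 0) :: l) x zE d0)/=.
suff [-> ->] : zoom (s0, c0) (s0, c0) = (0, 0) /\ zoom (s0, c0) (1, 0) = (1, 0) by [].
by rewrite /zoom/=; split; congr (_, _); field; rewrite ?n1 ?n2.
Qed.

(** The form vanishing on AV is positive on the points below the ray, but it
does not distinguish V from A: it is rotated slightly in favour of V. *)
Lemma exposed_first V l : in_triangle V -> all (below_ray V) l ->
  exposed ((0, 0) :: (1, 0) :: V :: l) V.
Proof.
case: V => s0 c0 /and3P[/= c0_gt0 cs s1] /allP hl.
(* [(c0, - s0)] vanishes on AV; subtracting [e] favours V over A *)
have [|e e0 he] := @small_perturbation _ ((1, 0) :: l)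
   (fun u => c0 * u.1 - s0 * u.2) (fun u => s0 - u.1).
  move=> u; rewrite inE => /predU1P[->/=|/hl/and3P[/= _ _ h]]; lra.
exists (c0 - e, - s0) => y; rewrite !inE => /or4P[/eqP -> _|/eqP -> _|/eqP -> |yl _].
- rewrite /gap/=.
  have : 0 < e * s0 by rewrite mulr_gt0//; lra.
  lra.
- by have := he (1, 0); rewrite inE eqxx => /(_ isT); rewrite /gap/=; lra.
- by rewrite eqxx.
- by have := he y; rewrite inE yl orbT => /(_ isT); rewrite /gap/=; lra.
Qed.

(** Such a point is a convex combination of A, V and B. *)
Lemma not_exposed_below_chord V l x : in_triangle V -> below_ray V x ->
  ~~ above_chord V x -> ~ exposed ((0, 0) :: (1, 0) :: V :: l) x.
Proof.
case: V x => s0 c0 [s c] /and3P[/= c0_gt0 cs s1] /and3P[/= c_gt0 s_lt1 ray].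
rewrite /above_chord/= -leNgt => chord [f hf].
have hA : 0 < gap f (s, c) (0, 0).
  by apply: hf; rewrite ?inE ?eqxx// xpair_eqE (lt_eqF c_gt0) andbF.
have hB : 0 < gap f (s, c) (1, 0).
  by apply: hf; rewrite ?inE ?eqxx ?orbT// xpair_eqE (lt_eqF c_gt0) andbF.
have hV : 0 < gap f (s, c) (s0, c0).
  apply: hf; rewrite ?inE ?eqxx ?orbT//; apply/eqP => -[e1 e2].
  by move: ray; rewrite e1 e2 mulrC ltxx.
(* up to the factor c0, the barycentric coordinates of [x] in V, B, A *)
have : 0 < c * gap f (s, c) (s0, c0) + (c0 * s - c * s0) * gap f (s, c) (1, 0)
   + (c0 * (1 - s) - c * (1 - s0)) * gap f (s, c) (0, 0).
  apply: ltr_wpDr; first by rewrite mulr_ge0 ?(ltW hA)// subr_ge0.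
  by rewrite addr_gt0// mulr_gt0// subr_gt0.
rewrite /gap/= [X in 0 < X](_ : _ = 0) ?ltxx//; ring.
Qed.

(** Once V is known to be a vertex, A and the points of the triangle AVB can
be forgotten: a linear form that is smaller at [x] than at V and B is smaller
than at these points too. *)
Lemma exposed_above_chord V l x : in_triangle V -> all (below_ray V) l ->
  below_ray V x -> above_chord V x ->
  exposed ((0, 0) :: (1, 0) :: V :: l) x <->
  exposed (V :: (1, 0) :: [seq u <- l | above_chord V u]) x.
Proof.
move=> VT /allP hl xray xch; split.
  apply: exposed_sub => y; rewrite !inE mem_filter.
  by move=> /or3P[->|->|/andP[_ ->]]; rewrite ?orbT.
case: V x VT hl xray xch => s0 c0 [s c] /and3P[/= c0_gt0 cs s1] hl /and3P[/= c_gt0 s_lt1 ray].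
rewrite {1}/above_chord/= => chord [f hf].
have hB : 0 < gap f (s, c) (1, 0).
  by apply: hf; rewrite ?inE ?eqxx ?orbT// xpair_eqE (lt_eqF c_gt0) andbF.
have hV : 0 < gap f (s, c) (s0, c0).
  apply: hf; rewrite ?inE ?eqxx ?orbT//; apply/eqP => -[e1 e2].
  by move: ray; rewrite e1 e2 mulrC ltxx.
(* the cone with apex [x] through [V] and [B] contains [A] *)
have hA : 0 < gap f (s, c) (0, 0).
  suff : 0 < (c * (1 - s0) - c0 * (1 - s)) * gap f (s, c) (0, 0).
    by rewrite pmulr_rgt0// subr_gt0.
  have : 0 < c * gap f (s, c) (s0, c0) + (c0 * s - c * s0) * gap f (s, c) (1, 0).
    by rewrite addr_gt0// mulr_gt0// subr_gt0.
  by congr (0 < _); rewrite /gap/=; ring.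
exists f => -[ys yc]; rewrite !inE => /or4P[/eqP ->//|/eqP ->//|/eqP -> //|yl yx].
case: (boolP (above_chord (s0, c0) (ys, yc))) => [ych|].
  by apply: hf => //; rewrite !inE mem_filter ych yl !orbT.
have /and3P[/= yc_gt0 ys1 yray] := hl _ yl.
rewrite /above_chord/= -leNgt => ych.
rewrite -(pmulr_rgt0 _ c0_gt0).
have : 0 < yc * gap f (s, c) (s0, c0) + (c0 * ys - yc * s0) * gap f (s, c) (1, 0)
   + (c0 * (1 - ys) - yc * (1 - s0)) * gap f (s, c) (0, 0).
  apply: ltr_wpDr; first by rewrite mulr_ge0 ?(ltW hA)// subr_ge0.
  by rewrite addr_gt0// mulr_gt0// subr_gt0.
by congr (0 < _); rewrite /gap/=; ring.
Qed.

(** The geometric content of the recursion. The point V, of steepest slope, is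
a vertex; the others are the vertices of the chain from V to B, a copy under
[zoom] of a chain from A to B. *)
Lemma chain_vertices_first V l : in_triangle V -> all (below_ray V) l ->
  chain_vertices (V :: l) =
  (chain_vertices (map (zoom V) [seq u <- l | above_chord V u])).+1.
Proof.
move=> VT hl; rewrite /chain_vertices /=.
have -> : `[< exposed [:: (0, 0), (1, 0), V & l] V >].
  by apply/asboolP/exposed_first.
rewrite add1n; congr S; rewrite count_map count_filter.
apply: eq_in_count => x xl /=; have xb := allP hl _ xl.
case: (boolP (above_chord V x)) => xch; last first.
  by rewrite andbF; apply/asboolPn/not_exposed_below_chord.
rewrite andbT; apply/asbool_equiv_eq.
by rewrite exposed_zoom// exposed_above_chord.
Qed.

Lemma perm_chain_vertices l l' : perm_eq l l' -> chain_vertices l = chain_vertices l'.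
Proof.
move=> ll'; rewrite /chain_vertices (seq.permP ll').
apply: eq_count => x; apply/asbool_equiv_eq; split; apply: exposed_mem => y.
  by rewrite !inE (perm_mem ll').
by rewrite !inE (perm_mem ll').
Qed.

End geometry.

(** * Extreme points of a convex hull are exposed points *)

Section hull.
Context {R : realType}.
Implicit Types (l : seq (R * R)) (x y z : R * R).
Local Open Scope convex_scope.

Lemma conv_planeE (y z : convex_lmodType (plane R)) (t : {i01 R}) :
  y <| t |> z = (t%:num * y.1 + (1 - t%:num) * z.1, t%:num * y.2 + (1 - t%:num) * z.2).
Proof. by []. Qed.

(** Barycentres with unnormalised weights, the form in which they occur in the
applications. *)
Lemma convex_hull_conv (S : set (convex_lmodType (plane R))) y z (a b : R) :
  0 < a -> 0 <= b -> convex_hull S y -> convex_hull S z ->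
  convex_hull S ((a * y.1 + b * z.1) / (a + b), (a * y.2 + b * z.2) / (a + b)).
Proof.
move=> a0 b0 Sy Sz.
have ab : 0 < a + b by lra.
have t01 : 0 <= a / (a + b) <= 1.
  by rewrite divr_ge0 ?(ltW a0) ?(ltW ab)//= ler_pdivrMr//; lra.
pose t : {i01 R} := Itv01 (proj1 (andP t01)) (proj2 (andP t01)).
move=> K [Kc SK].
have := Kc y z t; rewrite !in_setE => /(_ (Sy _ (conj Kc SK)) (Sz _ (conj Kc SK))).
rewrite conv_planeE /=; congr (K _); congr (_, _); field; lra.
Qed.

(** If [f] exposes [x], the set made of [x] and of the open half-plane [gap f
x > 0] is convex and contains the hull, and [x] is not inside any segment of
it. Conversely, if [x] is not exposed, Gordan's alternative writes it as a
proper convex combination of other points of [l], so that it is not extreme. *)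
Lemma extreme_point_exposed (S : set (convex_lmodType (plane R))) l x :
  x \in l -> S = [set` l] ->
  extreme_point (convex_hull S) x <-> exposed l x.
Proof.
move=> xl SE.
have hullS y : y \in l -> convex_hull S y.
  by move=> yl K [_ SK]; apply: SK; rewrite SE.
split; last first.
  move=> [f hf]; split; first exact: hullS.
  pose K : set (convex_lmodType (plane R)) := [set z | z = x \/ 0 < gap f x z].
  have gap0 z : K z -> 0 <= gap f x z.
    by move=> [->|/ltW//]; rewrite /gap !subrr !mulr0 addr0.
  have subK : convex_hull S `<=` K.
    apply: smallest_sub => [|y].
      apply/convex_setW => y z; rewrite !in_setE => Ky Kz t t0 t1; rewrite in_setE.
      have gE : gap f x (y <| t |> z) = t%:num * gap f x y + (1 - t%:num) * gap f x z.
        by rewrite conv_planeE /gap/=; ring.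
      have KE : 0 < t%:num * gap f x y + (1 - t%:num) * gap f x z -> K (y <| t |> z).
        by rewrite -gE => h; right.
      have gx : gap f x x = 0 by rewrite /gap !subrr !mulr0 addr0.
      have {}t1 : 0 < 1 - t%:num by rewrite subr_gt0.
      case: Ky Kz => [yx|Ky] [zx|Kz].
      - by left; rewrite yx zx convmm.
      - by apply: KE; rewrite yx gx mulr0 add0r mulr_gt0.
      - by apply: KE; rewrite zx gx mulr0 addr0 mulr_gt0.
      - by apply: KE; rewrite addr_gt0// mulr_gt0.
    rewrite SE /= => yl; have [->|yx] := eqVneq y x; first by left.
    by right; apply: hf.
  move=> y z t /subK Ky /subK Kz t0 t1 xyz.
  have : t%:num * gap f x y + (1 - t%:num) * gap f x z = 0.
    transitivity (gap f x (y <| t |> z)); first by rewrite conv_planeE /gap/=; ring.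
    by rewrite -xyz /gap !subrr !mulr0 addr0.
  case: Ky => [->|Ky].
    case: Kz => [->//|Kz] e; exfalso.
    have : 0 < (1 - t%:num) * gap f x z by rewrite mulr_gt0// subr_gt0.
    by rewrite -e /gap; lra.
  move=> e; exfalso; have : 0 < t%:num * gap f x y by rewrite mulr_gt0.
  have : 0 <= (1 - t%:num) * gap f x z by rewrite mulr_ge0 ?gap0// subr_ge0 ltW.
  by move: e; set A := _ * gap _ _ _; set B := _ * gap _ _ _; lra.
move=> [_ xext].
pose l' := [seq (y.1 - x.1, y.2 - x.2) | y <- l & y != x].
have [v|[f hf]|] := @gordan _ l'.
- move=> /mapP[y]; rewrite mem_filter => /andP[yx _] ->.
  apply/eqP => -[/eqP + /eqP]; rewrite !subr_eq0 => /eqP e1 /eqP e2.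
  by case/eqP: yx; rewrite (surjective_pairing y) e1 e2 -surjective_pairing.
- exists f => y yl yx; apply: (hf (y.1 - x.1, y.2 - x.2)); apply/mapP; exists y => //.
  by rewrite mem_filter yx.
move=> [v1 [v2 [v3 [a [b [c [[]]]]]]]].
move=> /mapP[y1 + ->] /mapP[y2 + ->] /mapP[y3 + ->] a0 [b0 c0] /=.
rewrite !mem_filter => /andP[n1 l1] /andP[n2 l2] /andP[n3 l3] e1 e2; exfalso.
have [bc0|bc0] := eqVneq (b + c) 0.
  have [b00 c00] : b = 0 /\ c = 0 by split; lra.
  move: e1 e2; rewrite b00 c00 !mul0r !addr0 => /eqP + /eqP.
  rewrite !mulf_eq0 (gt_eqF a0)/= !subr_eq0 => /eqP h1 /eqP h2.
  by move: n1; rewrite (surjective_pairing y1) h1 h2 -surjective_pairing eqxx.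
have {}bc0 : 0 < b + c by rewrite lt_neqAle eq_sym bc0 addr_ge0.
(* [x] is strictly between [y1] and this point of the segment [y2 y3] *)
pose z := ((b * y2.1 + c * y3.1) / (b + c), (b * y2.2 + c * y3.2) / (b + c)).
have hz : convex_hull S z.
  have [b00|bn0] := eqVneq b 0; last first.
    by apply: convex_hull_conv; [rewrite lt_neqAle eq_sym bn0| | exact: hullS..].
  rewrite /z (addrC b) (addrC (b * _)) [X in (_, X / _)]addrC.
  by apply: convex_hull_conv; [move: bc0; rewrite b00 add0r| | exact: hullS..].
have abc : 0 < a + (b + c) by lra.
have t01 : 0 <= a / (a + (b + c)) <= 1.
  by rewrite divr_ge0 ?(ltW a0) ?(ltW abc)//= ler_pdivrMr//; lra.
pose t : {i01 R} := Itv01 (proj1 (andP t01)) (proj2 (andP t01)).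
have xE : x = (y1 : convex_lmodType (plane R)) <| t |> z.
  have x1 : x.1 = (a * y1.1 + b * y2.1 + c * y3.1) / (a + (b + c)).
    by apply: (canRL (mulfK (lt0r_neq0 abc))); lra.
  have x2 : x.2 = (a * y1.2 + b * y2.2 + c * y3.2) / (a + (b + c)).
    by apply: (canRL (mulfK (lt0r_neq0 abc))); lra.
  have z1 : x.1 = t%:num * y1.1 + (1 - t%:num) * z.1 by rewrite x1 /z/=; field; rewrite !lt0r_neq0.
  have z2 : x.2 = t%:num * y1.2 + (1 - t%:num) * z.2 by rewrite x2 /z/=; field; rewrite !lt0r_neq0.
  transitivity (x.1, x.2); first exact: surjective_pairing.
  by rewrite conv_planeE -z1 -z2.
have y1z : y1 = z.
  apply: (xext y1 z t) => //; first exact: hullS.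
    by rewrite /= divr_gt0.
  by rewrite /= ltr_pdivrMr//; lra.
move: xE; rewrite -y1z convmm => xy1.
by move: n1; rewrite xy1 eqxx.
Qed.

End hull.

Section bridge.
Context {R : realType}.
Implicit Types (u x y z : R * R).

(** Sends A, B, C to (0,0), (1,0), (1,1). In these coordinates the zooming
maps are lower triangular, so that their effect on areas follows by
integrating one coordinate after the other. *)
Definition shear u : R * R := ((u.1 + u.2) / 2, u.2).

Lemma exposed_shear (l : seq (R * R)) x : exposed (map shear l) (shear x) <-> exposed l x.
Proof.
apply: (@exposed_affine _ _ 0 0 2^-1 2^-1 0 1).
  by move=> u; rewrite /shear; congr (_, _); field.
by rewrite mulr0 subr0 mulr1 invr_eq0 pnatr_eq0.
Qed.

(** Indices and list entries are counted alike: a point that is repeated in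
the sample is counted with its multiplicity on both sides. *)
Lemma nb_vertices_chain N (u : 'I_N -> R * R) :
  nb_vertices u = chain_vertices [seq shear (u i) | i : 'I_N].
Proof.
rewrite /nb_vertices /chain_vertices /image_mem count_map cardE -size_filter.
congr size; rewrite enumT {1}/enum_mem; apply: eq_filter => i.
rewrite -enumT [LHS]/= [LHS]asboolb /=.
apply/asbool_equiv_eq.
have -> : [:: (0, 0), (1, 0) & [seq shear (u i) | i <- enum 'I_N]] =
    map shear [:: ptA R, ptB R & [seq u i | i <- enum 'I_N]].
  rewrite /= /ptA /ptB -map_comp /shear /=; congr [:: (_, _), (_, _) & _]; lra.
rewrite exposed_shear; apply: extreme_point_exposed.
  by rewrite !inE map_f ?orbT// mem_enum.
apply/seteqP; split => v /=.
  move=> [[->|->]|[j _ <-]]; rewrite !inE ?eqxx ?orbT// map_f ?orbT// mem_enum//.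
rewrite !inE => /or3P[/eqP ->|/eqP ->|/mapP[j _ ->]]; [by left; left|by left; right|].
by right; exists j.
Qed.

Lemma triangleE : triangle R = [set u | [/\ 0 <= u.2, u.2 <= u.1 & u.1 + u.2 <= 2]].
Proof.
apply/seteqP; split.
  apply: smallest_sub => [|u].
    apply/convex_setW => y z; rewrite !in_setE /= => -[a1 a2 a3] [b1 b2 b3] t t0 t1.
    rewrite in_setE conv_planeE /=.
    have s1 : 0 < 1 - t%:num by rewrite subr_gt0.
    move: (t%:num) t0 t1 s1 => s s0 _ s1; split.
    - by rewrite addr_ge0// mulr_ge0// ltW.
    - by rewrite lerD// ler_pM2l.
    - have : s * (y.1 + y.2) <= s * 2 by rewrite ler_pM2l.
      have : (1 - s) * (z.1 + z.2) <= (1 - s) * 2 by rewrite ler_pM2l.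
      lra.
  by move=> [[->|->]|->] /=; split; lra.
move=> u /= [h1 h2 h3].
have hA : triangle R (ptA R) by move=> K [_]; apply; left; left.
have hB : triangle R (ptB R) by move=> K [_]; apply; left; right.
have hC : triangle R (ptC R) by move=> K [_]; apply; right.
have [e|x0] := eqVneq u.1 0.
  have e2 : u.2 = 0 by lra.
  by rewrite (surjective_pairing u) e e2.
have {}x0 : 0 < u.1 by rewrite lt_neqAle eq_sym x0; lra.
(* the point where the ray from A through [u] meets the side BC *)
have hz : triangle R (2 * u.1 / (u.1 + u.2), 2 * u.2 / (u.1 + u.2)).
  have [e|xy] := eqVneq u.1 u.2.
    have -> : (2 * u.1 / (u.1 + u.2), 2 * u.2 / (u.1 + u.2)) = ptC R.
      by rewrite /ptC -e; congr (_, _); field; lra.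
    exact: hC.
  have bpos : 0 < (u.1 - u.2) / 2 by rewrite divr_gt0// subr_gt0 lt_neqAle eq_sym xy.
  have := convex_hull_conv bpos h1 hB hC; rewrite /= mulr0 add0r !mulr1.
  congr (triangle R _); congr (_, _); field; lra.
have s0 : 0 < (u.1 + u.2) / 2 by lra.
have a0 : 0 <= 1 - (u.1 + u.2) / 2 by lra.
have := convex_hull_conv s0 a0 hz hA; rewrite /= !mulr0 !addr0.
rewrite [X in convex_hull _ X](_ : _ = u)//.
by rewrite [RHS]surjective_pairing; congr (_, _); field; lra.
Qed.

End bridge.

(** * Lebesgue measure and triangular affine maps *)

Section affine_maps.
Context {R : realType}.
Local Notation leb := (@lebesgue_measure R).
Local Open Scope ereal_scope.

Lemma measurable_affine (a b : R) : measurable_fun [set: R] (fun x => a + b * x)%R.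
Proof. by apply: measurable_funD => //; exact: measurable_funM. Qed.

(** The rescaled image measure agrees with Lebesgue measure on intervals,
hence everywhere. *)
Lemma lebesgue_measure_affine (a b : R) (A : set R) : (0 < b)%R -> measurable A ->
  leb ((fun x => a + b * x)%R @^-1` A) = b^-1%:E * leb A.
Proof.
move=> b0 mA.
pose f : R -> R := fun x => (a + b * x)%R.
have mf : measurable_fun setT (f : measurableTypeR R -> measurableTypeR R).
  exact: measurable_affine.
pose k : {nonneg R} := NngNum (ltW b0).
suff -> : leb A = b%:E * leb (f @^-1` A).
  by rewrite muleA -EFinM mulVf ?gt_eqF// mul1e.
pose pf : {measure set (measurableTypeR R) -> \bar R} :=
  [the measure _ _ of pushforward leb (f : _ -> measurableTypeR R)].
apply: (@lebesgue_measure_unique R (mscale k (pf mf))) => // _ [[x y]] _ <-.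
rewrite -[RHS]/(b%:E * leb (f @^-1` [set` `]x, y]%R])).
have -> : f @^-1` [set` `]x, y]%R] = [set` `](x - a) / b, (y - a) / b]%R].
  apply/seteqP; split => z /=; rewrite !in_itv/= /f => /andP[h1 h2]; apply/andP; split.
  - by rewrite ltr_pdivrMr//; lra.
  - by rewrite ler_pdivlMr//; lra.
  - by move: h1; rewrite ltr_pdivrMr//; lra.
  - by move: h2; rewrite ler_pdivlMr//; lra.
rewrite !lebesgue_measure_itv/= !lte_fin ltr_pM2r ?invr_gt0// ltrD2r.
case: ifPn => _; last by rewrite mule0.
by rewrite -!EFinD -EFinM; congr EFin; field; rewrite gt_eqF.
Qed.

Lemma ge0_integral_affine (a b : R) (f : R -> \bar R) : (0 < b)%R ->
  measurable_fun setT f -> (forall x, 0 <= f x) ->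
  \int[leb]_x f (a + b * x)%R = b^-1%:E * \int[leb]_x f x.
Proof.
move=> b0 mf f0.
have mg : measurable_fun setT ((fun x => a + b * x)%R : measurableTypeR R -> measurableTypeR R).
  exact: measurable_affine.
have b0' : (0 <= b^-1)%R by rewrite invr_ge0 ltW.
rewrite -(@ge0_integral_mscale _ _ _ leb setT measurableT (NngNum b0') f)//.
transitivity (\int[pushforward leb ((fun x => a + b * x)%R : _ -> measurableTypeR R)]_x f x).
  by rewrite ge0_integral_pushforward//= preimage_setT.
apply: eq_measure_integral => A mA _.
exact: (lebesgue_measure_affine a b0 mA).
Qed.

Local Notation leb2 := (leb \x leb).

(** By Fubini the linear part only matters through its diagonal: each vertical
section is translated and dilated by [c2], then the base is dilated by [b1]. *)
Lemma area_triangular (a1 b1 a2 b2 c2 : R) (E : set (R * R)) :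
  (0 < b1)%R -> (0 < c2)%R -> measurable E ->
  leb2 ((fun u => (a1 + b1 * u.1, a2 + b2 * u.1 + c2 * u.2)%R) @^-1` E) =
  ((b1 * c2)^-1)%:E * leb2 E.
Proof.
move=> b0 c0 mE.
have mF : measurable_fun setT (leb \o xsection E) by exact: measurable_fun_xsection.
rewrite /product_measure1.
transitivity (\int[leb]_x (c2^-1%:E * (leb \o xsection E) (a1 + b1 * x)%R)).
  apply: eq_integral => x _ /=.
  rewrite -(@lebesgue_measure_affine (a2 + b2 * x) c2)//; last exact: measurable_xsection.
rewrite ge0_integralZl//; last 2 first.
- exact: (measurableT_comp mF (measurable_affine a1 b1)).
- by rewrite lee_fin invr_ge0 ltW.
rewrite (@ge0_integral_affine a1 b1 (leb \o xsection E))//.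
by rewrite muleA -EFinM invfM mulrC.
Qed.

Lemma area_swap (E : set (R * R)) : measurable E ->
  leb2 ((fun u => (u.2, u.1)) @^-1` E) = leb2 E.
Proof.
move=> mE.
have ms : measurable_fun setT (fun u : R * R => (u.2, u.1)).
  exact/measurable_fun_pair.
pose pf : {measure set (measurableTypeR R * measurableTypeR R) -> \bar R} :=
  [the measure _ _ of pushforward leb2 (fun u => (u.2, u.1))].
apply/esym; apply: (@product_measure_unique _ _ _ _ _ leb leb (pf ms)) => // A B mA mB.
rewrite -[LHS]/(leb2 ((fun u : R * R => (u.2, u.1)) @^-1` (A `*` B))).
rewrite (_ : _ @^-1` _ = B `*` A); last first.
  by apply/seteqP; split => -[x y] /= [].
by rewrite product_measure1E// muleC.
Qed.

End affine_maps.

(** * The uniform law on the triangle, and its images under zooming *)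

Lemma measurable_pred d (T : measurableType d) (b : T -> bool) :
  measurable_fun setT b -> measurable [set x | b x].
Proof.
move=> mb; have := mb measurableT [set true]; rewrite setTI.
by apply.
Qed.

Section triangle_law.
Context {R : realType}.
Local Notation leb := (@lebesgue_measure R).
Local Notation leb2 := (leb \x leb)%E.

Lemma measurable_in_triangle : measurable_fun setT (@in_triangle R).
Proof.
apply: measurable_and; first exact: measurable_fun_ltr.
by apply: measurable_and; apply: measurable_fun_ltr.
Qed.

Definition open_triangle : set (R * R) := [set u | in_triangle u].

Lemma measurable_open_triangle : measurable open_triangle.
Proof. exact: measurable_pred measurable_in_triangle. Qed.

(** Euler's beta integral. *)
Lemma integral_monomial (a b : nat) :
  (\int[leb]_x (if 0 < x < 1 then x ^+ a * (1 - x) ^+ b else 0)%:E =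
   ((a`! * b`!)%:R / (a + b).+1`!%:R)%:E)%E.
Proof.
rewrite -beta_fun_fact EFin_beta_fun /=.
transitivity (\int[leb]_(x in `]0%R, 1%R[) (XMonemX a b x)%:E)%E.
  rewrite [RHS]integral_mkcond; apply: eq_integral => x _.
  by rewrite patchE mem_setE in_itv /=; case: ifP.
transitivity (\int[leb]_(x in `[0%R, 1%R]) (XMonemX a b x)%:E)%E.
  apply/esym/integral_itv_bndoo.
  by apply/measurable_EFinP; exact: measurable_XMonemX.
rewrite [LHS]integral_mkcond; apply: eq_integral => x _.
by rewrite !patchE; case: ifP.
Qed.

(** Integration of the height first: it ranges over (0, s) at abscissa s. *)
Lemma integral_triangle_monomial (g : R -> R) (N : nat) :
  measurable_fun setT g -> (forall s, 0 < s < 1 -> 0 <= g s) ->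
  (\int[leb2]_u (if in_triangle u then g u.1 * u.2 ^+ N else 0)%:E =
   \int[leb]_s (if 0 < s < 1 then g s * s ^+ N.+1 / N.+1%:R else 0)%:E)%E.
Proof.
move=> mg g0.
have mF : measurable_fun setT (fun u : R * R => (if in_triangle u then g u.1 * u.2 ^+ N else 0)%:E).
  apply/measurable_EFinP; apply: measurable_fun_ifT => //; first exact: measurable_in_triangle.
  apply: measurable_funM; first exact: measurableT_comp.
  exact: measurable_funX.
rewrite fubini_tonelli1//; last first.
  move=> u; rewrite lee_fin; case: ifP => // /and3P[h1 h2 h3].
  by rewrite mulr_ge0 ?exprn_ge0 ?(ltW h1)// g0// h3 (lt_trans h1 h2).
apply: eq_integral => s _; rewrite /fubini_F /=.
case: ifP => [/andP[s0 s1]|s01]; last first.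
  rewrite integral0_eq// => c _; case: ifP => // /and3P[/= h1 h2 h3].
  by rewrite (lt_trans h1 h2) h3 in s01.
pose f (c : R) := (if 0 < c < s then c ^+ N else 0)%:E.
have mf : measurable_fun setT f.
  apply/measurable_EFinP; apply: measurable_fun_ifT => //.
  by apply: measurable_and; apply: measurable_fun_ltr.
have f0 c : (0 <= f c)%E.
  by rewrite lee_fin; case: ifP => // /andP[h1 _]; rewrite exprn_ge0// ltW.
have If : (\int[leb]_c f c = (s ^+ N.+1 / N.+1%:R)%:E)%E.
  have := ge0_integral_affine 0 s0 mf f0.
  have -> : (\int[leb]_x f (0 + s * x)%R = (s ^+ N)%:E * (N.+1%:R^-1)%:E)%E.
    have -> : (N.+1%:R^-1 = (N`! * 0`!)%:R / (N + 0).+1`!%:R :> R)%R.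
      rewrite fact0 muln1 addn0 factS natrM; field.
      by rewrite nat1r !pnatr_eq0 /= -!lt0n fact_gt0.
    rewrite -(integral_monomial N 0) -ge0_integralZl//.
    - apply: eq_integral => x _; rewrite /f add0r -EFinM; congr EFin.
      rewrite pmulr_rgt0// gtr_pMr// expr0 mulr1.
      by case: ifP => _; rewrite ?mulr0// exprMn.
    - apply/measurable_EFinP; apply: measurable_fun_ifT => //.
        by apply: measurable_and; apply: measurable_fun_ltr.
      by apply: measurable_funM => //; apply: (measurable_funX 0); exact: measurable_funB.
    - move=> x _; rewrite lee_fin; case: ifP => // /andP[x0 _].
      by rewrite expr0 mulr1 exprn_ge0// ltW.
    - by rewrite lee_fin exprn_ge0// ltW.
  move=> e; have : (s%:E * ((s ^+ N)%:E * (N.+1%:R^-1)%:E) = s%:E * (s^-1%:E * \int[leb]_x f x))%E by rewrite e.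
  by rewrite !muleA -!EFinM mulfV ?gt_eqF// mul1e -exprS => <-.
transitivity (\int[leb]_c ((g s)%:E * f c))%E.
  apply: eq_integral => c _; rewrite /f -EFinM /in_triangle/= s1 andbT; congr EFin.
  by case: ifP => _; rewrite ?mulr0.
rewrite ge0_integralZl//; last by rewrite lee_fin g0// s0.
by rewrite If -EFinM mulrA.
Qed.

Lemma area_open_triangle : leb2 open_triangle = (2^-1)%:E.
Proof.
transitivity (\int[leb2]_u (\1_open_triangle u)%:E)%E.
  by rewrite integral_indic ?setIT//; exact: measurable_open_triangle.
transitivity (\int[leb2]_u (if in_triangle u then cst 1%R u.1 * u.2 ^+ 0 else 0)%:E)%E.
  apply: eq_integral => u _; rewrite indicE; case: ifPn => h.
    by rewrite mem_set// expr0 mulr1.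
  by rewrite memNset//; exact/negP.
rewrite integral_triangle_monomial//.
transitivity (\int[leb]_x (if (0 < x < 1)%R then x ^+ 1 * (1 - x) ^+ 0 else 0)%:E)%E.
  by apply: eq_integral => x _; rewrite expr0 mulr1 mul1r divr1.
by rewrite integral_monomial /= fact0 mul1r; congr EFin; rewrite div1r.
Qed.

End triangle_law.

Section triangle_probability.
Context {R : realType}.
Local Notation leb := (@lebesgue_measure R).
Local Notation leb2 := (leb \x leb)%E.
Local Open Scope ereal_scope.

(** The open triangle is used so that the inequalities selecting the points of
the successive triangles are all strict. *)
Definition triangle_law : set (R * R) -> \bar R :=
  mscale (NngNum (ler0n R 2)) (mrestr leb2 measurable_open_triangle).

Let triangle_law0 : triangle_law set0 = 0.
Proof. exact: measure0. Qed.

Let triangle_law_ge0 E : 0 <= triangle_law E.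
Proof. exact: measure_ge0. Qed.

Let triangle_law_sigma_additive : semi_sigma_additive triangle_law.
Proof.
pose m : {measure set (measurableTypeR R * measurableTypeR R) -> \bar R} :=
  [the measure _ _ of mscale (NngNum (ler0n R 2))
     (mrestr leb2 measurable_open_triangle)].
exact: (@measure_semi_sigma_additive _ _ _ m).
Qed.

HB.instance Definition _ := isMeasure.Build _ _ _ triangle_law
  triangle_law0 triangle_law_ge0 triangle_law_sigma_additive.

Lemma triangle_lawE E : triangle_law E = 2%:E * leb2 (E `&` open_triangle).
Proof. by []. Qed.

Let triangle_law_setT : triangle_law setT = 1.
Proof.
by rewrite triangle_lawE setTI area_open_triangle -EFinM mulfV.
Qed.

HB.instance Definition _ :=
  Measure_isProbability.Build _ _ _ triangle_law triangle_law_setT.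

Lemma integral_triangle_law (f : R * R -> \bar R) : measurable_fun setT f ->
  (forall u, 0 <= f u) -> (forall u, ~~ in_triangle u -> f u = 0) ->
  \int[triangle_law]_u f u = 2%:E * \int[leb2]_u f u.
Proof.
move=> mf f0 fsupp.
pose m0 : {measure set (measurableTypeR R * measurableTypeR R) -> \bar R} :=
  [the measure _ _ of mrestr leb2 measurable_open_triangle].
pose idR (u : measurableTypeR R * measurableTypeR R) : R * R := u.
have mid : measurable_fun setT idR by exact: measurable_id.
have mf' : measurable_fun setT (f \o idR) by exact: measurableT_comp mf mid.
transitivity (\int[pushforward (mscale (NngNum (ler0n R 2)) m0) idR]_u f u).
  by [].
rewrite (ge0_integral_pushforward mid)//.
rewrite preimage_setT.
rewrite (@ge0_integral_mscale _ _ _ m0 setT measurableT _ _ mf'); last first.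
  by move=> u _; exact: f0.
have key : \int[m0]_u (f \o idR) u = \int[leb2]_u f u.
  have fE : f = f \_ open_triangle.
    apply/funext => u; rewrite patchE; case: ifPn => //.
    by rewrite notin_setE => /negP h; rewrite fsupp.
  rewrite -[LHS]/(\int[m0]_u f u) fE -!integral_mkcond.
  apply: eq_measure_integral => A mA AT.
  by rewrite /= /mrestr setIidl.
exact: (congr1 (fun x => 2%:E * x) key).
Qed.

(** The part of the triangle below the ray AV and above the chord VB is the
preimage of the whole triangle. *)
Lemma in_triangle_zoom (V u : R * R) : in_triangle V ->
  in_triangle (zoom V u) = below_ray V u && above_chord V u.
Proof.
case: V u => [s0 c0] [s c] /and3P[/= h1 h2 h3].
have k1 : (0 < 1 - s0)%R by lra.
have k2 : (0 < s0)%R by lra.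
rewrite /in_triangle /zoom /below_ray /above_chord /=.
have -> : ((s - s0) / (1 - s0) < 1)%R = (s < 1)%R.
  by rewrite ltr_pdivrMr// mul1r ltrD2r.
have -> : (0 < (c - c0 * (1 - (s - s0) / (1 - s0))) * (s0 / c0))%R = (c0 * (1 - s) < c * (1 - s0))%R.
  rewrite pmulr_lgt0 ?divr_gt0// -(pmulr_rgt0 _ k1) -[RHS]subr_gt0; congr (0 < _)%R.
  by field; lra.
have -> : ((c - c0 * (1 - (s - s0) / (1 - s0))) * (s0 / c0) < (s - s0) / (1 - s0))%R = (c * s0 < c0 * s)%R.
  rewrite -subr_gt0 -(pmulr_rgt0 _ h1) -[RHS]subr_gt0; congr (0 < _)%R.
  by field; lra.
case: (ltP s 1%R) => s1; last by rewrite !andbF.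
case: (ltP (c * s0)%R (c0 * s)%R) => h4; last by rewrite !andbF.
rewrite !andbT; case: ltP => h5; last by rewrite andbF.
rewrite andbT; apply/esym.
have : (0 < c0 * (1 - s))%R by rewrite mulr_gt0// subr_gt0.
by move=> /lt_trans /(_ h5); rewrite pmulr_lgt0.
Qed.

Lemma below_ray_in_triangle (V u : R * R) : in_triangle V -> below_ray V u -> in_triangle u.
Proof.
case: V u => [s0 c0] [s c] /and3P[/= h1 h2 h3] /and3P[/= g1 g2 g3].
rewrite /in_triangle/= g1 g2 andbT/=.
have s0p : (0 < s0)%R by lra.
have sp : (0 < s)%R.
  by rewrite -(pmulr_rgt0 _ h1) (lt_trans _ g3)// mulr_gt0.
rewrite -(ltr_pM2r s0p) (lt_trans g3)// mulrC ltr_pM2l//.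
Qed.

(** A point falling in the part that is zoomed is uniform there, up to the
mass of that part. *)
Lemma triangle_law_zoom (V : R * R) (E : set (R * R)) : in_triangle V ->
  measurable E ->
  triangle_law [set u | (below_ray V u && above_chord V u) /\ E (zoom V u)] =
  ((1 - V.1) * V.2 / V.1)%:E * triangle_law E.
Proof.
move=> VT mE; rewrite !triangle_lawE muleCA; congr (_ * _).
have -> : [set u | (below_ray V u && above_chord V u) /\ E (zoom V u)] `&` open_triangle =
   zoom V @^-1` (E `&` open_triangle).
  apply/seteqP; split => u /=.
    by rewrite /open_triangle/= in_triangle_zoom// => -[[-> Eu] _].
  rewrite /open_triangle/= in_triangle_zoom// => -[Eu /andP[h1 h2]].
  by rewrite h1 h2; split=> //; exact: below_ray_in_triangle h1.
case: V VT => s0 c0 /= VT; have /and3P[/= h1 h2 h3] := VT.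
have k1 : (0 < 1 - s0)%R by lra.
have k2 : (0 < s0)%R by lra.
have zE : zoom (s0, c0) = fun u => (- s0 / (1 - s0) + (1 - s0)^-1 * u.1,
   - s0 / (1 - s0) + s0 / (1 - s0) * u.1 + s0 / c0 * u.2)%R.
  by apply/funext => u; rewrite /zoom/=; congr (_, _); field; lra.
rewrite zE area_triangular ?invr_gt0 ?divr_gt0//; last first.
  by apply: measurableI => //; exact: measurable_open_triangle.
by congr (_%:E * _); field; lra.
Qed.

Lemma triangle_law_below_ray (V : R * R) : in_triangle V ->
  triangle_law [set u | below_ray V u] = (V.2 / V.1)%:E.
Proof.
case: V => s0 c0 VT; have /and3P[/= h1 h2 h3] := VT.
have k2 : (0 < s0)%R by lra.
rewrite triangle_lawE setIidl; last by move=> u; exact: below_ray_in_triangle.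
have -> : [set u | below_ray (s0, c0) u] =
  (fun u => (0 + 1 * u.1, 0 + 0 * u.1 + s0 / c0 * u.2)%R) @^-1` open_triangle.
  apply/seteqP; split => -[s c] /=; rewrite /below_ray /open_triangle/= /in_triangle/=;
    rewrite !add0r mul1r mul0r add0r pmulr_rgt0 ?divr_gt0// mulrAC ltr_pdivrMr//;
    by rewrite (mulrC c) (mulrC c0) andbC -andbA => /and3P[-> -> ->].
rewrite area_triangular ?divr_gt0//; last exact: measurable_open_triangle.
by rewrite area_open_triangle -!EFinM; congr EFin; field; lra.
Qed.

Lemma measurable_below_ray (V : R * R) : measurable_fun setT (below_ray V).
Proof.
apply: measurable_and; first exact: measurable_fun_ltr.
by apply: measurable_and; apply: measurable_fun_ltr => //; exact: measurable_funM.
Qed.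

Lemma measurable_above_chord (V : R * R) : measurable_fun setT (above_chord V).
Proof.
apply: measurable_fun_ltr; apply: measurable_funM => //; exact: measurable_funB.
Qed.

Lemma measurable_zoom (V : R * R) : measurable_fun setT (zoom V).
Proof.
have m1 : measurable_fun setT (fun u : R * R => (u.1 - V.1) / (1 - V.1))%R.
  by apply: measurable_funM => //; exact: measurable_funB.
apply/measurable_fun_pair => //=.
apply: measurable_funM => //; apply: measurable_funB => //.
by apply: measurable_funM => //; exact: measurable_funB.
Qed.

(** Computed as a difference: the points below the ray minus those above the
chord. *)
Lemma triangle_law_below_chord (V : R * R) : in_triangle V ->
  triangle_law [set u | below_ray V u && ~~ above_chord V u] = V.2%:E.
Proof.
move=> VT.
pose W := [set u | below_ray V u && above_chord V u].
have mW : measurable W.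
  by apply: measurable_pred; apply: measurable_and;
    [exact: measurable_below_ray|exact: measurable_above_chord].
have -> : [set u | below_ray V u && ~~ above_chord V u] = [set u | below_ray V u] `\` W.
  apply/seteqP; split => u /=.
    by move=> /andP[h1 h2]; rewrite /W/= h1 (negbTE h2).
  by rewrite /W /= => -[h1]; rewrite h1/= => /negP.
have mB : measurable [set u | below_ray V u].
  by apply: measurable_pred; exact: measurable_below_ray.
have -> : triangle_law ([set u | below_ray V u] `\` W) =
    triangle_law [set u | below_ray V u] - triangle_law W.
  rewrite (measureD mB mW); last by rewrite ltey_eq fin_num_measure.
  by rewrite setIidr// => u /andP[].
rewrite triangle_law_below_ray//.
have := triangle_law_zoom VT measurableT.
rewrite triangle_law_setT mule1 => h.
have -> : W = [set u | (below_ray V u && above_chord V u) /\ setT (zoom V u)].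
  by apply/seteqP; split=> u /= => [|[]].
rewrite h -EFinB; congr EFin; have /and3P[h1 h2 h3] := VT.
have V1_neq0 : V.1 != 0%R by rewrite gt_eqF// (lt_trans h1 h2).
by field.
Qed.

Lemma integral_triangle_law_monomial (g : R -> R) (N : nat) :
  measurable_fun setT g -> (forall s, (0 < s < 1)%R -> (0 <= g s)%R) ->
  \int[triangle_law]_u (if in_triangle u then g u.1 * u.2 ^+ N else 0)%:E =
  2%:E * \int[leb]_s (if (0 < s < 1)%R then g s * s ^+ N.+1 / N.+1%:R else 0)%:E.
Proof.
move=> mg g0; rewrite integral_triangle_law ?integral_triangle_monomial//.
- apply/measurable_EFinP; apply: measurable_fun_ifT => //; first exact: measurable_in_triangle.
  apply: measurable_funM; first exact: measurableT_comp.
  exact: measurable_funX.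
- move=> u; rewrite lee_fin; case: ifP => // /and3P[h1 h2 h3].
  by rewrite mulr_ge0 ?exprn_ge0 ?(ltW h1)// g0// h3 (lt_trans h1 h2).
- by move=> u /negbTE ->.
Qed.

Definition closed_triangle : set (R * R) := [set u | (0 <= u.2 <= u.1)%R && (u.1 <= 1)%R].

Lemma measurable_closed_triangle : measurable closed_triangle.
Proof.
apply: measurable_pred; apply: measurable_and; last exact: measurable_fun_ler.
by apply: measurable_and; apply: measurable_fun_ler.
Qed.

Lemma area_vertical_line (a : R) : leb2 [set u : R * R | u.1 = a] = 0.
Proof.
have -> : [set u : R * R | u.1 = a] = [set a] `*` setT.
  by apply/seteqP; split => u //= [].
rewrite product_measure1E; [|exact: measurable_set1|exact: measurableT].
rewrite [X in X * _](_ : _ = 0) ?mul0e//; exact: lebesgue_measure_set1.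
Qed.

Lemma measurable_line (a b c : R) : measurable [set u : R * R | (a * u.1 + b * u.2 = c)%R].
Proof.
have -> : [set u : R * R | (a * u.1 + b * u.2 = c)%R] = [set u : R * R | (a * u.1 + b * u.2 == c)%R].
  by apply/seteqP; split => u /= /eqP.
apply: measurable_pred; apply: measurable_fun_eqr => //.
by apply: measurable_funD; exact: measurable_funM.
Qed.

Lemma area_horizontal_line (a : R) : leb2 [set u : R * R | u.2 = a] = 0.
Proof.
rewrite -area_swap ?area_vertical_line//.
have -> : [set u : R * R | u.2 = a] = [set u : R * R | (0 * u.1 + 1 * u.2 = a)%R].
  by apply/seteqP; split => u /=; rewrite mul0r mul1r add0r.
exact: measurable_line.
Qed.

Lemma area_diagonal : leb2 [set u : R * R | u.2 = u.1] = 0.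
Proof.
have -> : [set u : R * R | u.2 = u.1] =
   (fun u => (0 + 1 * u.1, 0 + -1 * u.1 + 1 * u.2)%R) @^-1` [set u : R * R | u.2 = 0%R].
  by apply/seteqP; split => u /=; rewrite ?add0r; lra.
rewrite area_triangular// ?area_horizontal_line ?mule0//.
have -> : [set u : R * R | u.2 = 0%R] = [set u : R * R | (0 * u.1 + 1 * u.2 = 0)%R].
  by apply/seteqP; split => u /=; rewrite mul0r mul1r add0r.
exact: measurable_line.
Qed.

(** The boundary consists of three segments, which have measure zero. *)
Lemma area_closed_triangle (E : set (R * R)) : measurable E ->
  leb2 (E `&` closed_triangle) = leb2 (E `&` open_triangle).
Proof.
move=> mE.
pose m2 : {measure set (measurableTypeR R * measurableTypeR R) -> \bar R} :=
  [the measure _ _ of leb2].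
have mO : measurable (E `&` open_triangle).
  by apply: measurableI => //; exact: measurable_open_triangle.
have mC : measurable (E `&` closed_triangle).
  by apply: measurableI => //; exact: measurable_closed_triangle.
have mh : measurable [set u : R * R | u.2 = 0%R].
  have -> : [set u : R * R | u.2 = 0%R] = [set u : R * R | (0 * u.1 + 1 * u.2 = 0)%R].
    by apply/seteqP; split => u /=; rewrite mul0r mul1r add0r.
  exact: measurable_line.
have mv : measurable [set u : R * R | u.1 = 1%R].
  have -> : [set u : R * R | u.1 = 1%R] = [set u : R * R | (1 * u.1 + 0 * u.2 = 1)%R].
    by apply/seteqP; split => u /=; rewrite mul0r mul1r addr0.
  exact: measurable_line.
have md : measurable [set u : R * R | u.2 = u.1].
  have -> : [set u : R * R | u.2 = u.1] = [set u : R * R | (-1 * u.1 + 1 * u.2 = 0)%R].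
    by apply/seteqP; split => u /=; lra.
  exact: measurable_line.
apply/eqP; rewrite eq_le; apply/andP; split; last first.
  apply: (@le_measure _ _ _ m2); rewrite ?inE// => u [Eu /and3P[/= h1 h2 h3]]; split => //.
  by rewrite /closed_triangle/= !ltW.
pose L := [set u : R * R | u.2 = 0%R] `|` ([set u | u.2 = u.1] `|` [set u | u.1 = 1%R]).
have mL : measurable L by do 2 apply: measurableU => //.
have L0 : m2 L = 0.
  have e1 : m2 [set u : R * R | u.2 = 0%R] = 0 by exact: area_horizontal_line.
  have e2 : m2 [set u : R * R | u.2 = u.1] = 0 by exact: area_diagonal.
  have e3 : m2 [set u : R * R | u.1 = 1%R] = 0 by exact: area_vertical_line.
  apply/eqP; rewrite eq_le measure_ge0 andbT.
  have i1 : m2 L <= m2 [set u : R * R | u.2 = 0%R] +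
      m2 ([set u : R * R | u.2 = u.1] `|` [set u | u.1 = 1%R]).
    exact: (measureU2 m2 mh (measurableU _ _ md mv)).
  have i2 : m2 ([set u : R * R | u.2 = u.1] `|` [set u | u.1 = 1%R]) <=
      m2 [set u : R * R | u.2 = u.1] + m2 [set u : R * R | u.1 = 1%R].
    exact: (measureU2 m2 md mv).
  by move: i1; rewrite e1 add0e => /le_trans; apply; rewrite e2 e3 adde0 in i2.
have sub : E `&` closed_triangle `<=` (E `&` open_triangle) `|` L.
  move=> u [Eu /andP[/andP[/= h1 h2] h3]].
  have [e1|n1] := eqVneq u.2 0%R; first by right; left.
  have [e2|n2] := eqVneq u.2 u.1; first by right; right; left.
  have [e3|n3] := eqVneq u.1 1%R; first by right; right; right.
  left; split => //; rewrite /open_triangle/= /in_triangle.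
  by rewrite !lt_neqAle h1 h2 h3 n2 n3 eq_sym n1.
apply: (@le_trans _ _ (m2 ((E `&` open_triangle) `|` L))).
  by apply: (@le_measure _ _ _ m2); rewrite ?inE//; exact: measurableU.
have i3 : m2 ((E `&` open_triangle) `|` L) <= m2 (E `&` open_triangle) + m2 L.
  exact: (measureU2 m2 mO mL).
by rewrite L0 adde0 in i3.
Qed.

Lemma area_shear (E : set (R * R)) : measurable E ->
  leb2 (shear @^-1` E) = 2%:E * leb2 E.
Proof.
move=> mE.
pose tri (u : R * R) := (0 + 1 * u.1, 0 + 2^-1 * u.1 + 2^-1 * u.2)%R.
pose sw (u : R * R) := (u.2, u.1).
have msw A : measurable A -> measurable (sw @^-1` A).
  move=> mA; have : measurable_fun setT sw by exact/measurable_fun_pair.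
  by move=> /(_ measurableT _ mA); rewrite setTI.
have mtri A : measurable A -> measurable (tri @^-1` A).
  move=> mA; have : measurable_fun setT tri.
    apply/measurable_fun_pair => //=; first by apply: measurable_funD => //; exact: measurable_funM.
    by do 2?[apply: measurable_funD => //]; exact: measurable_funM.
  by move=> /(_ measurableT _ mA); rewrite setTI.
have -> : shear @^-1` E = sw @^-1` (tri @^-1` (sw @^-1` E)).
  apply/seteqP; split => u /=; rewrite /shear /sw /tri /=; congr (E _); congr (_, _); by field.
have half_gt0 : (0 < 2^-1 :> R)%R by rewrite invr_gt0.
transitivity (leb2 (tri @^-1` (sw @^-1` E))).
  exact: (area_swap (mtri _ (msw _ mE))).
transitivity ((1 * 2^-1)^-1%:E * leb2 (sw @^-1` E)).
  exact: (area_triangular 0 0 2^-1 ltr01 half_gt0 (msw _ mE)).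
have -> : ((1 * 2^-1)^-1 = 2 :> R)%R by rewrite mul1r invrK.
exact: (congr1 (fun x => 2%:E * x) (area_swap mE)).
Qed.

(** In sheared coordinates, a uniform point of the closed triangle ABC has the
law [triangle_law]. *)
Lemma uniform_shear d (T : measurableType d) (P : probability T R)
    (X : {RV P >-> (R * R)%type}) (E : set (R * R)) :
  uniform_on (triangle R) X -> measurable E ->
  P ((shear \o X) @^-1` E) = triangle_law E.
Proof.
move=> Xunif mE.
have msh : measurable_fun setT (@shear R).
  apply/measurable_fun_pair => //=; apply: measurable_funM => //; exact: measurable_funD.
have mpre (A : set (R * R)) : measurable A -> measurable (shear @^-1` A).
  by move=> mA; have := msh measurableT _ mA; rewrite setTI.
have tE (A : set (R * R)) : measurable A -> area (shear @^-1` A `&` triangle R) = triangle_law A.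
  move=> mA.
  have -> : shear @^-1` A `&` triangle R = shear @^-1` (A `&` closed_triangle).
    rewrite triangleE preimage_setI; congr (_ `&` _).
    apply/seteqP; split => u; rewrite /closed_triangle /shear/=.
      by move=> [h1 h2 h3]; rewrite h1/=; apply/andP; split; lra.
    by move=> /andP[/andP[h1 h2] h3]; split => //; lra.
  rewrite /area area_shear; last first.
    by apply: measurableI => //; exact: measurable_closed_triangle.
  by rewrite area_closed_triangle.
have aT : area (triangle R) = 1.
  rewrite -[RHS]triangle_law_setT -(tE _ measurableT) preimage_setT.
  by rewrite setTI.
have := Xunif (shear @^-1` E) (mpre _ mE).
by rewrite tE// aT inve1 mule1.
Qed.

End triangle_probability.

(** * Laws of independent samples *)

Section tuple_law.
Context {R : realType} d (T : measurableType d) (mu : probability T R).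
Local Open Scope ereal_scope.

Definition tcons N (x : T * N.-tuple T) : N.+1.-tuple T :=
  [the N.+1.-tuple T of x.1 :: x.2].

Lemma measurable_tcons N : measurable_fun setT (@tcons N).
Proof. exact: measurable_cons. Qed.

HB.instance Definition _ N :=
  isMeasurableFun.Build _ _ _ _ (@tcons N) (@measurable_tcons N).

(** The N-fold power of [mu], built by adding one coordinate at a time; the
recursion on the number of points integrates over the first one. *)
Fixpoint tuple_law (N : nat) : probability (N.-tuple T) R :=
  if N is N'.+1 then distribution (mu \x tuple_law N') (@tcons N')
  else \d_[tuple].

Lemma tuple_lawS N (E : set (N.+1.-tuple T)) :
  tuple_law N.+1 E = \int[mu]_x tuple_law N [set t | E (tcons (x, t))].
Proof.
apply: eq_integral => x _ /=; congr (tuple_law N _).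
by apply/seteqP; split=> t; rewrite /xsection/= inE.
Qed.

Lemma measurable_tuple_law_section N (E : set (N.+1.-tuple T)) : measurable E ->
  measurable_fun setT (fun x => tuple_law N [set t | E (tcons (x, t))]).
Proof.
move=> mE.
have mE' : measurable (@tcons N @^-1` E).
  by have := @measurable_tcons N measurableT _ mE; rewrite setTI.
have := measurable_fun_xsection (tuple_law N) mE'.
congr (measurable_fun _ _); apply/funext => x /=; congr (tuple_law N _).
by apply/seteqP; split=> t; rewrite /xsection/= inE.
Qed.

Lemma measurable_box N (E : 'I_N -> set T) : (forall i, measurable (E i)) ->
  measurable [set t : N.-tuple T | forall i, E i (tnth t i)].
Proof.
move=> mE.
have -> : [set t : N.-tuple T | forall i, E i (tnth t i)] =
   \bigcap_(i in [set: 'I_N]) ((fun t => tnth t i) @^-1` (E i)).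
  by apply/seteqP; split => t /= h i; [move=> _|]; exact: h.
apply: fin_bigcap_measurable => // i _.
by rewrite -[X in measurable X]setTI; exact: measurable_tnth.
Qed.

Lemma tuple_law_box N (E : 'I_N -> set T) : (forall i, measurable (E i)) ->
  tuple_law N [set t : N.-tuple T | forall i, E i (tnth t i)] = \prod_(i < N) mu (E i).
Proof.
elim: N E => [|N IH] E mE.
  by rewrite big_ord0 /= diracE mem_set//= => -[].
rewrite tuple_lawS big_ord_recl /=.
transitivity (\int[mu]_x ((\1_(E ord0) x)%:E * \prod_(i < N) mu (E (lift ord0 i)))).
  apply: eq_integral => x _; rewrite indicE.
  have [xE|xE] := boolP (x \in E ord0).
    rewrite mul1e -IH; last by move=> i; exact: mE.
    congr (tuple_law N _); apply/seteqP; split => t /= h.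
      by move=> i; have := h (lift ord0 i); rewrite tnthS.
    move=> i; case: (unliftP ord0 i) => [j ->|->]; first by rewrite tnthS.
    by rewrite tnth0; exact/set_mem.
  rewrite mul0e -[RHS](measure0 (tuple_law N)); congr (tuple_law N _).
  apply/seteqP; split => t //= /(_ ord0); rewrite tnth0 => h.
  by move/negP : xE; apply; exact/mem_set.
rewrite ge0_integralZr//.
- by rewrite integral_indic// setIT.
- by apply/measurable_EFinP; exact: measurable_indic.
- by apply: prode_ge0 => i _; exact: measure_ge0.
Qed.

(** Boxes are stable under intersection and generate the measurable sets of
tuples. *)
Lemma tuple_law_unique N (nu : probability (N.-tuple T) R) :
  (forall E : 'I_N -> set T, (forall i, measurable (E i)) ->
    nu [set t : N.-tuple T | forall i, E i (tnth t i)] = \prod_(i < N) mu (E i)) ->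
  forall A, measurable A -> nu A = tuple_law N A.
Proof.
move=> nuE A mA.
pose G : set (set (N.-tuple T)) := [set B | exists E : 'I_N -> set T,
   (forall i, measurable (E i)) /\ B = [set t | forall i, E i (tnth t i)]].
apply: (@measure_unique _ _ _ G (fun=> setT)) => //.
- apply/seteqP; split.
    apply: smallest_sub; first exact: smallest_sigma_algebra.
    move=> B; rewrite -bigcup_seq => -[i /= _ [C mC <-]].
    apply: sub_sigma_algebra; exists (fun j => if j == i then C else setT).
    split=> [j|]; first by case: ifP.
    rewrite setTI; apply/seteqP; split => t /=.
      by move=> Ct j; case: ifP => // /eqP ->.
    by move=> /(_ i); rewrite eqxx.
  apply: smallest_sub; first exact: sigma_algebra_measurable.
  by move=> _ [E [mE ->]]; exact: measurable_box.
- move=> _ _ [E1 [mE1 ->]] [E2 [mE2 ->]].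
  exists (fun i => E1 i `&` E2 i); split=> [i|]; first exact: measurableI.
  apply/seteqP; split => t /=; first by move=> [h1 h2] i; split.
  by move=> h; split => i; have [] := h i.
- move=> _; exists (fun=> setT); split => //; exact/seteqP.
- by rewrite bigcup_const.
- by move=> _ [E [mE ->]]; exact: (etrans (nuE _ mE) (esym (tuple_law_box mE))).
- by move=> k; rewrite (le_lt_trans (probability_le1 _ _))// ltry.
Qed.

End tuple_law.

Section iid.
Context {R : realType} d (T : measurableType d) (mu : probability T R).
Context d' (Om : measurableType d') (P : probability Om R).
Local Open Scope ereal_scope.

Lemma iid_tuple_law N (Y : 'I_N -> Om -> T) :
  (forall i, measurable_fun setT (Y i)) ->
  (forall E : 'I_N -> set T, (forall i, measurable (E i)) ->
    P [set w | forall i, E i (Y i w)] = \prod_(i < N) mu (E i)) ->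
  forall A, measurable A -> P [set w | A [tuple Y i w | i < N]] = tuple_law mu N A.
Proof.
move=> mY PE A mA.
pose f (w : Om) := [the N.-tuple T of [tuple Y i w | i < N]].
have mf : measurable_fun setT f.
  apply/measurable_fun_tnthP => i.
  rewrite (_ : _ \o _ = Y i)//; apply/funext => w /=.
  by rewrite tnth_mktuple.
pose fM : {mfun Om >-> N.-tuple T} := HB.pack f (isMeasurableFun.Build _ _ _ _ f mf).
rewrite -[LHS]/(distribution P fM A).
apply: tuple_law_unique => // E mE.
rewrite -PE//; congr (P _); apply/seteqP; split => w /= h i; have := h i.
  by rewrite tnth_mktuple.
by rewrite tnth_mktuple.
Qed.

End iid.

Lemma tuple_law_perm {R : realType} d (T : measurableType d) (mu : probability T R)
    N (s : 'S_N) (A : set (N.-tuple T)) : measurable A ->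
  tuple_law mu N [set t | A [tuple tnth t (s i) | i < N]] = tuple_law mu N A.
Proof.
move=> mA; apply: (@iid_tuple_law _ _ _ mu _ _ (tuple_law mu N) N
  (fun i t => tnth t (s i))) => //.
  by move=> i; exact: measurable_tnth.
move=> E mE.
rewrite (reindex_inj (@perm_inj _ s^-1%g)) -tuple_law_box; last by move=> i; exact: mE.
congr (tuple_law mu N _); apply/seteqP; split => t /= h i.
  by have := h (s^-1%g i); rewrite permKV.
by have := h (s i); rewrite permK.
Qed.

(** * Thinning an independent sample *)

Section thinning.
Context {R : realType} d (T : measurableType d) (mu : probability T R).
Local Open Scope ereal_scope.

(** A condition on samples of all sizes at once: the size of the sample
changes during thinning. *)
Definition measurable_on_tuples (H : set (seq T)) :=
  forall N, measurable [set t : N.-tuple T | H t].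

Lemma measurable_on_tuples_cons (H : set (seq T)) (u : T) :
  measurable_on_tuples H -> measurable_on_tuples [set l | H (u :: l)].
Proof.
move=> mH N.
have m1 : measurable_fun setT (fun t : N.-tuple T => tcons (u, t)).
  exact: (measurable_cons (measurable_cst u) (@measurable_id _ _ setT)).
by have := m1 measurableT _ (mH N.+1); rewrite setTI.
Qed.

Lemma measurable_tuple_law_cons (H : set (seq T)) N : measurable_on_tuples H ->
  measurable_fun setT (fun u => tuple_law mu N [set t | H (u :: t)]).
Proof. by move=> mH; exact: (measurable_tuple_law_section mu (mH N.+1)). Qed.

Lemma tuple_law_fineK N (E : set (N.-tuple T)) : measurable E ->
  (fine (tuple_law mu N E))%:E = tuple_law mu N E.
Proof. by move=> mE; rewrite fineK// fin_num_measure. Qed.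

Variables (p q : T -> bool) (phi : T -> T) (a b : R).
Hypotheses (mp : measurable_fun setT p) (mq : measurable_fun setT q)
  (mphi : measurable_fun setT phi).

Hypothesis keep_law : forall E, measurable E ->
  mu [set u | (p u && q u) /\ E (phi u)] = b%:E * mu E.
Hypothesis drop_law : mu [set u | p u && ~~ q u] = a%:E.
Hypotheses (a_ge0 : (0 <= a)%R) (b_ge0 : (0 <= b)%R).

(** The image under [phi] of [mu] restricted to the kept points is [b] times
[mu]. *)
Lemma integral_keep (G : T -> \bar R) : measurable_fun setT G -> (forall u, 0 <= G u) ->
  \int[mu]_(u in [set u | p u && q u]) G (phi u) = b%:E * \int[mu]_u G u.
Proof.
move=> mG G0.
have mW : measurable [set u | p u && q u] by apply: (@measurable_pred _ _ (fun u => p u && q u)); apply: measurable_and.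
rewrite -(@ge0_integral_mscale _ _ _ mu setT measurableT (NngNum b_ge0) G)//.
pose m := mrestr mu mW.
transitivity (\int[pushforward m phi]_u G u); last first.
  apply: eq_measure_integral => A mA _.
  rewrite -[RHS]/(b%:E * mu A) -keep_law//; congr (mu _).
  by apply/seteqP; split => u /= [].
rewrite ge0_integral_pushforward//= preimage_setT.
have mGphi : measurable_fun setT (G \o phi) by exact: measurableT_comp.
have mWc := measurableC mW.
rewrite -[X in \int[m]_(x in X) _](setvU [set u | p u && q u]) ge0_integral_setU//; last 2 first.
- exact: measurable_funTS mGphi.
- by rewrite disj_set2E setICl.
rewrite (eq_measure_integral mzero); last first.
  move=> A mA AW; rewrite /m /= /mrestr (_ : A `&` _ = set0) ?measure0//.
  by apply/seteqP; split => u // -[/AW].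
rewrite integral_measure_zero add0e; apply: eq_measure_integral => A mA AW.
by rewrite /= /m /mrestr setIidl.
Qed.

(** Pascal's rule, summed against a sequence. *)
Lemma pascal_shift (r : nat -> R) N :
  (b * (\sum_(j < N.+1) ('C(N, j)%:R * a ^+ (N - j) * b ^+ j) * r j.+1) +
   (\sum_(j < N.+1) ('C(N, j)%:R * a ^+ (N - j) * b ^+ j) * r j) * a =
   \sum_(j < N.+2) ('C(N.+1, j)%:R * a ^+ (N.+1 - j) * b ^+ j) * r j)%R.
Proof.
rewrite [RHS]big_ord_recl [X in (_ + X * _)%R]big_ord_recl /= !bin0 !subn0 !expr0 !mul1r !mulr1.
rewrite mulrDl addrCA; congr (_ + _)%R; first by rewrite exprSr mulrAC.
have -> : (\sum_(i < N) 'C(N, bump 0 i)%:R * a ^+ (N - bump 0 i) * b ^+ bump 0 i * r (bump 0 i) =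
   \sum_(i < N.+1) 'C(N, i.+1)%:R * a ^+ (N - i.+1) * b ^+ i.+1 * r i.+1)%R.
  by rewrite big_ord_recr /= bin_small// !mul0r addr0.
rewrite mulr_sumr mulr_suml -big_split /=; apply: eq_bigr => i _.
rewrite /bump /= add1n binS natrD subSS !mulrDl addrC; congr (_ + _)%R; last first.
  by rewrite exprS; ring.
have [iN|Ni] := ltnP i N; last by rewrite bin_small ?mul0r.
have -> : (N - i = (N - i.+1).+1)%N by rewrite -subSn.
by rewrite (exprSr a); ring.
Qed.

(** The points of a sample are refused ([p] fails), dropped (probability [a]),
or kept and moved by [phi], in which case they have law [mu] again (mass [b]).
On the event that no point is refused, the survivors form an independent
sample whose size has binomial weights. Peeling off the first point turns the
claim into Pascal's rule. *)
Lemma tuple_law_thinning (H : set (seq T)) N : measurable_on_tuples H ->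
  tuple_law mu N [set t | all p t /\ H (map phi [seq u <- t | q u])] =
  \sum_(j < N.+1) ('C(N, j)%:R * a ^+ (N - j) * b ^+ j)%:E *
     tuple_law mu j [set t | H t].
Proof.
elim: N H => [|N IH] H mH.
  rewrite big_ord1 bin0 !mul1r mul1e; congr (tuple_law mu 0 _).
  by apply/seteqP; split => t /=; rewrite (tuple0 t)//= => -[].
have c0 j : (0 <= 'C(N, j)%:R * a ^+ (N - j) * b ^+ j)%R.
  by rewrite !mulr_ge0 ?exprn_ge0.
pose S (K : set (seq T)) := \sum_(j < N.+1) ('C(N, j)%:R * a ^+ (N - j) * b ^+ j)%:E *
     tuple_law mu j [set t | K t].
have S0 K : 0 <= S K.
  by apply: sume_ge0 => j _; rewrite mule_ge0// lee_fin.
(* what remains to be sampled once [u] is known to be kept *)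
pose G u := S [set l | H (u :: l)].
have mG : measurable_fun setT G.
  apply: emeasurable_sum => j; apply: measurable_funeM.
  exact: measurable_tuple_law_cons.
have mW : measurable [set u | p u && q u].
  by apply: (@measurable_pred _ _ (fun u => p u && q u)); apply: measurable_and.
have mZ : measurable [set u | p u && ~~ q u].
  apply: (@measurable_pred _ _ (fun u => p u && ~~ q u)); apply: measurable_and => //.
  exact: measurable_neg.
rewrite tuple_lawS.
transitivity (\int[mu]_u (((G \o phi) \_ [set u | p u && q u]) u +
   (cst (S H) \_ [set u | p u && ~~ q u]) u)).
  apply: eq_integral => u _; rewrite !patchE /=.
  have -> : (u \in [set u | p u && q u]) = p u && q u.
    by apply/idP/idP => [/set_mem|/mem_set].
  have -> : (u \in [set u | p u && ~~ q u]) = p u && ~~ q u.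
    by apply/idP/idP => [/set_mem|/mem_set].
  case pu : (p u) => /=; last first.
    rewrite adde0 -[RHS](measure0 (tuple_law mu N)); congr (tuple_law mu N _).
    by apply/seteqP; split => t //= [].
  case qu : (q u) => /=.
    by rewrite adde0 /G /S -IH; last exact: measurable_on_tuples_cons.
  by rewrite add0e /S -IH.
rewrite ge0_integralD//; last 4 first.
- by move=> u _; apply: erestrict_ge0 => v _; exact: S0.
- apply/(measurable_restrict _ _ _) => //.
  by apply: measurable_funTS; apply: measurableT_comp mphi.
- by move=> u _; apply: erestrict_ge0 => v _; exact: S0.
- apply/(measurable_restrict _ _ _) => //.
rewrite -!integral_mkcond integral_cst//.
have -> : \int[mu]_(x in [set u | p u && q u]) (G \o phi) x = b%:E * \int[mu]_u G u.
  by apply: integral_keep => // u; exact: S0.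
rewrite [X in _ + _ * X](_ : _ = a%:E); last exact: drop_law.
rewrite /G /S ge0_integral_sum//; last 2 first.
- move=> j; apply: measurable_funeM; exact: measurable_tuple_law_cons.
- by move=> j u _; rewrite mule_ge0// lee_fin.
under eq_bigr => j _.
  rewrite ge0_integralZl//; last 2 first.
  - exact: measurable_tuple_law_cons.
  - by rewrite lee_fin.
  rewrite -(tuple_lawS mu [set t | H t]) -(tuple_law_fineK (mH _)) -EFinM.
  over.
under [X in _ + X * _]eq_bigr => j _.
  rewrite -(tuple_law_fineK (mH _)) -EFinM.
  over.
under [RHS]eq_bigr => j _.
  rewrite -(tuple_law_fineK (mH _)) -EFinM.
  over.
rewrite !sumEFin -!EFinM -EFinD; congr EFin.
exact: (pascal_shift (fun j => fine (tuple_law mu j [set t | H t]))).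
Qed.

End thinning.

(** * Measurability of the number of vertices *)

Section measurable_chain.
Context {R : realType}.
Implicit Types (l : seq (R * R)) (x y : R * R).

Lemma rat_approx (a e : R) : 0 < e -> exists q : rat, `|ratr q - a| < e.
Proof.
move=> e0; have [q] : exists q : rat, (ratr q : R) \in `]a - e, a + e[ by apply: rat_in_itvoo; lra.
by rewrite in_itv/= => /andP[h1 h2]; exists q; rewrite ltr_norml; apply/andP; split; lra.
Qed.

(** Being exposed is an open condition on the linear form, so that rational
forms suffice; this expresses exposedness by countably many inequalities. *)
Lemma exposed_rational l x : exposed l x <->
  exists f : rat * rat, forall y, y \in l -> y != x -> 0 < gap (ratr f.1, ratr f.2) x y.
Proof.
split; last by move=> [f hf]; exists (ratr f.1, ratr f.2).
move=> [f hf].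
have [|e e0 he] := @small_perturbation _ _ [seq y <- l | y != x] (gap f x)
   (fun y => - (`|y.1 - x.1| + `|y.2 - x.2|)).
  by move=> y; rewrite mem_filter => /andP[yx yl]; exact: hf.
have [q1 h1] := rat_approx f.1 e0.
have [q2 h2] := rat_approx f.2 e0.
exists (q1, q2) => y yl yx.
have := he y; rewrite mem_filter yx yl => /(_ isT).
have hq (q a z : R) : `|q - a| < e -> a * z - e * `|z| <= q * z.
  move=> qa; have : - ((q - a) * z) <= e * `|z|.
    by rewrite (le_trans (ler_norm _))// normrN normrM ler_wpM2r// ltW.
  by rewrite mulrBl; lra.
have := hq _ _ (y.1 - x.1) h1; have := hq _ _ (y.2 - x.2) h2.
by rewrite /gap/=; lra.
Qed.

Lemma measurable_gap_cond d (T : measurableType d) (f : R * R) (X Y : T -> R * R) :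
  measurable_fun setT X -> measurable_fun setT Y ->
  measurable [set t | Y t != X t -> 0 < gap f (X t) (Y t)].
Proof.
move=> mX mY.
have m1 (Z : T -> R * R) : measurable_fun setT Z -> measurable_fun setT (fun t : T => (Z t).1 : R).
  by move=> mZ; have /measurable_fun_pairP[] := mZ.
have m2 (Z : T -> R * R) : measurable_fun setT Z -> measurable_fun setT (fun t : T => (Z t).2 : R).
  by move=> mZ; have /measurable_fun_pairP[] := mZ.
have -> : [set t | Y t != X t -> 0 < gap f (X t) (Y t)] =
    [set t | ((Y t).1 == (X t).1) && ((Y t).2 == (X t).2)] `|`
    [set t | 0 < gap f (X t) (Y t)].
  apply/seteqP; split => t /=.
    move=> h; have [e|n] := eqVneq (Y t) (X t); first by left; rewrite e !eqxx.
    by right; exact: h.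
  move=> [/andP[/eqP e1 /eqP e2]|//].
  by rewrite (surjective_pairing (Y t)) e1 e2 -surjective_pairing eqxx.
apply: measurableU.
  apply: (@measurable_pred _ _ (fun t => ((Y t).1 == (X t).1) && ((Y t).2 == (X t).2))).
  by apply: measurable_and; apply: measurable_fun_eqr; (exact: m1 || exact: m2).
apply: (@measurable_pred _ _ (fun t => 0 < gap f (X t) (Y t))).
apply: measurable_fun_ltr => //; apply: measurable_funD; apply: measurable_funM => //;
  apply: measurable_funB; (exact: m1 || exact: m2).
Qed.

Lemma measurable_exposed (N : nat) (i : 'I_N) :
  measurable [set t : N.-tuple (R * R) | exposed ((0, 0) :: (1, 0) :: t) (tnth t i)].
Proof.
have -> : [set t : N.-tuple (R * R) | exposed ((0, 0) :: (1, 0) :: t) (tnth t i)] =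
  \bigcup_(f : rat * rat) ([set t : N.-tuple (R * R) |
        (0, 0) != tnth t i -> 0 < gap (ratr f.1, ratr f.2) (tnth t i) (0, 0)] `&`
     [set t : N.-tuple (R * R) |
        (1, 0) != tnth t i -> 0 < gap (ratr f.1, ratr f.2) (tnth t i) (1, 0)] `&`
     \bigcap_(j in [set: 'I_N]) [set t : N.-tuple (R * R) |
        tnth t j != tnth t i -> 0 < gap (ratr f.1, ratr f.2) (tnth t i) (tnth t j)]).
  apply/seteqP; split => t /=.
    move=> /exposed_rational[f hf]; exists f => //; split; first split.
    - by apply: hf; rewrite inE eqxx.
    - by apply: hf; rewrite !inE eqxx orbT.
    - by move=> j _ /=; apply: hf; rewrite !inE mem_tnth !orbT.
  move=> [f _ [[hA hB] hj]]; exists (ratr f.1, ratr f.2) => y.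
  rewrite !inE => /or3P[/eqP ->//|/eqP ->//|/tnthP[j ->]].
  exact: hj.
apply: countable_bigcupT_measurable; first exact: countableP.
move=> f; apply: measurableI; last first.
  apply: fin_bigcap_measurable => // j _.
  by apply: measurable_gap_cond; exact: measurable_tnth.
by apply: measurableI; apply: measurable_gap_cond; (exact: measurable_cst || exact: measurable_tnth).
Qed.

Lemma measurable_chain_vertices (k : nat) :
  measurable_on_tuples [set l : seq (R * R) | chain_vertices l = k].
Proof.
move=> N.
have -> : [set t : N.-tuple (R * R) | chain_vertices t = k] =
  \big[setU/set0]_(J : {set 'I_N} | #|J| == k)
   \bigcap_(i in [set: 'I_N]) (if i \in J then
       [set t : N.-tuple (R * R) | exposed ((0, 0) :: (1, 0) :: t) (tnth t i)]
     else ~` [set t : N.-tuple (R * R) | exposed ((0, 0) :: (1, 0) :: t) (tnth t i)]).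
  rewrite -bigcup_seq_cond.
  have cE (t : N.-tuple (R * R)) :
      chain_vertices t = #|[set i | `[< exposed ((0, 0) :: (1, 0) :: t) (tnth t i) >] ]%SET|.
    rewrite /chain_vertices -{2}(map_tnth_enum t) count_map cardE -size_filter.
    by congr size; rewrite enumT /enum_mem; apply: eq_filter => i; rewrite /= inE.
  apply/seteqP; split => t /=.
    rewrite cE => tk.
    exists [set i | `[< exposed ((0, 0) :: (1, 0) :: t) (tnth t i) >] ]%SET.
      by rewrite /= mem_index_enum tk eqxx.
    move=> i _ /=; rewrite inE; case: asboolP => h //.
  move=> [J /andP[_ /eqP <-] hJ]; rewrite cE; apply: eq_card => i; rewrite inE.
  have := hJ i Logic.I; case: ifP => _ /= h; exact/asboolP.
apply: bigsetU_measurable => J _; apply: fin_bigcap_measurable => // i _.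
by case: ifP => _; [|apply: measurableC]; exact: measurable_exposed.
Qed.

End measurable_chain.

(** * The recursion on the number of points *)

Section first_vertex.
Context {R : realType}.
Local Notation leb := (@lebesgue_measure R).
Local Notation law := (tuple_law (@triangle_law R)).
Local Open Scope ereal_scope.

Lemma measurable_inv : measurable_fun setT (fun x : R => x^-1)%R.
Proof.
rewrite -(setvU [set 0%R]); apply/measurable_funU => //; first exact: measurableC.
split; last exact: measurable_fun_set1.
apply: subspace_continuous_measurable_fun; first exact: measurableC.
apply: continuous_in_subspaceT => x; rewrite inE /= => /eqP x0.
exact: inv_continuous.
Qed.

(** The point [V] is the first vertex of the chain: all the other points have
a smaller slope seen from A. *)
Definition leads (V : R * R) (l : seq (R * R)) : bool := in_triangle V && all (below_ray V) l.

Lemma measurable_leads N :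
  measurable [set t : N.+1.-tuple (R * R) | leads (thead t) (behead t)].
Proof.
have mt i : measurable_fun setT (fun t : N.+1.-tuple (R * R) => tnth t i).
  exact: measurable_tnth.
have m1 i : measurable_fun setT (fun t : N.+1.-tuple (R * R) => (tnth t i).1).
  by have /measurable_fun_pairP[] := mt i.
have m2 i : measurable_fun setT (fun t : N.+1.-tuple (R * R) => (tnth t i).2).
  by have /measurable_fun_pairP[] := mt i.
have -> : [set t : N.+1.-tuple (R * R) | leads (thead t) (behead t)] =
  [set t : N.+1.-tuple (R * R) | in_triangle (tnth t ord0)] `&`
  \bigcap_(i in [set: 'I_N])
    [set t : N.+1.-tuple (R * R) | below_ray (tnth t ord0) (tnth t (lift ord0 i))].
  apply/seteqP; split => t /=; case/tupleP: t => u t; rewrite theadE /leads /= tnth0.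
    by move=> /andP[-> /all_tnthP h]; split => // i _ /=; rewrite tnth0 tnthS.
  move=> [-> h]; apply/all_tnthP => i; have := h i Logic.I.
  by rewrite /= tnth0 tnthS.
apply: measurableI.
  apply: (@measurable_pred _ _ (fun t : N.+1.-tuple (R * R) => in_triangle (tnth t ord0))).
  by apply: (measurableT_comp measurable_in_triangle).
apply: fin_bigcap_measurable => // i _.
apply: (@measurable_pred _ _ (fun t : N.+1.-tuple (R * R) =>
   below_ray (tnth t ord0) (tnth t (lift ord0 i)))).
apply: measurable_and; first by apply: measurable_fun_ltr => //; exact: m2.
apply: measurable_and; first by apply: measurable_fun_ltr => //; exact: m1.
by apply: measurable_fun_ltr; apply: measurable_funM; (exact: m1 || exact: m2).
Qed.

(** The probability that a given point leads a sample of N + 1 points, and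
that [j] of the others are above its chord. *)
Definition first_weight N j : R := 2 * (N.+1 - j)%:R / (N.+1%:R ^+ 2 * N.+2%:R).

(** Fubini reduces the double integral to a beta integral: the powers of V.2
combine to [V.2 ^+ N], whatever [j] is. *)
Lemma integral_first_vertex N j : (j <= N)%N ->
  \int[triangle_law]_V (if in_triangle V then
     'C(N, j)%:R * V.2 ^+ (N - j) * ((1 - V.1) * V.2 / V.1) ^+ j else 0)%:E =
  (first_weight N j)%:E.
Proof.
move=> jN.
pose g (s : R) := ('C(N, j)%:R * ((1 - s) / s) ^+ j)%R.
transitivity (\int[@triangle_law R]_V (if in_triangle V then g V.1 * V.2 ^+ N else 0)%:E).
  apply: eq_integral => V _; congr EFin; case: ifP => // _.
  have -> : (V.2 ^+ N = V.2 ^+ (N - j) * V.2 ^+ j)%R by rewrite -exprD subnK.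
  have -> : (((1 - V.1) * V.2 / V.1) ^+ j = ((1 - V.1) / V.1) ^+ j * V.2 ^+ j)%R.
    by rewrite -exprMn mulrAC.
  by rewrite /g; ring.
rewrite integral_triangle_law_monomial; last 2 first.
- apply: measurable_funM => //; apply: measurable_funX; apply: measurable_funM.
    exact: measurable_funB.
  exact: measurable_inv.
- move=> s /andP[s0 s1]; rewrite mulr_ge0// exprn_ge0// divr_ge0 ?ltW//.
  by rewrite subr_gt0.
transitivity (2%:E * \int[leb]_s (('C(N, j)%:R / N.+1%:R)%:E *
    (if (0 < s < 1)%R then s ^+ (N.+1 - j) * (1 - s) ^+ j else 0)%:E)).
  congr (_ * _); apply: eq_integral => s _; rewrite -EFinM; congr EFin.
  case: ifP => [/andP[s0 s1]|_]; last by rewrite mulr0.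
  have jN1 : (j <= N.+1)%N by exact: leqW.
  have -> : (s ^+ N.+1 = s ^+ (N.+1 - j) * s ^+ j)%R by rewrite -exprD subnK.
  rewrite /g exprMn exprVn; field.
  by rewrite nat1r pnatr_eq0 expf_neq0 ?gt_eqF.
rewrite ge0_integralZl//; last 2 first.
- apply/measurable_EFinP; apply: measurable_fun_ifT => //.
    by apply: measurable_and; apply: measurable_fun_ltr.
  apply: measurable_funM; first exact: measurable_funX.
  by apply: measurable_funX; exact: measurable_funB.
- move=> s _; rewrite lee_fin; case: ifP => // /andP[s0 s1].
  by rewrite mulr_ge0// exprn_ge0 ?ltW// subr_gt0.
rewrite integral_monomial -!EFinM; congr EFin; rewrite /first_weight.
rewrite subnK; last exact: leqW.
have NF : (N`!%:R != 0 :> R)%R by rewrite pnatr_eq0 -lt0n fact_gt0.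
have N1 : (N.+1%:R != 0 :> R)%R by rewrite pnatr_eq0.
have N2 : (N.+2%:R != 0 :> R)%R by rewrite pnatr_eq0.
have -> : ((N.+1 - j)`! = (N.+1 - j) * (N - j)`!)%N by rewrite subSn// factS.
rewrite !factS !natrM.
have := bin_fact jN => /(congr1 (fun n => n%:R : R)); rewrite !natrM => e.
have ez : ('C(N, j)%:R = N`!%:R / (j`!%:R * (N - j)`!%:R) :> R)%R.
  by rewrite -e mulfK// mulf_neq0// pnatr_eq0 -lt0n fact_gt0.
have jF : (j`!%:R != 0 :> R)%R by rewrite pnatr_eq0 -lt0n fact_gt0.
have NjF : ((N - j)`!%:R != 0 :> R)%R by rewrite pnatr_eq0 -lt0n fact_gt0.
rewrite ez; move: ((N.+1 - j)%:R : R) ((N - j)`!%:R : R) NjF (j`!%:R : R) jF => v w w0 z z0.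
move: (N`!%:R : R) NF (N.+1%:R : R) N1 (N.+2%:R : R) N2 => x x0 y y0 u u0.
by field; rewrite w0 x0 y0 z0 u0.
Qed.

(** The law of the sample seen from its first vertex. Conditionally on V, the
other points are thinned by the ray AV (refused above it), the chord VB
(dropped below it), and moved by [zoom]. *)
Lemma law_first_vertex (H : set (seq (R * R))) N : measurable_on_tuples H ->
  law N.+1 [set t | leads (thead t) (behead t) /\
    H (map (zoom (thead t)) [seq u <- behead t | above_chord (thead t) u])] =
  (\sum_(j < N.+1) first_weight N j * fine (law j [set t | H t]))%:E.
Proof.
move=> mH; rewrite tuple_lawS.
transitivity (\int[triangle_law]_V (\sum_(j < N.+1)
  ((if in_triangle V then
     'C(N, j)%:R * V.2 ^+ (N - j) * ((1 - V.1) * V.2 / V.1) ^+ j else 0)%:E *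
    law j [set t | H t]))).
  apply: eq_integral => V _; rewrite /leads.
  case VT : (in_triangle V) => /=; last first.
    rewrite big1; last by move=> j _; rewrite mul0e.
    rewrite -[RHS](measure0 (law N)); congr (law N _).
    by apply/seteqP; split => t //=; rewrite theadE VT => -[].
  have /and3P[h1 h2 h3] := VT.
  have a0 : (0 <= V.2)%R by exact: ltW.
  have b0 : (0 <= (1 - V.1) * V.2 / V.1)%R.
    by rewrite divr_ge0 ?mulr_ge0 ?subr_ge0 ?(ltW h3)// ltW// (lt_trans h1 h2).
  rewrite -(@tuple_law_thinning _ _ _ _ (below_ray V) (above_chord V) (zoom V) V.2)//.
  - congr (law N _); apply/seteqP; split => t /=; rewrite theadE VT /= => -[h k];
      by split => //; move: k; rewrite theadE.
  - exact: measurable_below_ray.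
  - exact: measurable_above_chord.
  - exact: measurable_zoom.
  - by move=> E mE; exact: triangle_law_zoom.
  - exact: triangle_law_below_chord.
have m0 (j : 'I_N.+1) : measurable_fun setT (fun V : R * R => (if in_triangle V then
     'C(N, j)%:R * V.2 ^+ (N - j) * ((1 - V.1) * V.2 / V.1) ^+ j else 0)%:E).
  apply/measurable_EFinP; apply: measurable_fun_ifT => //; first exact: measurable_in_triangle.
  apply: measurable_funM.
    by apply: measurable_funM => //; exact: measurable_funX.
  apply: measurable_funX; apply: measurable_funM.
    by apply: measurable_funM => //; exact: measurable_funB.
  exact: (measurableT_comp measurable_inv).
have p0 (j : 'I_N.+1) (V : R * R) : 0 <= (if in_triangle V then
     'C(N, j)%:R * V.2 ^+ (N - j) * ((1 - V.1) * V.2 / V.1) ^+ j else 0)%:E.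
  rewrite lee_fin; case: ifP => // /and3P[h1 h2 h3].
  by rewrite !mulr_ge0 ?exprn_ge0 ?divr_ge0 ?mulr_ge0 ?subr_ge0 ?(ltW h1) ?(ltW h3)//
    ltW// (lt_trans h1 h2).
rewrite ge0_integral_sum//; last 2 first.
- by move=> j; apply: emeasurable_funM => //.
- by move=> j V _; rewrite mule_ge0.
rewrite -sumEFin; apply: eq_bigr => j _.
rewrite ge0_integralZr//.
have jN : (j <= N)%N by rewrite -ltnS.
rewrite (integral_first_vertex jN) [RHS]EFinM; congr (_ * _).
exact: (esym (tuple_law_fineK triangle_law (mH j))).
Qed.

End first_vertex.

Section recursion.
Context {R : realType}.
Local Notation law := (tuple_law (@triangle_law R)).
Local Open Scope ereal_scope.

Definition to_front N (i : 'I_N.+1) (t : N.+1.-tuple (R * R)) : N.+1.-tuple (R * R) :=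
  [tuple tnth t (tperm ord0 i j) | j < N.+1].

(** The [i]-th point of the sample is its first vertex. It is exchanged with
the point of index 0, so that the law of the sample is invariant. *)
Definition leader N (i : 'I_N.+1) : set (N.+1.-tuple (R * R)) :=
  [set t | leads (thead (to_front i t)) (behead (to_front i t))].

Lemma perm_to_front N (i : 'I_N.+1) (t : N.+1.-tuple (R * R)) : perm_eq (to_front i t) t.
Proof. by apply/tuple_permP; exists (tperm ord0 i). Qed.

Lemma leader_below_ray N (i j : 'I_N.+1) t : leader i t -> j != i ->
  below_ray (tnth t i) (tnth t j).
Proof.
move=> /andP[_ /allP h] ji.
have -> : tnth t i = thead (to_front i t) by rewrite /thead tnth_mktuple tpermL.
apply: h.
have tj0 : tperm ord0 i j != ord0.
  by rewrite -(inj_eq (@perm_inj _ (tperm ord0 i))) tpermK tpermL.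
have [j' e] : exists j', tperm ord0 i j = lift ord0 j'.
  by case: (unliftP ord0 (tperm ord0 i j)) => [j' ->|e]; [exists j'|rewrite e eqxx in tj0].
have -> : tnth t j = tnth [tuple of behead (to_front i t)] j'.
  rewrite tnth_behead (_ : inord j'.+1 = lift ord0 j'); last first.
    by apply/val_inj; rewrite /= inordK // ltnS.
  by rewrite tnth_mktuple -e tpermK.
exact: mem_tnth.
Qed.

Lemma trivIset_leader N : trivIset setT (@leader N).
Proof.
apply/trivIsetP => i j _ _ ij; apply/seteqP; split => t //= [hi hj].
have ji : j != i by rewrite eq_sym.
have /and3P[_ _ h1] := leader_below_ray hi ji.
have /and3P[_ _ h2] := leader_below_ray hj ij.
by have := lt_trans h1 h2; rewrite ltxx.
Qed.

Lemma measurable_to_front N (i : 'I_N.+1) (A : set (N.+1.-tuple (R * R))) :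
  measurable A -> measurable [set t | A (to_front i t)].
Proof.
have mf : measurable_fun setT (to_front i).
  apply/measurable_fun_tnthP => j.
  rewrite (_ : _ \o _ = fun t => tnth t (tperm ord0 i j)); first exact: measurable_tnth.
  by apply/funext => t /=; rewrite tnth_mktuple.
by move=> mA; rewrite -[X in measurable X]setTI; exact: mf.
Qed.

Lemma measurable_leader N (i : 'I_N.+1) : measurable (leader i).
Proof.
apply: (@measurable_to_front N i [set t | leads (thead t) (behead t)]).
exact: measurable_leads.
Qed.

Definition chain_probability (N k : nat) : R :=
  fine (law N [set t | chain_vertices t = k]).

Lemma chain_probabilityK N k :
  (chain_probability N k)%:E = law N [set t | chain_vertices t = k].
Proof. by apply: tuple_law_fineK; exact: measurable_chain_vertices. Qed.

(** The sum of the weights of [law_first_vertex]. As it is 1 / (N + 1), some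
point leads almost surely, and ties need not be discussed. *)
Lemma law_leader N (i : 'I_N.+1) : law N.+1 (leader i) = (N.+1%:R^-1)%:E.
Proof.
transitivity (law N.+1 [set t | leads (thead t) (behead t)]).
  exact: (@tuple_law_perm _ _ _ triangle_law N.+1 (tperm ord0 i)
    [set t | leads (thead t) (behead t)] (@measurable_leads R N)).
transitivity (law N.+1 [set t | leads (thead t) (behead t) /\
    setT (map (zoom (thead t)) [seq u <- behead t | above_chord (thead t) u])]).
  by congr (law N.+1 _); apply/seteqP; split => t //= [].
rewrite law_first_vertex; last by move=> M; exact: measurableT.
congr EFin.
transitivity (\sum_(j < N.+1) first_weight N j : R)%R.
  by apply: eq_bigr => j _; rewrite [X in fine X](_ : _ = 1) ?mulr1//; exact: probability_setT.
rewrite -mulr_suml (reindex_inj rev_ord_inj) /=.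
rewrite (eq_bigr (fun i : 'I_N.+1 => 2 * i.+1%:R)%R); last first.
  by move=> j _; rewrite subKn.
have sum2 M : (\sum_(i < M) 2 * i.+1%:R = M%:R * M.+1%:R :> R)%R.
  elim: M => [|M IH]; first by rewrite big_ord0 mul0r.
  by rewrite big_ord_recr /= IH; ring.
rewrite sum2.
by field; rewrite !nat1r -natrD !pnatr_eq0.
Qed.

Lemma law_leaderU N : law N.+1 (\big[setU/set0]_(i < N.+1) leader i) = 1.
Proof.
rewrite measure_bigsetU_ord//; last 2 first.
- by move=> i; exact: measurable_leader.
- exact: trivIset_leader.
rewrite (eq_bigr (fun=> (N.+1%:R^-1)%:E)); last by move=> i _; exact: law_leader.
rewrite sumEFin sumr_const card_ord; congr EFin.
by rewrite -[LHS]mulr_natr mulVf ?pnatr_eq0.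
Qed.

(** The events that distinct points lead are disjoint and of total probability
1. *)
Lemma law_split_leader N (A : set (N.+1.-tuple (R * R))) : measurable A ->
  law N.+1 A = \sum_(i < N.+1) law N.+1 (A `&` leader i).
Proof.
move=> mA.
set U := \big[setU/set0]_(i < N.+1) leader i.
have mU : measurable U by apply: bigsetU_measurable => i _; exact: measurable_leader.
have U0 : law N.+1 (~` U) = 0.
  by rewrite probability_setC// law_leaderU subee.
have -> : law N.+1 A = law N.+1 (A `&` U).
  apply/eqP; rewrite eq_le; apply/andP; split; last first.
    by apply: le_measure; rewrite ?inE//; exact: measurableI.
  have eA : A = (A `&` U) `|` (A `&` ~` U) by rewrite -setIUr setUv setIT.
  rewrite [X in law _ X <= _]eA measureU//; last 3 first.
  - exact: measurableI.
  - by apply: measurableI => //; exact: measurableC.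
  - by rewrite setIACA setICr setI0.
  rewrite [X in _ + X](_ : _ = 0) ?adde0//; apply/eqP; rewrite eq_le measure_ge0 andbT.
  rewrite -[leRHS]U0; apply: le_measure; rewrite ?inE//.
  - by apply: measurableI => //; exact: measurableC.
  - exact: measurableC.
rewrite /U (big_morph (setI A) (setIUr A) (setI0 A)) measure_bigsetU_ord//.
- by move=> i; apply: measurableI => //; exact: measurable_leader.
- apply/trivIsetP => i j _ _ ij; have /trivIsetP/(_ i j Logic.I Logic.I ij) := @trivIset_leader N.
  by rewrite setIACA => ->; rewrite setI0.
Qed.

Lemma chain_vertices_to_front N (i : 'I_N.+1) (t : N.+1.-tuple (R * R)) :
  chain_vertices (to_front i t) = chain_vertices t.
Proof. exact/perm_chain_vertices/perm_to_front. Qed.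

Lemma law_chain_leader N k (i : 'I_N.+1) :
  law N.+1 ([set t : N.+1.-tuple (R * R) | chain_vertices t = k] `&` leader i) =
  law N.+1 ([set t : N.+1.-tuple (R * R) | chain_vertices t = k] `&` [set t | leads (thead t) (behead t)]).
Proof.
rewrite -(@tuple_law_perm _ _ _ triangle_law N.+1 (tperm ord0 i)
  ([set t : N.+1.-tuple (R * R) | chain_vertices t = k] `&` [set t | leads (thead t) (behead t)])); last first.
  by apply: measurableI; [exact: measurable_chain_vertices|exact: measurable_leads].
congr (law N.+1 _); apply/seteqP; split => t /= [h1 h2]; split => //=.
  exact: (etrans (chain_vertices_to_front i t) h1).
exact: (etrans (esym (chain_vertices_to_front i t)) h1).
Qed.

Lemma chain_vertices_leads (N k : nat) (t : N.+1.-tuple (R * R)) :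
  leads (thead t) (behead t) ->
  chain_vertices t = (chain_vertices
    (map (zoom (thead t)) [seq u <- behead t | above_chord (thead t) u])).+1.
Proof.
case/tupleP: t => V t; rewrite theadE /= => /andP[VT h].
exact: chain_vertices_first.
Qed.

(** Each of the N + 1 points is the first vertex in the same way; the others
give the weights of [law_first_vertex], and the chain after the first vertex
has one vertex less. *)
Lemma chain_probabilitySS N k :
  chain_probability N.+1 k.+1 =
  (\sum_(j < N.+1) 2 * (N.+1 - j)%:R / (N.+1%:R * N.+2%:R) * chain_probability j k)%R.
Proof.
apply: EFin_inj; rewrite chain_probabilityK law_split_leader; last exact: measurable_chain_vertices.
rewrite (eq_bigr (fun=> (\sum_(j < N.+1) first_weight N j * chain_probability j k)%:E)); last first.
  move=> i _; rewrite law_chain_leader -law_first_vertex; last exact: measurable_chain_vertices.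
  congr (law N.+1 _); apply/seteqP; split => t /= [].
    by move=> + h; rewrite chain_vertices_leads// => -[].
  by move=> h e; split => //; rewrite chain_vertices_leads// e.
rewrite sumEFin sumr_const card_ord; congr EFin.
rewrite -[LHS]mulr_natl mulr_sumr; apply: eq_bigr => j _; rewrite mulrA; congr (_ * _)%R.
by rewrite /first_weight; field; rewrite -natrD !nat1r !pnatr_eq0.
Qed.

Lemma chain_probabilityS0 N : chain_probability N.+1 0 = 0%R.
Proof.
apply: EFin_inj; rewrite chain_probabilityK law_split_leader; last exact: measurable_chain_vertices.
rewrite big1// => i _; rewrite law_chain_leader -[RHS](measure0 (law N.+1)); congr (law N.+1 _).
by apply/seteqP; split => t //= [+ h]; rewrite chain_vertices_leads.
Qed.

Lemma chain_probability0 k : chain_probability 0 k = (k == 0)%:R%R.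
Proof.
apply: EFin_inj; rewrite chain_probabilityK /= diracE; congr ((_ _)%:R%:E).
apply/idP/idP; first by move=> /set_mem /= <-.
by move=> /eqP ->; exact/mem_set.
Qed.

(** Reduction of the given random variables to [triangle_law]: their sheared
values form an independent sample of it. *)
Lemma nb_vertices_probability d (T : measurableType d) (P : probability T R)
    (N k : nat) (X : 'I_N -> {RV P >-> (R * R)%type}) :
  (forall i, uniform_on (triangle R) (X i)) -> mutually_independent X ->
  P [set w | nb_vertices (fun i => X i w) = k] = (chain_probability N k)%:E.
Proof.
move=> Xunif Xindep; rewrite chain_probabilityK.
have msh : measurable_fun setT (@shear R).
  apply/measurable_fun_pair => //=; apply: measurable_funM => //; exact: measurable_funD.
transitivity (P [set w | [set t : N.-tuple (R * R) | chain_vertices t = k]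
    [tuple shear (X i w) | i < N]]).
  congr (P _); apply/seteqP; split => w /=; rewrite nb_vertices_chain => h.
    by rewrite -[RHS]h.
  by rewrite -[RHS]h.
apply: (iid_tuple_law (Y := fun i w => shear (X i w))).
- by move=> i; exact: measurableT_comp.
- move=> E mE.
  have := Xindep [set: 'I_N]%SET (fun i => shear @^-1` E i).
  have mS i : measurable (shear @^-1` E i).
    by have := msh measurableT _ (mE i); rewrite setTI.
  move=> /(_ (fun i _ => mS i)) h.
  transitivity (P (\bigcap_(i in [set` [set: 'I_N]%SET]) (X i @^-1` (shear @^-1` E i)))).
    congr (P _); apply/seteqP; split => w /= hw i; first by move=> _; exact: hw.
    by apply: (hw i); rewrite /= inE.
  rewrite h; apply: eq_big => [i|i _]; first by rewrite inE.
  exact: uniform_shear.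
- exact: measurable_chain_vertices.
Qed.

End recursion.

(** * Derivatives and hyperbolic functions *)

Section derivatives.
Context {R : realType}.
Implicit Types (f g : R -> R) (a b t : R).

Lemma is_derive_mul f g t a b : is_derive t 1 f a -> is_derive t 1 g b ->
  is_derive t 1 (fun x => f x * g x) (a * g t + f t * b).
Proof.
move=> hf hg; apply: (is_derive_eq (is_deriveM hf hg)).
by rewrite /GRing.scale /=; ring.
Qed.

Lemma is_derive_add f g t a b : is_derive t 1 f a -> is_derive t 1 g b ->
  is_derive t 1 (fun x => f x + g x) (a + b).
Proof. by move=> hf hg; exact: is_deriveD. Qed.

Lemma is_derive_sub f g t a b : is_derive t 1 f a -> is_derive t 1 g b ->
  is_derive t 1 (fun x => f x - g x) (a - b).
Proof. by move=> hf hg; exact: is_deriveB. Qed.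

Lemma is_derive_scale f k t a : is_derive t 1 f a ->
  is_derive t 1 (fun x => k * f x) (k * a).
Proof. by move=> hf; exact: is_deriveZ. Qed.

Lemma is_derive_pow n t : is_derive t 1 (fun x : R => x ^+ n) (n%:R * t ^+ n.-1).
Proof.
rewrite (_ : (fun x : R => x ^+ n) = id ^+ n); last by rewrite exprfctE.
apply: (is_derive_eq (is_deriveX n (is_derive_id t 1))).
by rewrite /GRing.scale /= mulr1.
Qed.

Lemma is_derive_inv f t a : f t != 0 -> is_derive t 1 f a ->
  is_derive t 1 (fun x => (f x)^-1) (- (f t) ^- 2 * a).
Proof. by move=> h hf; exact: is_deriveV. Qed.

Lemma is_derive_le (f g f' g' : R -> R) a b : a <= b ->
  (forall x, a <= x <= b -> is_derive x 1 f (f' x)) ->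
  (forall x, a <= x <= b -> is_derive x 1 g (g' x)) ->
  (forall x, a < x < b -> f' x <= g' x) -> f b - f a <= g b - g a.
Proof.
move=> ab hf hg fg.
move: ab; rewrite le_eqVlt => /predU1P[->|ab]; first by rewrite !subrr.
have hd x : a <= x <= b -> is_derive x 1 (fun y => g y - f y) (g' x - f' x).
  by move=> xab; apply: is_derive_sub; [exact: hg|exact: hf].
have [||c] := @MVT R (fun y => g y - f y) (fun x => g' x - f' x) a b ab.
- by move=> x; rewrite in_itv/= => /andP[h1 h2]; apply: hd; rewrite !ltW.
- apply: derivable_within_continuous => x; rewrite in_itv/= => h.
  by have [] := hd x h.
rewrite in_itv/= => acb e.
have : 0 <= (g' c - f' c) * (b - a).
  by rewrite mulr_ge0 ?subr_ge0 ?(ltW ab)//; exact: fg.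
by rewrite -e; lra.
Qed.

End derivatives.

Section hyperbolic.
Context {R : realType}.
Implicit Types x y t : R.

Lemma is_derive_sinh t : is_derive t 1 (@sinh R) (cosh t).
Proof.
have h1 := is_derive_expR t.
have h2 : is_derive t 1 (fun x : R => expR (- x)) (- expR (- t)).
  apply: (is_derive_eq (@is_derive1_comp R expR (-%R) t _ _ (is_derive_expR (- t)) (is_deriveNid t 1))).
  by rewrite mulrN1.
rewrite (_ : @sinh R = (fun x => 2^-1 * (expR x - expR (- x)))); last by apply/funext => x; rewrite /sinh mulrC.
apply: (is_derive_eq (is_derive_scale 2^-1 (is_derive_sub h1 h2))).
by rewrite /cosh opprK mulrC.
Qed.

Lemma is_derive_cosh t : is_derive t 1 (@cosh R) (sinh t).
Proof.
have h1 := is_derive_expR t.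
have h2 : is_derive t 1 (fun x : R => expR (- x)) (- expR (- t)).
  apply: (is_derive_eq (@is_derive1_comp R expR (-%R) t _ _ (is_derive_expR (- t)) (is_deriveNid t 1))).
  by rewrite mulrN1.
rewrite (_ : @cosh R = (fun x => 2^-1 * (expR x + expR (- x)))); last by apply/funext => x; rewrite /cosh mulrC.
apply: (is_derive_eq (is_derive_scale 2^-1 (is_derive_add h1 h2))).
by rewrite /sinh mulrC.
Qed.

Lemma cosh2_sinh2 t : cosh t ^+ 2 = 1 + sinh t ^+ 2.
Proof.
have e : expR t * expR (- t) = 1 by rewrite -expRD subrr expR0.
rewrite /cosh /sinh; move: (expR t) (expR (- t)) e => a b e.
have -> : ((a + b) / 2) ^+ 2 = a * b + ((a - b) / 2) ^+ 2 by field.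
by rewrite e.
Qed.

Lemma sinh2x t : sinh (2 * t) = 2 * (sinh t * cosh t).
Proof.
have -> : 2 * t = t + t by ring.
rewrite /sinh /cosh opprD !expRD.
by move: (expR t) (expR (- t)) => a b; field.
Qed.

Lemma cosh2x t : cosh (2 * t) = cosh t ^+ 2 + sinh t ^+ 2.
Proof.
have -> : 2 * t = t + t by ring.
rewrite /sinh /cosh opprD !expRD.
by move: (expR t) (expR (- t)) => a b; field.
Qed.

Lemma cosh_gt0 t : 0 < cosh t.
Proof. by rewrite divr_gt0// addr_gt0 ?expR_gt0. Qed.

Lemma sinh0 : sinh 0 = 0 :> R.
Proof. by rewrite /sinh oppr0 subrr mul0r. Qed.

Lemma cosh0 : cosh 0 = 1 :> R.
Proof. by rewrite /cosh oppr0 expR0; field. Qed.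

Lemma sinh_gt0 t : 0 < t -> 0 < sinh t.
Proof. by move=> t0; rewrite divr_gt0// subr_gt0 ltr_expR; lra. Qed.

Lemma sinh_ge0 t : 0 <= t -> 0 <= sinh t.
Proof. by rewrite le_eqVlt => /predU1P[<-|/sinh_gt0/ltW//]; rewrite sinh0. Qed.

Lemma cosh_ge1 t : 1 <= cosh t.
Proof.
rewrite -(@ler_pXn2r _ 2)// ?nnegrE ?(ltW (cosh_gt0 t))//.
by rewrite expr1n cosh2_sinh2 lerDl sqr_ge0.
Qed.

Lemma sinh_ge t : 0 <= t -> t <= sinh t.
Proof.
move=> t0.
have := @is_derive_le R id (@sinh R) (cst 1) (@cosh R) 0 t t0.
rewrite sinh0 !subr0; apply.
- by move=> x _; exact: is_derive_sinh.
- by move=> x _; exact: cosh_ge1.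
Qed.

Lemma sinh_le_xcosh t : 0 <= t -> sinh t <= t * cosh t.
Proof.
move=> t0.
have := @is_derive_le R (@sinh R) (fun x => x * cosh x) (@cosh R)
  (fun x => 1 * cosh x + x * sinh x) 0 t t0.
rewrite sinh0 mul0r !subr0; apply.
- by move=> x _; exact: is_derive_sinh.
- by move=> x _; apply: is_derive_mul; exact: is_derive_cosh.
- by move=> x /andP[x0 _]; rewrite mul1r lerDl mulr_ge0 ?sinh_ge0// ltW.
Qed.

Lemma ler_sinh_cosh t : 0 <= t -> t <= sinh t * cosh t.
Proof.
move=> t0; have := @sinh_ge (2 * t); rewrite sinh2x; lra.
Qed.

End hyperbolic.

(** * Generating polynomials *)

Section coefficients.
Context {R : realType}.

(** The recursion satisfied by [chain_probability N k], restricted to chains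
on which at most [L] points disappear at each vertex (the vertex included).
The restriction is void when N <= L, and makes the generating functions
polynomials. *)
Fixpoint chain_coef (L k N : nat) {struct k} : R :=
  match k, N with
  | 0, _ => (N == 0)%:R
  | _.+1, 0 => 0
  | k'.+1, N'.+1 => \sum_(j < N'.+1 | (N'.+1 - j <= L)%N)
      2 * (N'.+1 - j)%:R / (N'.+1%:R * N'.+2%:R) * chain_coef L k' j
  end.

Lemma chain_coef_ge0 L k N : 0 <= chain_coef L k N.
Proof.
elim: k N => [|k IH] [|N] //=.
by apply: sumr_ge0 => j _; rewrite mulr_ge0// divr_ge0// mulr_ge0.
Qed.

Lemma chain_coef_eq0 L k N : (L * k < N)%N -> chain_coef L k N = 0.
Proof.
elim: k N => [|k IH] [|N] //=.
move=> h; rewrite big1// => j jL; rewrite IH ?mulr0//.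
by move: jL h; rewrite mulnS; have := ltn_ord j; lia.
Qed.

Lemma chain_coef_mono L L' k N : (L <= L')%N -> chain_coef L k N <= chain_coef L' k N.
Proof.
move=> LL'; elim: k N => [|k IH] [|N] //=.
rewrite big_mkcond [leRHS]big_mkcond /=; apply: ler_sum => j _.
case: ifP => h1; case: ifP => h2 //.
- by rewrite ler_wpM2l// divr_ge0// mulr_ge0.
- by rewrite (leq_trans h1 LL') in h2.
- by rewrite mulr_ge0 ?chain_coef_ge0// divr_ge0// mulr_ge0.
Qed.

Lemma chain_coef_stable L L' k N : (N <= L)%N -> (N <= L')%N ->
  chain_coef L k N = chain_coef L' k N.
Proof.
elim: k N => [|k IH] [|N] //= NL NL'.
apply: eq_big => [j|j _]; first by have := ltn_ord j; lia.
by rewrite IH//; have := ltn_ord j; lia.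
Qed.

(** The generating polynomial of [chain_coef L k], with exponents shifted by 1
to absorb the denominators (N + 1)(N + 2) of the recursion into two
derivatives. *)
Definition chain_poly L k : {poly R} :=
  \poly_(i < (L * k).+2) (if i is N.+1 then chain_coef L k N else 0).

Lemma coef_chain_poly L k i :
  (chain_poly L k)`_i = if i is N.+1 then chain_coef L k N else 0.
Proof.
rewrite coef_poly; case: ltnP => //; case: i => // N h.
by rewrite chain_coef_eq0.
Qed.

(** The partial sums of the power series of 1 / (1 - x)^2. *)
Definition weight_poly L : {poly R} := \poly_(i < L) i.+1%:R.

(** The recursion read on generating polynomials. *)
Lemma chain_poly_ode L k :
  'X * (chain_poly L k.+1)^`()^`() = 2%:R *: (chain_poly L k * weight_poly L).
Proof.
apply/polyP => i; rewrite coefXM coefZ coefM; case: i => [|N] /=.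
  by rewrite big_ord1 coef_chain_poly mul0r mulr0.
rewrite !coef_deriv !coef_chain_poly big_ord_recl coef_chain_poly mul0r add0r.
rewrite -mulrnA -[LHS]mulr_natr natrM /= big_distrl big_distrr /= [LHS]big_mkcond /=.
apply: eq_bigr => j _; rewrite coef_chain_poly coef_poly /=.
have -> : (N.+1 - bump 0 j = N - j)%N by rewrite /bump /= add1n subSS.
have -> : (N.+1 - j = (N - j).+1)%N by rewrite subSn// -ltnS.
case: ifP => _; last by rewrite !mulr0.
by field; rewrite !nat1r -natrD !pnatr_eq0.
Qed.

Lemma chain_poly0 L : chain_poly L 0 = 'X.
Proof.
apply/polyP => i; rewrite coef_chain_poly coefX.
by case: i => [|[|i]].
Qed.

Lemma chain_poly_ge0 L k x : 0 <= x -> 0 <= (chain_poly L k).[x].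
Proof.
move=> x0; rewrite horner_poly; apply: sumr_ge0 => -[[|i] hi] _ /=; first by rewrite mul0r.
by rewrite mulr_ge0 ?chain_coef_ge0 ?exprn_ge0.
Qed.

Lemma chain_polyE L k x :
  (chain_poly L k).[x] = \sum_(N < (L * k).+1) chain_coef L k N * x ^+ N.+1.
Proof. by rewrite horner_poly big_ord_recl /= mul0r add0r. Qed.

Lemma chain_coef_le L k N x : 0 <= x ->
  chain_coef L k N * x ^+ N.+1 <= (chain_poly L k).[x].
Proof.
move=> x0; have [h|h] := ltnP (L * k)%N N.
  by rewrite chain_coef_eq0// mul0r chain_poly_ge0.
rewrite chain_polyE (bigD1 (Ordinal (h : N < (L * k).+1)%N)) //= lerDl.
by apply: sumr_ge0 => i _; rewrite mulr_ge0 ?chain_coef_ge0 ?exprn_ge0.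
Qed.

Lemma weight_polyE L (x : R) :
  (weight_poly L).[x] * (1 - x) ^+ 2 = 1 - L.+1%:R * x ^+ L + L%:R * x ^+ L.+1.
Proof.
rewrite horner_poly; elim: L => [|L IH]; first by rewrite big_ord0 mul0r; ring.
by rewrite big_ord_recr /= mulrDl IH !exprS; ring.
Qed.

Lemma chain_coefSE k N : N%:R * N.+1%:R * chain_coef N k.+1 N =
  \sum_(j < N) 2 * (N - j)%:R * chain_coef j k j.
Proof.
case: N => [|N]; first by rewrite !mul0r big_ord0.
rewrite /= mulr_sumr; apply: eq_big => [j|j _]; first by rewrite leq_subr.
rewrite (@chain_coef_stable N.+1 j)//; last by have := ltn_ord j; lia.
by field; rewrite !nat1r -natrD !pnatr_eq0.
Qed.

(** After multiplication by N (N + 1), the recursion has weights N - j that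
grow with N. *)
Lemma chain_coef_ndecr k N M : (N <= M)%N ->
  N%:R * N.+1%:R * chain_coef N k.+1 N <= M%:R * M.+1%:R * chain_coef M k.+1 M.
Proof.
move=> /subnK <-; elim: (M - N)%N => [|d]; first by rewrite add0n.
move=> /le_trans; apply; rewrite addSn; move: (d + N)%N => K.
rewrite !chain_coefSE big_ord_recr /= -[leLHS]addr0; apply: lerD.
  apply: ler_sum => j _; rewrite ler_wpM2r ?chain_coef_ge0// ler_wpM2l// ler_nat.
  by rewrite leq_sub2r.
by rewrite !mulr_ge0 ?chain_coef_ge0.
Qed.

End coefficients.

(** * Two-sided bounds on the generating polynomials *)

Section generating_function_bounds.
Context {R : realType}.
Implicit Types (t : R) (L k : nat).

(** Comparison of two functions on (0, th], from their derivatives and from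
the behaviour of their difference at 0. One of the functions compared below is
a quotient whose value at 0 has no meaning, which is why continuity at 0 is
only required of a function [u] bounding the difference. *)
Lemma derive_compare (f g f' g' u : R -> R) (th : R) : 0 < th ->
  (forall t, 0 < t <= th -> is_derive t 1 f (f' t) /\ is_derive t 1 g (g' t)) ->
  (forall t, 0 < t < th -> f' t <= g' t) ->
  (forall t, 0 < t < th -> f t - g t <= u t) ->
  {for 0, continuous u} -> u 0 = 0 -> f th <= g th.
Proof.
move=> th0 hfg' hfg hu cu u0; apply/ler_addgt0Pr => e e0.
have /cvgrPdist_lt/(_ _ e0) := cu.
rewrite u0 => -[d /= d0 hd].
pose m := Num.min (d / 2) (th / 2).
have m0 : 0 < m by rewrite lt_min !divr_gt0.
have mth : m < th by rewrite gt_min; apply/orP; right; lra.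
have := @is_derive_le R f g f' g' m th (ltW mth).
have h1 : `|u m| < e.
  have := hd m; rewrite /ball_/= !sub0r !normrN; apply.
  rewrite gtr0_norm// gt_min; apply/orP; left; lra.
have h2 := hu m; rewrite m0 mth in h2; have {}h2 := h2 isT.
have h3 := ler_norm (u m).
move=> h; have : f th - f m <= g th - g m.
  apply: h => t /andP[a1 a2].
  - by have [|] := hfg' t; first by rewrite a2 (lt_le_trans m0).
  - by have [|] := hfg' t; first by rewrite a2 (lt_le_trans m0).
  - by apply: hfg; rewrite a2 (lt_trans m0).
lra.
Qed.

Lemma is_derive_continuous (f : R -> R) t a : is_derive t 1 f a -> {for t, continuous f}.
Proof. by move=> [df _]; apply/differentiable_continuous/derivable1_diffP. Qed.

Definition th2 t : R := tanh t ^+ 2.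

Lemma th2_ge0 t : 0 <= th2 t. Proof. exact: sqr_ge0. Qed.

Lemma onem_th2 t : 1 - th2 t = (cosh t ^+ 2)^-1.
Proof.
have c0 := cosh_gt0 t; rewrite /th2 /tanh expr_div_n.
have -> : sinh t ^+ 2 = cosh t ^+ 2 - 1 by rewrite cosh2_sinh2; ring.
by field; rewrite gt_eqF.
Qed.

Lemma th20 : th2 0 = 0.
Proof. by rewrite /th2 /tanh sinh0 mul0r expr0n. Qed.

Lemma is_derive_th2 t : is_derive t 1 th2 (2 * sinh t / cosh t ^+ 3).
Proof.
have c0 : cosh t != 0 by rewrite gt_eqF ?cosh_gt0.
have hi := is_derive_inv c0 (is_derive_cosh t).
have hm := is_derive_mul (is_derive_sinh t) hi.
have := is_derive_mul hm hm.
rewrite (_ : (fun x => _) = th2); last by apply/funext => x; rewrite /th2 expr2.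
move=> h; apply: (is_derive_eq h).
have : sinh t ^+ 2 = cosh t ^+ 2 - 1 by rewrite cosh2_sinh2; ring.
move: (sinh t) (cosh t) c0 => s c c0 e.
transitivity (2 * s / c * (c ^+ 2 - s ^+ 2) / c ^+ 2); first by field.
by rewrite e; field.
Qed.

Lemma is_derive_horner_th2 (p : {poly R}) t :
  is_derive t 1 (fun x => p.[th2 x]) (p^`().[th2 t] * (2 * sinh t / cosh t ^+ 3)).
Proof. exact: (is_derive1_comp (is_derive_poly p (th2 t)) (is_derive_th2 t)). Qed.

(** The equation for the derivative of f_(k+1)' along x = tanh(t)^2. *)
Lemma chain_poly_ode_th2 L k t : 0 < t ->
  (chain_poly L k.+1)^`()^`().[th2 t] * (2 * sinh t / cosh t ^+ 3) =
  4 * (chain_poly L k).[th2 t] * (weight_poly L).[th2 t] / (sinh t * cosh t) :> R.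
Proof.
move=> t0; have s0 := sinh_gt0 t0; have c0 := cosh_gt0 t.
have := congr1 (fun p : {poly R} => p.[th2 t]) (chain_poly_ode L k).
rewrite hornerM hornerX hornerZ hornerM /th2 /tanh.
set D := (X in X = _ -> _); set a := (chain_poly L k).[_]; set w := (weight_poly L).[_].
rewrite /D; set F := (_^`()^`()).[_] => e.
have -> : F = 2 * (a * w) * (cosh t ^+ 2 / sinh t ^+ 2).
  rewrite -e; field; lra.
by field; rewrite !gt_eqF.
Qed.

(** 1 / (1 - x)^2 is cosh(t)^4 at x = tanh(t)^2. *)
Lemma weight_poly_le L t : (weight_poly L).[th2 t] <= cosh t ^+ 4.
Proof.
have x0 := th2_ge0 t; have c0 := cosh_gt0 t.
have x1 : th2 t <= 1.
  by rewrite -subr_ge0 onem_th2 invr_ge0 sqr_ge0.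
have := weight_polyE L (th2 t); rewrite onem_th2 => e.
have -> : (weight_poly L).[th2 t] =
    (weight_poly L).[th2 t] * (cosh t ^+ 2)^-1 ^+ 2 * cosh t ^+ 4.
  by field; rewrite gt_eqF.
rewrite e -[leRHS]mul1r ler_wpM2r ?exprn_ge0 ?(ltW c0)//.
have : L%:R * th2 t ^+ L.+1 <= L.+1%:R * th2 t ^+ L.
  have xL := exprn_ge0 L x0.
  rewrite exprS; apply: ler_pM => //; first exact: mulr_ge0.
    by rewrite ler_nat.
  exact: ler_piMl.
lra.
Qed.

Lemma deriv_chain_poly_ge0 L k x : 0 <= x -> 0 <= (chain_poly L k)^`().[x] :> R.
Proof.
move=> x0; rewrite horner_coef; apply: sumr_ge0 => i _.
rewrite coef_deriv coef_chain_poly mulr_ge0 ?exprn_ge0// mulrn_wge0//.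
exact: chain_coef_ge0.
Qed.

(** The lowest coefficient of the k-th generating function, which is also the
probability that k points are all vertices; its decay, like that of 1 /
(k!)^2, is the source of the term 2n log n of the theorem. *)
Definition chain_const k : R := 2 ^+ k / (k`!%:R * k.+1`!%:R).

Lemma chain_const_gt0 k : 0 < chain_const k.
Proof. by rewrite divr_gt0 ?exprn_gt0 ?mulr_gt0 ?ltr0n ?fact_gt0. Qed.

Lemma chain_constS k : chain_const k.+1 * (k.+2%:R * (2 * k.+1%:R)) = 4 * chain_const k.
Proof.
rewrite /chain_const !factS !natrM exprS.
have : k`!%:R != 0 :> R by rewrite pnatr_eq0 -lt0n fact_gt0.
have : k.+1%:R != 0 :> R by rewrite pnatr_eq0.
have : k.+2%:R != 0 :> R by rewrite pnatr_eq0.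
move: (k`!%:R : R) (k.+1%:R : R) (k.+2%:R : R) => x y z z0 y0 x0.
by field; rewrite x0 y0 z0.
Qed.

Let e1 k : (2 * k).+3%:R = 2 * k.+1%:R + 1 :> R.
Proof. by rewrite -natrM natr1 mulnS. Qed.

Let e2 k : (2 * k.+1).+2%:R = 2 * k.+2%:R :> R.
Proof. by rewrite -natrM !mulnS. Qed.

Let e3 k : (2 * k.+1).+1 = (2 * k).+3.
Proof. by rewrite mulnS. Qed.

(** Two successive comparisons, one for each derivative. If f_k is at most C_k
t^(2k+2), the derivative of f_(k+1) is at most that of C_(k+1) t^(2k+4) with
respect to x = tanh(t)^2, as a consequence of t <= sinh t cosh t; then f_(k+1)
itself is at most C_(k+1) t^(2k+4). *)
Lemma chain_poly_le L k t : 0 < t ->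
  (chain_poly L k).[th2 t] <= chain_const k * t ^+ (2 * k).+2.
Proof.
elim: k t => [|k IH] t t0.
  rewrite chain_poly0 hornerX /chain_const expr0 !mulr1 divr1 mul1r.
  have c0 := cosh_gt0 t; have := sinh_le_xcosh (ltW t0); rewrite -ler_pdivrMr// => h.
  by rewrite /th2 ler_sqr ?nnegrE ?(ltW t0)// divr_ge0 ?sinh_ge0 ?ltW.
pose F : {poly R} := chain_poly L k.+1; pose s := chain_const k.+1.
have s0 : 0 < s by exact: chain_const_gt0.
(* the derivative of s t^(2k+4) with respect to x = tanh(t)^2 *)
pose B (x : R) := s * k.+2%:R * (x ^+ (2 * k).+3 * (cosh x * cosh x * cosh x * (sinh x)^-1)).
have AB (x : R) : 0 < x -> F^`().[th2 x] <= B x.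
  move=> x0.
  pose B' (x : R) := s * k.+2%:R * ((2 * k).+3%:R * x ^+ (2 * k).+2 *
      (cosh x * cosh x * cosh x * (sinh x)^-1) + x ^+ (2 * k).+3 *
     (((sinh x * cosh x + cosh x * sinh x) * cosh x + cosh x * cosh x * sinh x) * (sinh x)^-1 +
      cosh x * cosh x * cosh x * (- (sinh x) ^- 2 * cosh x))).
  refine (@derive_compare (fun x => F^`().[th2 x]) B
    (fun t => F^`()^`().[th2 t] * (2 * sinh t / cosh t ^+ 3)) B'
    (fun x => F^`().[th2 x]) x x0 _ _ _ _ _).
  - move=> y /andP[y0 _]; split; first exact: is_derive_horner_th2.
    apply: is_derive_scale; apply: is_derive_mul; first exact: is_derive_pow.
    have hc := is_derive_cosh y.
    apply: is_derive_mul; first by do 2!apply: is_derive_mul => //.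
    apply: is_derive_inv; last exact: is_derive_sinh.
    by rewrite gt_eqF ?sinh_gt0.
  - move=> y /andP[y0 _]; rewrite chain_poly_ode_th2//.
    have c0 := cosh_gt0 y; have sy0 := sinh_gt0 y0; have yk := IH _ y0.
    have w4 := weight_poly_le L y.
    have w0 : 0 <= (weight_poly L).[th2 y].
      rewrite horner_poly; apply: sumr_ge0 => j _.
      by rewrite mulr_ge0// exprn_ge0// th2_ge0.
    have h0 : 0 <= (chain_poly L k).[th2 y] by rewrite chain_poly_ge0// th2_ge0.
    apply: (@le_trans _ _ (4 * (chain_const k * y ^+ (2 * k).+2) * cosh y ^+ 4 / (sinh y * cosh y))).
      apply: ler_wpM2r; first by rewrite invr_ge0 mulr_ge0 ?(ltW c0) ?(ltW sy0).
      apply: ler_pM => //; first exact: mulr_ge0.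
      exact: ler_wpM2l.
    have -> : 4 * (chain_const k * y ^+ (2 * k).+2) =
        s * (k.+2%:R * (2 * k.+1%:R)) * y ^+ (2 * k).+2.
      by rewrite /s chain_constS mulrA.
    have ch := cosh2_sinh2 y; have sc := ler_sinh_cosh (ltW y0).
    rewrite -subr_ge0 /B' [y ^+ (2 * k).+3]exprS.
    rewrite e1.
    have P0 : 0 < y ^+ (2 * k).+2 by rewrite exprn_gt0.
    have K0 : 0 < k.+2%:R :> R by rewrite ltr0n.
    move: (y ^+ (2 * k).+2) P0 (k.+2%:R : R) K0 (k.+1%:R : R) => P P0 K K0 K1.
    rewrite [leRHS](_ : _ = s * K * P * (cosh y ^+ 2 / sinh y ^+ 2) *
       (sinh y * cosh y - y * cosh y ^+ 2 + 3 * y * sinh y ^+ 2)); last first.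
      by field; rewrite !gt_eqF.
    rewrite mulr_ge0//.
      apply: mulr_ge0; last by rewrite divr_ge0 ?sqr_ge0.
      exact: (mulr_ge0 (mulr_ge0 (ltW s0) (ltW K0)) (ltW P0)).
    have : 0 <= y * sinh y ^+ 2 by rewrite mulr_ge0 ?sqr_ge0 ?ltW.
    by rewrite ch; lra.
  - move=> y /andP[y0 _]; rewrite gerBl /B.
    have c0 := cosh_gt0 y; have sy0 := sinh_gt0 y0.
    have ccc := mulr_ge0 (mulr_ge0 (ltW c0) (ltW c0)) (ltW c0).
    apply: mulr_ge0; first exact: (mulr_ge0 (ltW s0) (ler0n _ _)).
    by apply: mulr_ge0; [rewrite exprn_ge0// ltW|rewrite mulr_ge0// invr_ge0 ltW].
  - exact: is_derive_continuous (is_derive_horner_th2 _ _).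
  - by rewrite th20 horner_coef0 coef_deriv coef_chain_poly.
refine (@derive_compare (fun x => F.[th2 x]) (fun x => s * x ^+ (2 * k.+1).+2)
    (fun t => F^`().[th2 t] * (2 * sinh t / cosh t ^+ 3))
    (fun x => s * ((2 * k.+1).+2%:R * x ^+ (2 * k.+1).+1))
    (fun x => F.[th2 x]) t t0 _ _ _ _ _).
- move=> y _; split; first exact: is_derive_horner_th2.
  by apply: is_derive_scale; exact: is_derive_pow.
- move=> y /andP[y0 _].
  have c0 := cosh_gt0 y; have sy0 := sinh_gt0 y0.
  apply: (@le_trans _ _ (B y * (2 * sinh y / cosh y ^+ 3))).
    apply: ler_wpM2r; last exact: AB.
    by apply: divr_ge0; [rewrite mulr_ge0// ltW|rewrite exprn_ge0// ltW].
  rewrite le_eqVlt; apply/orP; left; apply/eqP; rewrite /B.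
  rewrite e2 e3.
  by field; rewrite !gt_eqF.
- move=> y /andP[y0 _]; rewrite gerBl; apply: mulr_ge0; first exact: ltW.
  by rewrite exprn_ge0// ltW.
- exact: is_derive_continuous (is_derive_horner_th2 _ _).
- by rewrite th20 horner_coef0 coef_chain_poly.
Qed.

(** The same two comparisons with the subsolution C_k t^(2k+2) (1 - x), where
the factor 1 - x compensates the fact that t^(2k+2) alone is too large; the
decisive inequality is sinh(2t) <= 2t cosh(2t). The truncation costs a factor
[c] per step. *)
Lemma chain_poly_ge L k (c th : R) t : 0 <= c ->
  (forall y, 0 < y <= th -> c * cosh y ^+ 4 <= (weight_poly L).[th2 y]) ->
  0 < t <= th ->
  c ^+ k * chain_const k * t ^+ (2 * k).+2 * (1 - th2 t) <= (chain_poly L k).[th2 t].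
Proof.
move=> c0 hw; elim: k t => [|k IH] t /andP[t0 tth].
  rewrite chain_poly0 hornerX /chain_const expr0 !mulr1 divr1 !mul1r onem_th2.
  have h : t ^+ 2 <= sinh t ^+ 2.
    by rewrite ler_sqr ?nnegrE ?(ltW t0) ?(sinh_ge0 (ltW t0)) ?(sinh_ge (ltW t0)).
  by rewrite /th2 /tanh [leRHS]expr_div_n; apply: ler_wpM2r => //; rewrite invr_ge0 sqr_ge0.
pose F : {poly R} := chain_poly L k.+1; pose s := c ^+ k.+1 * chain_const k.+1.
have s0 : 0 <= s by rewrite mulr_ge0 ?exprn_ge0// ltW// chain_const_gt0.
(* the derivative of s t^(2k+4) (1 - x) with respect to x = tanh(t)^2 *)
pose B (x : R) := s * (k.+2%:R * (x ^+ (2 * k).+3 * (cosh x * (sinh x)^-1))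
   - x ^+ (2 * k.+1).+2).
pose u (x : R) := s * k.+2%:R * (x ^+ (2 * k).+2 * cosh x).
have BA (x : R) : 0 < x <= t -> B x <= F^`().[th2 x].
  move=> /andP[x0 xt].
  pose B' (x : R) := s * (k.+2%:R * ((2 * k).+3%:R * x ^+ (2 * k).+2 * (cosh x * (sinh x)^-1)
     + x ^+ (2 * k).+3 * (sinh x * (sinh x)^-1 + cosh x * (- (sinh x) ^- 2 * cosh x)))
     - (2 * k.+1).+2%:R * x ^+ (2 * k.+1).+1).
  refine (@derive_compare B (fun x => F^`().[th2 x]) B'
    (fun t => F^`()^`().[th2 t] * (2 * sinh t / cosh t ^+ 3)) u x x0 _ _ _ _ _).
  - move=> y /andP[y0 _]; split; last exact: is_derive_horner_th2.
    apply: is_derive_scale; apply: is_derive_sub; last exact: is_derive_pow.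
    apply: is_derive_scale; apply: is_derive_mul; first exact: is_derive_pow.
    apply: is_derive_mul; first exact: is_derive_cosh.
    apply: is_derive_inv; last exact: is_derive_sinh.
    by rewrite gt_eqF ?sinh_gt0.
  - move=> y /andP[y0 yx]; rewrite chain_poly_ode_th2//.
    have yth : 0 < y <= th by rewrite y0 ltW// (lt_le_trans yx)// (le_trans xt).
    have yt : 0 < y <= t by rewrite y0 ltW// (lt_le_trans yx).
    have ch0 := cosh_gt0 y; have sy0 := sinh_gt0 y0.
    have yk := IH y yth; have w4 := hw y yth.
    have cc0 : 0 <= c * cosh y ^+ 4 by rewrite mulr_ge0// exprn_ge0// ltW.
    have P0 : 0 < y ^+ (2 * k).+2 by rewrite exprn_gt0.
    have hk0 : 0 <= c ^+ k * chain_const k * y ^+ (2 * k).+2 * (1 - th2 y).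
      apply: mulr_ge0; last by rewrite onem_th2 invr_ge0 sqr_ge0.
      apply: (mulr_ge0 (mulr_ge0 _ (ltW (chain_const_gt0 k))) (ltW P0)).
      exact: exprn_ge0.
    apply: (@le_trans _ _ (4 * (c ^+ k * chain_const k * y ^+ (2 * k).+2 * (1 - th2 y)) *
       (c * cosh y ^+ 4) / (sinh y * cosh y))); last first.
      apply: ler_wpM2r; first by rewrite invr_ge0 mulr_ge0 ?(ltW ch0) ?(ltW sy0).
      apply: ler_pM => //; first exact: mulr_ge0.
      exact: ler_wpM2l.
    rewrite onem_th2.
    have -> : 4 * (c ^+ k * chain_const k * y ^+ (2 * k).+2 / cosh y ^+ 2) * (c * cosh y ^+ 4) /
      (sinh y * cosh y) = c ^+ k * c * (4 * chain_const k) * y ^+ (2 * k).+2 * cosh y / sinh y.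
      by field; rewrite !gt_eqF.
    rewrite -chain_constS -exprSr [c ^+ k.+1 * (_ * _)]mulrA -/s.
    have h2 : sinh y * cosh y <= y * (cosh y ^+ 2 + sinh y ^+ 2).
      have : 0 <= 2 * y by lra.
      by move=> /sinh_le_xcosh; rewrite sinh2x cosh2x; lra.
    have sh : sinh y ^+ 2 = cosh y ^+ 2 - 1 by rewrite cosh2_sinh2; ring.
    rewrite -subr_ge0 /B' e1 e2 e3 [y ^+ (2 * k).+3]exprS.
    have K0 : 0 < k.+2%:R :> R by rewrite ltr0n.
    move: (y ^+ (2 * k).+2) P0 (k.+2%:R : R) K0 (k.+1%:R : R) => P P0 K K0 K1.
    rewrite [leRHS](_ : _ = s * K * P / sinh y ^+ 2 *
       (y * (cosh y ^+ 2 + sinh y ^+ 2) - sinh y * cosh y)); last first.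
      by field; rewrite !gt_eqF.
    apply: mulr_ge0; last by rewrite subr_ge0.
    apply: mulr_ge0; last by rewrite invr_ge0 sqr_ge0.
    exact: (mulr_ge0 (mulr_ge0 s0 (ltW K0)) (ltW P0)).
  - move=> y /andP[y0 _].
    have ch0 := cosh_gt0 y; have sy0 := sinh_gt0 y0.
    have A0 : 0 <= F^`().[th2 y] by rewrite deriv_chain_poly_ge0// th2_ge0.
    apply: (@le_trans _ _ (B y)); first by rewrite gerBl.
    rewrite /B /u -mulrA; apply: ler_wpM2l => //.
    have P0 : 0 < y ^+ (2 * k).+2 by rewrite exprn_gt0.
    have K0 : 0 < k.+2%:R :> R by rewrite ltr0n.
    apply: (@le_trans _ _ (k.+2%:R * (y ^+ (2 * k).+3 * (cosh y / sinh y)))).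
      by rewrite gerBl exprn_ge0// ltW.
    apply: ler_wpM2l; first exact: ltW.
    have -> : y ^+ (2 * k).+3 * (cosh y / sinh y) =
        y / sinh y * (y ^+ (2 * k).+2 * cosh y).
      by rewrite exprS; field; rewrite gt_eqF.
    apply: ler_piMl; first by rewrite mulr_ge0// ltW.
    by rewrite ler_pdivrMr// mul1r; exact/sinh_ge/ltW.
  - have du := is_derive_scale (s * k.+2%:R)
      (is_derive_mul (is_derive_pow (2 * k).+2 0) (is_derive_cosh (0 : R))).
    exact: (is_derive_continuous du).
  - by rewrite /u expr0n/= mul0r mulr0.
have d1 (y : R) : is_derive y 1 (fun x => s * (x ^+ (2 * k.+1).+2 * (1 - th2 x)))
    (s * ((2 * k.+1).+2%:R * y ^+ (2 * k.+1).+1 * (1 - th2 y)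
       + y ^+ (2 * k.+1).+2 * (0 - 2 * sinh y / cosh y ^+ 3))).
  apply: is_derive_scale; apply: is_derive_mul; first exact: is_derive_pow.
  have dc : is_derive y 1 (fun _ : R => 1 : R) 0 by exact: is_derive_cst.
  exact: (is_derive_sub dc (is_derive_th2 y)).
rewrite -mulrA.
refine (@derive_compare (fun x => s * (x ^+ (2 * k.+1).+2 * (1 - th2 x))) (fun x => F.[th2 x])
    (fun x => s * ((2 * k.+1).+2%:R * x ^+ (2 * k.+1).+1 * (1 - th2 x)
       + x ^+ (2 * k.+1).+2 * (0 - 2 * sinh x / cosh x ^+ 3)))
    (fun t => F^`().[th2 t] * (2 * sinh t / cosh t ^+ 3))
    (fun x => s * (x ^+ (2 * k.+1).+2 * (1 - th2 x))) t t0 _ _ _ _ _).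
- by move=> y _; split; [exact: d1|exact: is_derive_horner_th2].
- move=> y /andP[y0 yt].
  have ch0 := cosh_gt0 y; have sy0 := sinh_gt0 y0.
  apply: (@le_trans _ _ (B y * (2 * sinh y / cosh y ^+ 3))); last first.
    apply: ler_wpM2r; last by apply: BA; rewrite y0 ltW.
    by apply: divr_ge0; [rewrite mulr_ge0// ltW|rewrite exprn_ge0// ltW].
  rewrite le_eqVlt; apply/orP; left; apply/eqP; rewrite /B onem_th2 e2 e3.
  by field; rewrite !gt_eqF.
- move=> y /andP[y0 yt]; rewrite gerBl chain_poly_ge0// th2_ge0//.
- exact: is_derive_continuous (d1 0).
- by rewrite expr0n/= mul0r mulr0.
Qed.

End generating_function_bounds.

(** * The rate function and its minimum *)

Section rate_function.
Context {R : realType}.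
Implicit Types (t : R).

Lemma is_derive_lt (f f' : R -> R) (a b : R) : a < b ->
  (forall x, a <= x <= b -> is_derive x 1 f (f' x) /\ (a < x < b -> 0 < f' x)) ->
  f a < f b.
Proof.
move=> ab hf.
have [||c] := @MVT R f f' a b ab.
- move=> x; rewrite in_itv/= => /andP[h1 h2].
  by have [|h _] := hf x; first by rewrite !ltW.
- apply: derivable_within_continuous => x; rewrite in_itv/= => h.
  by have [[]] := hf x h.
rewrite in_itv/= => acb e.
have [|_ /(_ acb) h] := hf c; first by have /andP[h1 h2] := acb; rewrite !ltW.
by rewrite -subr_gt0 e mulr_gt0 ?subr_gt0.
Qed.

Lemma sinh_lt_xcosh t : 0 < t -> sinh t < t * cosh t.
Proof.
move=> t0.
have hd (x : R) : is_derive x 1 (fun x => x * cosh x - sinh x) (1 * cosh x + x * sinh x - cosh x).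
  have h1 := is_derive_mul (is_derive_id x 1) (is_derive_cosh x).
  exact: (is_derive_sub h1 (is_derive_sinh x)).
have := @is_derive_lt (fun x => x * cosh x - sinh x) _ 0 t t0.
rewrite mul0r sinh0 subrr subr_gt0; apply => x _; split; first exact: hd.
move=> /andP[x0 _]; by rewrite mul1r addrAC subrr add0r mulr_gt0// sinh_gt0.
Qed.

Lemma sinh_gt t : 0 < t -> t < sinh t.
Proof.
move=> t0.
have hd (x : R) : is_derive x 1 (fun x => sinh x - x) (cosh x - 1).
  exact: (is_derive_sub (is_derive_sinh x) (is_derive_id x 1)).
have := @is_derive_lt (fun x => sinh x - x) _ 0 t t0.
rewrite sinh0 subrr subr_gt0; apply => x _; split; first exact: hd.
move=> /andP[x0 _].
rewrite subr_gt0 -(@ltr_pXn2r _ 2)// ?nnegrE ?(ltW (cosh_gt0 x))//.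
by rewrite expr1n cosh2_sinh2 ltrDl exprn_gt0// sinh_gt0.
Qed.

Lemma PsiE t : 0 < t -> Psi t = sinh t * cosh t / t - 1.
Proof. by move=> t0; rewrite /Psi gt_eqF// sinh2x; field; rewrite gt_eqF. Qed.

Definition sinhc t : R := sinh (2 * t) / (2 * t).

Lemma is_derive_sinhc t : 0 < t ->
  is_derive t 1 sinhc ((2 * t * cosh (2 * t) - sinh (2 * t)) / (2 * t ^+ 2)).
Proof.
move=> t0.
have h2 : is_derive t 1 (fun x : R => 2 * x) (2 * 1) := is_derive_scale 2 (is_derive_id t 1).
have hs : is_derive t 1 (fun x : R => sinh (2 * x)) (cosh (2 * t) * (2 * 1)).
  exact: (is_derive1_comp (is_derive_sinh (2 * t)) h2).
have t2 : 2 * t != 0 by lra.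
have hi := is_derive_inv t2 h2.
by apply: (is_derive_eq (is_derive_mul hs hi)); field; rewrite gt_eqF.
Qed.

Lemma Psi_sinhc t : 0 < t -> Psi t = sinhc t - 1.
Proof. by move=> t0; rewrite /Psi gt_eqF. Qed.

Lemma Psi_gt0 t : 0 < t -> 0 < Psi t.
Proof.
move=> t0; rewrite Psi_sinhc// subr_gt0 ltr_pdivlMr ?mul1r; last lra.
by apply: sinh_gt; lra.
Qed.

Lemma Psi_lt (a b : R) : 0 < a -> a < b -> Psi a < Psi b.
Proof.
move=> a0 ab; rewrite (Psi_sinhc a0) (Psi_sinhc (lt_trans a0 ab)) ltrD2r.
apply: (is_derive_lt ab) => x /andP[ax _]; have x0 := lt_le_trans a0 ax.
split=> [|_]; first exact: is_derive_sinhc.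
rewrite divr_gt0 ?mulr_gt0 ?exprn_gt0// subr_gt0.
by apply: sinh_lt_xcosh; lra.
Qed.

Lemma Psi_inj : {in [set r : R | 0 <= r] &, injective (@Psi R)}.
Proof.
have Psi0 : Psi (0 : R) = 0 by rewrite /Psi eqxx.
move=> a b; rewrite !inE /= !le_eqVlt => /predU1P[<-|a0] /predU1P[<-|b0]//.
- by rewrite Psi0 => e; have := Psi_gt0 b0; rewrite -e ltxx.
- by rewrite Psi0 => e; have := Psi_gt0 a0; rewrite e ltxx.
- move=> e; have [ab|ab|//] := ltgtP a b.
    by have := Psi_lt a0 ab; rewrite e ltxx.
  by have := Psi_lt b0 ab; rewrite e ltxx.
Qed.

Lemma sinhc_le_cosh t : 0 < t -> sinhc t <= cosh (2 * t).
Proof.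
move=> t0; rewrite ler_pdivrMr; last lra.
by rewrite [leRHS]mulrC; apply: sinh_le_xcosh; lra.
Qed.

Lemma sinhc_ge t : 0 < t -> t / 2 <= sinhc t.
Proof.
move=> t0; rewrite ler_pdivlMr; last lra.
have y0 : 0 <= 2 * t by lra.
have := expR_ge1Dxn 1 y0; have : expR (- (2 * t)) <= 1 by rewrite -[leRHS]expR0 ler_expR; lra.
by rewrite (_ : 2`! = 2%N)// /sinh expr2; lra.
Qed.

(** Intermediate values, between a small point where sinhc is close to 1 and a
large one. *)
Lemma Psi_surj (lam : R) : 0 < lam -> exists2 r, 0 < r & Psi r = lam.
Proof.
move=> lam0.
have cc := is_derive_continuous (is_derive_cosh (0 : R)).
have /cvgrPdist_lt/(_ _ lam0) := cc.
rewrite cosh0 => -[d /= d0 hd].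
pose a := Num.min (d / 4) 1.
have a0 : 0 < a by rewrite lt_min divr_gt0//=.
have ad : a <= d / 4 by rewrite ge_min lexx.
have a1 : a <= 1 by rewrite ge_min lexx orbT.
have ha : sinhc a <= 1 + lam.
  apply: (le_trans (sinhc_le_cosh a0)).
  have := hd (2 * a); rewrite /ball_ /= sub0r normrN gtr0_norm; last lra.
  have d2 : 2 * a < d by lra.
  by move=> /(_ d2); rewrite distrC ltr_norml; lra.
pose b := 2 * (1 + lam).
have hb : 1 + lam <= sinhc b.
  have b0 : 0 < b by rewrite /b; lra.
  by have := sinhc_ge b0; rewrite /b; lra.
have ab : a <= b by rewrite /b; lra.
have [||r] := @IVT R sinhc a b (1 + lam) ab.
- apply: derivable_within_continuous => x; rewrite in_itv/= => /andP[ax _].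
  by have [] := is_derive_sinhc (lt_le_trans a0 ax).
- by rewrite ge_min ha/= le_max hb orbT.
rewrite in_itv/= => /andP[ar _] e.
have r0 := lt_le_trans a0 ar.
by exists r => //; rewrite Psi_sinhc// e; ring.
Qed.

(** The partial inverse by which [r_] is defined takes values in the half-line
because Psi is injective there. *)
Lemma r_Psi (lam : R) : 0 < lam -> 0 < r_ lam /\ Psi (r_ lam) = lam.
Proof.
move=> lam0; have [r r0 rlam] := Psi_surj lam0.
have lamI : lam \in [set Psi r | r in [set r : R | 0 <= r]].
  by rewrite inE; exists r => //=; exact: ltW.
have e : Psi (r_ lam) = lam by exact: pinvK.
split => //.
have : ([set r : R | 0 <= r]) (r_ lam).
  rewrite -(injpinv_image (fun=> 0) Psi_inj); exists lam => //.
  exact/set_mem.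
rewrite /= le_eqVlt => /predU1P[h|//].
by move: lam0; rewrite -e -h /(@Psi R) eqxx ltxx.
Qed.

(** The exponent, per vertex, of t^(2n) x^(-N) when N is about n (1 + mu) and
x = tanh(t)^2. *)
Definition rate (mu t : R) : R := 2 * ln t - (1 + mu) * ln (th2 t).

Lemma th2_gt0 t : 0 < t -> 0 < th2 t.
Proof. by move=> t0; rewrite exprn_gt0// divr_gt0 ?sinh_gt0 ?cosh_gt0. Qed.

Lemma th2_lt1 t : th2 t < 1.
Proof. by rewrite -subr_gt0 onem_th2 invr_gt0 exprn_gt0// cosh_gt0. Qed.

(** The critical point of the rate is the solution of Psi t = mu, which is
where [r_] comes from. *)
Lemma is_derive_rate mu t : 0 < t ->
  is_derive t 1 (rate mu) (2 / (sinh t * cosh t) * (Psi t - mu)).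
Proof.
move=> t0; have s0 := sinh_gt0 t0; have c0 := cosh_gt0 t.
have hl : is_derive t 1 (fun x => ln (th2 x)) ((th2 t)^-1 * (2 * sinh t / cosh t ^+ 3)).
  exact: (is_derive1_comp (is_derive1_ln (th2_gt0 t0)) (is_derive_th2 t)).
have h := is_derive_sub (is_derive_scale 2 (is_derive1_ln t0)) (is_derive_scale (1 + mu) hl).
apply: (is_derive_eq h); rewrite PsiE// /th2 /tanh.
by field; rewrite !gt_eqF.
Qed.

Lemma rate_incr mu (a b : R) : 0 < a -> a < b ->
  (forall t, a < t < b -> mu < Psi t) -> rate mu a < rate mu b.
Proof.
move=> a0 ab h; apply: (is_derive_lt ab) => x /andP[ax _]; have x0 := lt_le_trans a0 ax.
split=> [|axb]; first exact: is_derive_rate.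
apply: mulr_gt0; last by rewrite subr_gt0; exact: h.
by apply: divr_gt0 => //; apply: mulr_gt0; [exact: sinh_gt0|exact: cosh_gt0].
Qed.

Lemma rate_decr mu (a b : R) : 0 < a -> a < b ->
  (forall t, a < t < b -> Psi t < mu) -> rate mu b < rate mu a.
Proof.
move=> a0 ab h; rewrite -ltrN2; apply: (@is_derive_lt (fun x => - rate mu x)
   (fun t => - (2 / (sinh t * cosh t) * (Psi t - mu))) _ _ ab) => x /andP[ax _].
have x0 := lt_le_trans a0 ax.
split=> [|axb]; first exact: (is_deriveN (is_derive_rate mu x0)).
rewrite -mulrN; apply: mulr_gt0; last by rewrite oppr_gt0 subr_lt0; exact: h.
by apply: divr_gt0 => //; apply: mulr_gt0; [exact: sinh_gt0|exact: cosh_gt0].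
Qed.

Lemma Psi_left_dense (r e : R) : 0 < r -> 0 < e ->
  exists2 s, r / 2 < s < r & Psi r - e < Psi s.
Proof.
move=> r0 e0.
have cc := is_derive_continuous (is_derive_sinhc r0).
have /cvgrPdist_lt/(_ _ e0)[d /= d0 hd] := cc.
pose m := Num.min (d / 2) (r / 4).
have m0 : 0 < m by rewrite lt_min !divr_gt0.
have md : m <= d / 2 by rewrite ge_min lexx.
have mr : m <= r / 4 by rewrite ge_min lexx orbT.
exists (r - m); first by apply/andP; split; lra.
rewrite !Psi_sinhc//; last lra.
have := hd (r - m); rewrite /ball_ /= opprB addrC subrK gtr0_norm//.
have md' : m < d by lra.
by move=> /(_ md'); rewrite ltr_norml; lra.
Qed.

End rate_function.

(** * Tails of the generating polynomial *)

Section asymptotics.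
Context {R : realType}.
Implicit Types (t x : R) (n N L : nat).

Lemma th2_le (a b : R) : 0 < a -> a <= b -> th2 a <= th2 b.
Proof.
move=> a0; rewrite le_eqVlt => /predU1P[->//|ab]; apply: ltW.
apply: (is_derive_lt ab) => x /andP[ax _]; have x0 := lt_le_trans a0 ax.
split=> [|_]; first exact: is_derive_th2.
apply: divr_gt0; last by rewrite exprn_gt0 ?cosh_gt0.
by rewrite mulr_gt0 ?sinh_gt0.
Qed.

(** For t in (0, th], the partial sums of the series of 1 / (1 - x)^2 reach
any fraction of the sum uniformly: the missing part, relative to the sum, is
at most (L + 1) x^L, which is made small by e^z >= 1 + z^2/2. *)
Lemma exists_weight_poly_ge (c th : R) : 0 < th -> c < 1 ->
  exists L, forall y, 0 < y <= th -> c * cosh y ^+ 4 <= (weight_poly L).[th2 y].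
Proof.
move=> th0 c1.
have x0 := th2_gt0 th0; have x1 := th2_lt1 th.
pose a := - ln (th2 th).
have a0 : 0 < a by rewrite oppr_gt0 ln_lt0// x0.
pose L := (Num.truncn (4 / (a ^+ 2 * (1 - c)))).+1.
have hL : 4 <= (1 - c) * (L%:R * a ^+ 2).
  have : 4 / (a ^+ 2 * (1 - c)) < L%:R by exact: truncnS_gt.
  rewrite ltr_pdivrMr; last by rewrite mulr_gt0 ?exprn_gt0 ?subr_gt0.
  by move=> /ltW; rewrite mulrCA mulrA mulrAC -mulrA (mulrC (L%:R)); lra.
have hx : L.+1%:R * th2 th ^+ L <= 1 - c.
  have -> : th2 th ^+ L = (expR (L%:R * a))^-1.
    by rewrite -expRN -mulrN opprK mulrC expRM_natr lnK.
  rewrite ler_pdivrMr ?expR_gt0//.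
  have La : 0 <= L%:R * a by rewrite mulr_ge0 ?ltW.
  have := expR_ge1Dxn 1 La; rewrite (_ : 2`! = 2%N)// => h.
  have L1 : 1 <= L%:R :> R by rewrite ler1n.
  have h2 : (1 - c) * (1 + (L%:R * a) ^+ 2 / 2) <= (1 - c) * expR (L%:R * a).
    by rewrite ler_wpM2l// subr_ge0 ltW.
  apply: le_trans h2; have : 4 * L%:R <= (1 - c) * (L%:R * a) ^+ 2.
    have := ler_wpM2r (ler0n R L) hL; congr (_ <= _); ring.
  by rewrite -natr1; lra.
exists L => y /andP[y0 yth].
have xy0 := th2_gt0 y0; have xy := th2_le y0 yth; have c0 := cosh_gt0 y.
have := weight_polyE L (th2 y); rewrite onem_th2 => e.
have -> : (weight_poly L).[th2 y] =
    (weight_poly L).[th2 y] * (cosh y ^+ 2)^-1 ^+ 2 * cosh y ^+ 4.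
  by field; rewrite gt_eqF.
rewrite e ler_wpM2r ?exprn_ge0 ?(ltW c0)//.
have : L.+1%:R * th2 y ^+ L <= L.+1%:R * th2 th ^+ L.
  by rewrite ler_wpM2l// lerXn2r// ?nnegrE ltW.
have : 0 <= L%:R * th2 y ^+ L.+1.
  by apply: mulr_ge0 => //; apply: exprn_ge0; exact: ltW.
move: hx; clear; set u := _ * th2 th ^+ _; set v := _ * th2 y ^+ L.
set w := _ * th2 y ^+ _ => hx hw hv; clearbody u v w; lra.
Qed.

(** One term of the exponential series at n. *)
Lemma ln_fact_ge n : n%:R * ln n%:R - n%:R <= ln n`!%:R :> R.
Proof.
case: n => [|n]; first by rewrite mul0r subrr fact0 ln1.
have n0 : 0 < n.+1%:R :> R by rewrite ltr0n.
have := expR_ge1Dxn n (ltW n0) => h.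
have {}h : n.+1%:R ^+ n.+1 / n.+1`!%:R <= expR (n.+1%:R) :> R.
  by apply: le_trans h; rewrite lerDr.
have f0 : 0 < n.+1`!%:R :> R by rewrite ltr0n fact_gt0.
move: h; rewrite -ler_ln ?posrE ?expR_gt0 ?divr_gt0 ?exprn_gt0//.
rewrite ln_div ?posrE ?exprn_gt0// lnXn// expRK -[ln _ *+ _]mulr_natl; lra.
Qed.

Lemma ln_fact_le n : (0 < n)%N -> ln n`!%:R <= n%:R * ln n%:R - n%:R + ln n%:R + 1 :> R.
Proof.
case: n => // n _; elim: n => [|n IH].
  by rewrite ln1 mulr0 add0r addr0 addrC subrr.
rewrite factS natrM lnM ?posrE ?ltr0n ?fact_gt0//.
have n1 : 0 < n.+1%:R :> R by rewrite ltr0n.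
have n2 : 0 < n.+2%:R :> R by rewrite ltr0n.
have h : ln n.+1%:R <= ln n.+2%:R - n.+2%:R^-1 :> R.
  have : n.+1%:R = n.+2%:R * (1 - n.+2%:R^-1) :> R.
    by rewrite mulrBr mulr1 mulfV ?gt_eqF// -[n.+2%:R]natr1 addrK.
  have i0 : n.+2%:R^-1 < 1 :> R by rewrite invf_lt1// ltr1n.
  move=> ->; rewrite lnM ?posrE ?subr_gt0// lerD2l.
  have : -1 < - n.+2%:R^-1 :> R by rewrite ltrN2.
  by move=> /le_ln1Dx.
have h2 : n.+2%:R * ln n.+1%:R <= n.+2%:R * ln n.+2%:R - 1 :> R.
  have := ler_wpM2l (ltW n2) h; rewrite mulrBr mulfV ?gt_eqF//.
move: IH h2; set l2 := ln n.+2%:R; set l1 := ln _ => IH h2; move: IH h2.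
rewrite -[n.+2%:R]natr1; set A := n.+1%:R.
lra.
Qed.

Lemma ln_chain_const n t : 0 < t ->
  ln (chain_const n * t ^+ (2 * n).+2) =
  n%:R * ln 2 - ln n`!%:R - ln n.+1`!%:R + (2 * n%:R + 2) * ln t.
Proof.
move=> t0.
have f0 m : 0 < m`!%:R :> R by rewrite ltr0n fact_gt0.
rewrite lnM ?posrE ?chain_const_gt0 ?exprn_gt0// /chain_const.
rewrite ln_div ?posrE ?exprn_gt0 ?mulr_gt0// lnM ?posrE// !lnXn// -[ln 2 *+ n]mulr_natl -[ln t *+ _]mulr_natl.
have -> : (2 * n).+2%:R = 2 * n%:R + 2 :> R by rewrite -natrM -natrD addn2.
by ring.
Qed.

Lemma exprn_tilt n (x y : R) : 0 < x -> 0 < y ->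
  x ^+ n = y ^+ n * expR (n%:R * (ln x - ln y)).
Proof.
move=> x0 y0; have e (z : R) : 0 < z -> z ^+ n = expR (n%:R * ln z).
  by move=> z0; rewrite mulrC expRM_natr lnK.
by rewrite !e// -expRD; congr expR; ring.
Qed.

(** Exponential tilting. The hypothesis bounds the factor gained in each term
by passing from [t] to [th] by its value at M + 1 = n (1 + mu); the sum is
thus at most that factor times the generating polynomial at [th], and the
exponential part of the result is the difference of the rates. *)
Lemma sum_tail_le L n (mu t th : R) (p : pred nat) : 0 < t -> 0 < th ->
  (forall M, p M -> M.+1%:R * (ln (th2 t) - ln (th2 th)) <=
     n%:R * (1 + mu) * (ln (th2 t) - ln (th2 th))) ->
  \sum_(M < (L * n).+1 | p M) chain_coef L n M * th2 t ^+ M.+1 <=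
  chain_const n * t ^+ (2 * n).+2 * (th / t) ^+ 2 *
    expR (rate mu th - rate mu t) ^+ n :> R.
Proof.
move=> t0 th0 hp.
have x0 := th2_gt0 t0; have y0 := th2_gt0 th0.
set D := ln (th2 t) - ln (th2 th).
have hb := chain_poly_le L n th0.
pose E := expR (n%:R * (1 + mu) * D).
apply: (@le_trans _ _ ((chain_poly L n).[th2 th] * E)).
  rewrite chain_polyE mulr_suml big_mkcond /=; apply: ler_sum => M _.
  case: ifP => [pM|_]; last first.
    apply: mulr_ge0 (expR_ge0 _); apply: mulr_ge0 (chain_coef_ge0 _ _ _) _.
    by apply: exprn_ge0; exact: ltW.
  rewrite -mulrA ler_wpM2l ?chain_coef_ge0//.
  rewrite (exprn_tilt M.+1 x0 y0); apply: ler_wpM2l.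
    by apply: exprn_ge0; exact: ltW.
  by rewrite ler_expR hp.
apply: (@le_trans _ _ (chain_const n * th ^+ (2 * n).+2 * E)).
  by rewrite ler_wpM2r// expR_ge0.
rewrite le_eqVlt; apply/orP; left; apply/eqP.
have q0 : 0 < th / t by exact: divr_gt0.
have -> : th ^+ (2 * n).+2 = t ^+ (2 * n).+2 * ((th / t) ^+ 2 * (th / t) ^+ (2 * n)).
  by rewrite -exprD add2n -exprMn; congr (_ ^+ _); field; rewrite gt_eqF.
have <- : (th / t) ^+ (2 * n) * E = expR (rate mu th - rate mu t) ^+ n.
  have -> : (th / t) ^+ (2 * n) = expR ((2 * n)%:R * ln (th / t)).
    by rewrite [X in expR X]mulrC expRM_natr lnK.
  rewrite -[RHS]expRM_natr -expRD; congr expR.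
  by rewrite ln_div ?posrE// /rate /D natrM; ring.
move: (chain_const n) (t ^+ _) ((th / t) ^+ 2) ((th / t) ^+ _) => a b c d.
by rewrite !mulrA.
Qed.

End asymptotics.

(** * Asymptotics of a single coefficient *)

Section lower.
Context {R : realType}.
Implicit Types (t x : R) (n N L : nat).

Lemma ln_sublinear (e y : R) : 0 < e -> 0 < y -> ln y <= e * y - ln e.
Proof.
move=> e0 y0; have ey : 0 < e * y by exact: mulr_gt0.
have : ln (1 + (e * y - 1)) <= e * y - 1 by apply: le_ln1Dx; lra.
by rewrite addrC subrK lnM ?posrE//; lra.
Qed.

(** The upper bound, for every value of [r]: one term of the generating
polynomial against its total. *)
Lemma ln_chain_coef_le n N (mu r : R) : 0 < r ->
  N%:R <= n%:R * (1 + mu) -> 0 < chain_coef N n N :> R ->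
  ln (chain_coef N n N) + 2 * n%:R * ln n%:R <=
  n%:R * (ln 2 + 2 + rate mu r) + 2 * ln r - ln (th2 r).
Proof.
move=> r0 hN q0; have x0 := th2_gt0 r0.
have lx : ln (th2 r) <= 0 by apply: ln_le0; exact/ltW/th2_lt1.
have h := le_trans (chain_coef_le N n N (ltW x0)) (chain_poly_le N n r0).
move: h; rewrite -ler_ln; last 2 first.
- by rewrite posrE; apply: mulr_gt0 => //; exact: exprn_gt0.
- by rewrite posrE; apply: mulr_gt0 (chain_const_gt0 _) _; exact: exprn_gt0.
rewrite ln_chain_const// lnM ?posrE//; last exact: exprn_gt0.
rewrite lnXn// -[ln _ *+ N.+1]mulr_natl -natr1.
have hf := @ln_fact_ge R n.
have hf1 : ln n`!%:R <= ln n.+1`!%:R :> R.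
  rewrite ler_ln ?posrE ?ltr0n ?fact_gt0// ler_nat factS.
  by rewrite leq_pmull.
have hx := ler_wnM2r lx hN.
rewrite /rate; move: hx hf hf1.
set a := ln (th2 r); set b := ln r; set f := ln n`!%:R; set g := ln n.+1`!%:R.
set l := ln n%:R; set k := ln 2; set q := ln (chain_coef _ _ _).
by move: (n%:R) (N%:R) => u v; clearbody a b f g l k q; clear; lra.
Qed.

Lemma near_geometric_le (rho c K eta : R) : 0 <= rho -> rho < c -> 0 <= K -> 0 < eta ->
  \forall n \near \oo, K * rho ^+ n <= eta * c ^+ n.
Proof.
move=> rho0 rc K0 eta0; have c0 : 0 < c := le_lt_trans rho0 rc.
have q1 : `|rho / c| < 1 by rewrite ger0_norm ?divr_ge0 ?(ltW c0)// ltr_pdivrMr ?mul1r.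
have K1 : 0 < K + 1 by lra.
have /cvgrPdist_lt/(_ (eta / (K + 1)) (divr_gt0 eta0 K1)) := cvg_expr q1.
apply: filterS => n; rewrite sub0r normrN ger0_norm; last first.
  by rewrite exprn_ge0 ?divr_ge0 ?(ltW c0).
rewrite expr_div_n ltr_pdivlMr// => h.
have cn : 0 < c ^+ n by exact: exprn_gt0.
have : rho ^+ n * (K + 1) < eta * c ^+ n by rewrite -ltr_pdivrMr// mulrAC.
have : 0 <= rho ^+ n by exact: exprn_ge0.
by move: (rho ^+ n) (eta * c ^+ n) => u v; lra.
Qed.

(** The terms of index at most N are all compared to the one of index N,
through the monotonicity of N (N + 1) p(N, n). *)
Lemma sum_window_le L n N (x a : R) : (0 < n)%N -> 0 < x < 1 ->
  \sum_(M < (L * n).+1 | (M <= N)%N && (a <= M.+1%:R))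
     chain_coef L n M * x ^+ M.+1 <=
  (L * n).+1%:R * (N%:R * N.+1%:R * chain_coef N n N * expR (a * ln x)).
Proof.
case: n => // k _ /andP[x0 x1].
have B0 : 0 <= N%:R * N.+1%:R * chain_coef N k.+1 N * expR (a * ln x).
  by rewrite !mulr_ge0 ?expR_ge0 ?chain_coef_ge0.
have -> : (L * k.+1).+1%:R * (N%:R * N.+1%:R * chain_coef N k.+1 N * expR (a * ln x)) =
  \sum_(M < (L * k.+1).+1) N%:R * N.+1%:R * chain_coef N k.+1 N * expR (a * ln x).
  by rewrite sumr_const card_ord mulr_natl.
rewrite big_mkcond; apply: ler_sum => M _; case: ifP => // /andP[].
case: (nat_of_ord M) => {M} [_ _|M MN aM]; first by rewrite /= mul0r.
apply: ler_pM; rewrite ?chain_coef_ge0 ?exprn_ge0 ?(ltW x0)//.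
  have h : chain_coef L k.+1 M.+1 <= chain_coef M.+1 k.+1 M.+1 :> R.
    have [LM|ML] := leqP L M.+1; first exact: chain_coef_mono.
    by rewrite (chain_coef_stable (L' := M.+1)) ?(ltnW ML).
  apply: (le_trans h); apply: (le_trans _ (chain_coef_ndecr k MN)).
  rewrite ler_peMl ?chain_coef_ge0// -natrM ler1n.
  by rewrite muln_gt0.
have -> : x ^+ M.+2 = expR (M.+2%:R * ln x).
  by rewrite [X in expR X]mulrC expRM_natr lnK.
by rewrite ler_expR ler_wnM2r// ln_le0// ltW.
Qed.

(** The lower bound for the generating polynomial, minus its two tails: the
part of degree at least n (1 + lam), tilted to [r], and the part of degree at
most n (1 + lam - del), tilted to [s]. *)
Lemma chain_coef_window (lam del r s t c : R) L n N : (0 < n)%N -> 0 <= c ->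
  0 < s -> s < t -> t < r ->
  (forall y, 0 < y <= r -> c * cosh y ^+ 4 <= (weight_poly L).[th2 y]) ->
  n%:R * (1 + lam) <= N.+1%:R ->
  chain_const n * t ^+ (2 * n).+2 *
    (c ^+ n * (1 - th2 t) - (r / t) ^+ 2 * expR (rate lam r - rate lam t) ^+ n
      - (s / t) ^+ 2 * expR (rate (lam - del) s - rate (lam - del) t) ^+ n) <=
  (L * n).+1%:R *
    (N%:R * N.+1%:R * chain_coef N n N * expR (n%:R * (1 + (lam - del)) * ln (th2 t))).
Proof.
move=> n0 c0 s0 st tr hw hN.
have t0 := lt_trans s0 st; have r0 := lt_trans t0 tr.
have x0 := th2_gt0 t0; have x1 := th2_lt1 t.
pose hi (M : nat) := n%:R * (1 + lam) <= M.+1%:R.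
pose lo (M : nat) := M.+1%:R <= n%:R * (1 + (lam - del)).
have hhi : \sum_(M < (L * n).+1 | hi M) chain_coef L n M * th2 t ^+ M.+1 <=
    chain_const n * t ^+ (2 * n).+2 * (r / t) ^+ 2 * expR (rate lam r - rate lam t) ^+ n.
  apply: (@sum_tail_le _ L n lam t r hi t0 r0) => M hM.
  apply: ler_wnM2r => //; rewrite subr_le0 ler_ln ?posrE//; last exact: th2_gt0.
  by apply: th2_le => //; exact: ltW.
have hlo : \sum_(M < (L * n).+1 | lo M) chain_coef L n M * th2 t ^+ M.+1 <=
    chain_const n * t ^+ (2 * n).+2 * (s / t) ^+ 2 *
      expR (rate (lam - del) s - rate (lam - del) t) ^+ n.
  apply: (@sum_tail_le _ L n (lam - del) t s lo t0 s0) => M hM.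
  apply: ler_wpM2r => //; rewrite subr_ge0 ler_ln ?posrE//; last exact: th2_gt0.
  by apply: th2_le => //; exact: ltW.
have tI : 0 < t <= r by rewrite t0 ltW.
have hsum := chain_poly_ge n c0 hw tI; rewrite chain_polyE in hsum.
have x01 : 0 < th2 t < 1 by rewrite x0.
have hmid := sum_window_le L N (n%:R * (1 + (lam - del))) n0 x01.
apply: le_trans hmid.
have : \sum_(M < (L * n).+1) chain_coef L n M * th2 t ^+ M.+1 <=
    \sum_(M < (L * n).+1 | hi M) chain_coef L n M * th2 t ^+ M.+1 +
    \sum_(M < (L * n).+1 | lo M) chain_coef L n M * th2 t ^+ M.+1 +
    \sum_(M < (L * n).+1 | (M <= N)%N && (n%:R * (1 + (lam - del)) <= M.+1%:R))
      chain_coef L n M * th2 t ^+ M.+1.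
  rewrite [X in _ <= X + _ + _]big_mkcond [X in _ <= _ + X + _]big_mkcond.
  rewrite [X in _ <= _ + X]big_mkcond -!big_split; apply: ler_sum => M _.
  rewrite [leRHS]/=.
  have u0 : 0 <= chain_coef L n M * th2 t ^+ M.+1.
    by apply: mulr_ge0 (chain_coef_ge0 _ _ _) _; apply: exprn_ge0; exact: ltW.
  move: (chain_coef L n M * _) u0 => u u0.
  case hM : (hi M); first by case: ifP; case: ifP => _ _; lra.
  case lM : (lo M); first by case: ifP => _; lra.
  have -> : (M <= N)%N.
    move: hM => /negbT; rewrite -ltNge => /lt_le_trans/(_ hN).
    by rewrite ltr_nat ltnS => /ltnW.
  have -> : n%:R * (1 + (lam - del)) <= M.+1%:R.
    by move: lM => /negbT; rewrite -ltNge => /ltW.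
  by rewrite !add0r.
move: hsum hhi hlo.
set S0 := \sum_(M < _) _; set S1 := \sum_(M < _ | hi _) _.
set S2 := \sum_(M < _ | lo _) _; set S3 := \sum_(M < _ | _ && _) _.
move: (expR _ ^+ n) (expR _ ^+ n) (c ^+ n) (t ^+ _) ((r / t) ^+ 2) ((s / t) ^+ 2).
move: (chain_const n) (th2 t) => k x e1 e2 cn p k1 k2.
clearbody S0 S1 S2 S3; clear.
by move=> h1 h2 h3 h4; lra.
Qed.

(** The previous bound in logarithmic form, once the tails are at most half of
the main term. The six logarithms collect the polynomial factors. *)
Lemma ln_chain_coef_ge (lam del t c : R) L n N : (0 < n)%N -> (n <= N)%N ->
  0 < lam -> 0 < c -> 0 < t -> N%:R <= n%:R * (1 + lam) ->
  chain_const n * t ^+ (2 * n).+2 * ((1 - th2 t) / 2 * c ^+ n) <=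
  (L * n).+1%:R *
    (N%:R * N.+1%:R * chain_coef N n N * expR (n%:R * (1 + (lam - del)) * ln (th2 t))) ->
  0 < chain_coef N n N :> R /\
  n%:R * (ln 2 + 2 + rate lam t) + n%:R * (del * ln (th2 t) + ln c) +
    (2 * ln t - 2 + ln ((1 - th2 t) / 2)) - 6 * ln ((L%:R + 2 + lam) * n%:R) <=
  ln (chain_coef N n N) + 2 * n%:R * ln n%:R.
Proof.
move=> n0 nN lam0 c0 t0 hN h.
have x0 := th2_gt0 t0; have x1 := th2_lt1 t.
have z0 : 0 < (1 - th2 t) / 2 by lra.
have cn0 : 0 < c ^+ n by exact: exprn_gt0.
have S0 : 0 < chain_const n * t ^+ (2 * n).+2.
  by apply: mulr_gt0 (chain_const_gt0 _) _; exact: exprn_gt0.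
have N0 : 0 < N%:R :> R by rewrite ltr0n (leq_trans n0).
have nR : 1 <= n%:R :> R by rewrite ler1n.
have q0 : 0 < chain_coef N n N :> R.
  rewrite lt_neqAle chain_coef_ge0 andbT eq_sym; apply/eqP => q0.
  move: h; rewrite q0 mulr0 mul0r mulr0 leNgt => /negP; apply.
  by apply: mulr_gt0 => //; exact: mulr_gt0.
split=> //.
have f0 m : 0 < m`!%:R :> R by rewrite ltr0n fact_gt0.
move: h; rewrite -ler_ln ?posrE; last 2 first.
- by apply: mulr_gt0 => //; exact: mulr_gt0.
- by rewrite !mulr_gt0 ?expR_gt0.
rewrite lnM ?posrE//; last exact: mulr_gt0.
rewrite ln_chain_const// [ln (_ / 2 * c ^+ n)]lnM ?posrE// [ln (c ^+ n)]lnXn// -[ln c *+ n]mulr_natl.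
rewrite lnM ?posrE//; last by rewrite !mulr_gt0 ?expR_gt0.
rewrite lnM ?posrE ?expR_gt0//; last by rewrite !mulr_gt0.
rewrite expRK lnM ?posrE//; last by rewrite mulr_gt0.
rewrite lnM ?posrE// factS natrM lnM ?posrE//.
have hf := @ln_fact_le R n n0.
have D0 : 0 < (L%:R + 2 + lam) * n%:R by apply: mulr_gt0; have := ler0n R L; lra.
have hl (m : R) : 0 < m -> m <= (L%:R + 2 + lam) * n%:R -> ln m <= ln ((L%:R + 2 + lam) * n%:R).
  by move=> m0; rewrite ler_ln ?posrE.
have Ln0 : 0 <= L%:R * n%:R :> R by exact: mulr_ge0.
have ln0 : 0 <= lam * n%:R by rewrite mulr_ge0 ?(ltW lam0)//.
have e1 : ln n%:R <= ln ((L%:R + 2 + lam) * n%:R) by apply: hl; lra.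
have e2 : ln n.+1%:R <= ln ((L%:R + 2 + lam) * n%:R) by apply: hl => //; rewrite -natr1; lra.
have e3 : ln (L * n).+1%:R <= ln ((L%:R + 2 + lam) * n%:R).
  by apply: hl => //; rewrite -natr1 natrM; lra.
have e4 : ln N%:R <= ln ((L%:R + 2 + lam) * n%:R) by apply: hl => //; lra.
have e5 : ln N.+1%:R <= ln ((L%:R + 2 + lam) * n%:R) by apply: hl => //; rewrite -natr1; lra.
move: hf e1 e2 e3 e4 e5; rewrite /rate.
set l0 := ln _; set l1 := ln n%:R; set l2 := ln (_ * _); set l3 := ln n.+1%:R.
set l4 := ln (L * n).+1%:R; set l5 := ln N%:R; set l6 := ln N.+1%:R.
set l7 := ln (th2 t); set l8 := ln (_ / 2); set l9 := ln t; set l10 := ln c.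
set l11 := ln (chain_coef _ _ _); set l12 := ln 2; move: (n%:R) => u.
clearbody l0 l1 l2 l3 l4 l5 l6 l7 l8 l9 l10 l11 l12; clear.
by move=> h0 h1 h2 h3 h4 h5; lra.
Qed.

(** The point [t] is taken between [s] and r_lambda. As [rate lam] decreases
from [t] to r_lambda and [rate (lam - del)] increases from [s] to [t], both
tails are geometric with ratios [rho1] and [rho2] less than 1; the truncation
[L] is then chosen so that the loss [c] per step exceeds these ratios. *)
Lemma near_ln_chain_coef_ge (lam e : R) : 0 < lam -> 0 < e ->
  \forall n \near \oo, forall N, (n <= N)%N ->
    N%:R <= n%:R * (1 + lam) -> n%:R * (1 + lam) <= N.+1%:R ->
    0 < chain_coef N n N :> R /\
    n%:R * (ln 2 + 2 + rate lam (r_ lam)) - n%:R * e <=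
    ln (chain_coef N n N) + 2 * n%:R * ln n%:R.
Proof.
move=> lam0 e0; have [r0 rE] := r_Psi lam0; move: (r_ lam) r0 rE => r r0 rE.
have r20 : 0 < r / 2 by lra.
pose a := - ln (th2 (r / 2)).
have a0 : 0 < a by rewrite oppr_gt0 ln_lt0// th2_gt0// th2_lt1.
(* chosen so that [del * ln (th2 t)] stays above [- e / 4] for all t >= r / 2 *)
pose del := e / 4 / a.
have del0 : 0 < del by rewrite !divr_gt0.
have [s /andP[rs sr]] := Psi_left_dense r0 del0; rewrite rE => hs.
have s0 : 0 < s by lra.
pose t := (s + r) / 2.
have st : s < t by rewrite /t; lra.
have tr : t < r by rewrite /t; lra.
have t0 := lt_trans s0 st; clearbody t.
have hr1 : rate lam r < rate lam t.
  apply: rate_decr => // u /andP[tu ur]; rewrite -rE; apply: Psi_lt => //.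
  exact: lt_trans tu.
have hr2 : rate (lam - del) s < rate (lam - del) t.
  apply: rate_incr => // u /andP[su ut]; apply: (lt_trans hs); exact: Psi_lt.
set rho1 := expR (rate lam r - rate lam t).
set rho2 := expR (rate (lam - del) s - rate (lam - del) t).
have rho1_lt1 : rho1 < 1 by rewrite -[ltRHS]expR0 ltr_expR subr_lt0.
have rho2_lt1 : rho2 < 1 by rewrite -[ltRHS]expR0 ltr_expR subr_lt0.
have e1 : expR (- (e / 4)) < 1 by rewrite -[ltRHS]expR0 ltr_expR; lra.
have [c [c1 cr1 cr2 ce]] : exists c, [/\ c < 1, rho1 < c, rho2 < c & expR (- (e / 4)) <= c].
  (* above both ratios, and with logarithm at least [- e / 4] *)
  exists (Num.max (expR (- (e / 4))) (Num.max ((1 + rho1) / 2) ((1 + rho2) / 2))).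
  rewrite !gt_max !lt_max le_max lexx; split=> //.
  - by rewrite e1; apply/andP; split; lra.
  - by apply/or3P/Or32; lra.
  - by apply/or3P/Or33; lra.
have c0 : 0 < c := lt_le_trans (expR_gt0 _) ce.
have [L hL] := exists_weight_poly_ge r0 c1.
have x0 := th2_gt0 t0; have x1 := th2_lt1 t.
have z0 : 0 < (1 - th2 t) / 4 by lra.
have g1 := near_geometric_le (expR_ge0 _) cr1 (sqr_ge0 (r / t)) z0.
have g2 := near_geometric_le (expR_ge0 _) cr2 (sqr_ge0 (s / t)) z0.
have D0 : 0 < L%:R + 2 + lam by have := ler0n R L; lra.
pose e' := e / (24 * (L%:R + 2 + lam)).
have e'0 : 0 < e' by rewrite divr_gt0 ?mulr_gt0.
pose K := 2 * ln t - 2 + ln ((1 - th2 t) / 2) + 6 * ln e'.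
have g3 : \forall n \near \oo, - K <= n%:R * (e / 4).
  have e40 : 0 < e / 4 by lra.
  have := nbhs_infty_ger (- K / (e / 4)); apply: filterS => n.
  by rewrite ler_pdivrMr.
near=> n => N nN hN1 hN2.
have n0 : (0 < n)%N by near: n; exact: nbhs_infty_gt.
have h1 : (r / t) ^+ 2 * rho1 ^+ n <= (1 - th2 t) / 4 * c ^+ n by near: n.
have h2 : (s / t) ^+ 2 * rho2 ^+ n <= (1 - th2 t) / 4 * c ^+ n by near: n.
have h3 : - K <= n%:R * (e / 4) by near: n.
have hw := @chain_coef_window lam del r s t c L n N n0 (ltW c0) s0 st tr hL hN2.
have hw2 : chain_const n * t ^+ (2 * n).+2 * ((1 - th2 t) / 2 * c ^+ n) <=
  (L * n).+1%:R *
    (N%:R * N.+1%:R * chain_coef N n N * expR (n%:R * (1 + (lam - del)) * ln (th2 t))).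
  apply: le_trans hw; apply: ler_wpM2l.
    by apply: mulr_ge0 (ltW (chain_const_gt0 _)) _; apply: exprn_ge0; exact: ltW.
  move: h1 h2; rewrite -/rho1 -/rho2; set u1 := _ * rho1 ^+ n; set u2 := _ * rho2 ^+ n.
  by move: (c ^+ n) (th2 t) => v x; clearbody u1 u2; clear; lra.
have [q0 hq] := ln_chain_coef_ge n0 nN lam0 c0 t0 hN1 hw2; split=> //.
apply: le_trans hq.
have nR : 0 < n%:R :> R by rewrite ltr0n.
have h4 : 6 * ln ((L%:R + 2 + lam) * n%:R) <= n%:R * (e / 4) - 6 * ln e'.
  have := ln_sublinear e'0 (mulr_gt0 D0 nR); rewrite {1}/e' => h.
  have -> : n%:R * (e / 4) = 6 * (e / (24 * (L%:R + 2 + lam)) * ((L%:R + 2 + lam) * n%:R)).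
    by field; rewrite gt_eqF.
  by move: (ln _) (ln _) (_ * (_ * n%:R)) h => u v w; lra.
have h5 : - (e / 4) <= ln c by rewrite -[leLHS]expRK ler_ln ?posrE ?expR_gt0.
have h6 : - (e / 4) <= del * ln (th2 t).
  have : - a <= ln (th2 t).
    rewrite opprK ler_ln ?posrE ?th2_gt0//; apply: th2_le => //.
    exact: le_trans (ltW rs) (ltW st).
  move=> /(ler_wpM2l (ltW del0)); apply: le_trans.
  by rewrite /del mulrN divfK// gt_eqF.
have h7 : n%:R * rate lam r <= n%:R * rate lam t by rewrite ler_pM2l// ltW.
have h8 : n%:R * - (e / 4) <= n%:R * ln c by rewrite ler_pM2l.
have h9 : n%:R * - (e / 4) <= n%:R * (del * ln (th2 t)) by rewrite ler_pM2l.
move: h3 h4 h7 h8 h9; rewrite /K.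
set v1 := ln t; set v2 := ln (_ / 2); set v3 := ln e'; set v4 := rate lam r.
set v5 := rate lam t; set v6 := ln c; set v7 := del * _; set v8 := ln (_ * _); set v9 := ln 2.
move: (n%:R) => u; clearbody v1 v2 v3 v4 v5 v6 v7 v8 v9; clear.
by move=> h3 h4 h5 h6 h7; lra.
Unshelve. all: by end_near.
Qed.
End lower.

(** * The theorem *)

(** With at most [L] points the truncation is not felt. *)
Lemma chain_probabilityE (R : realType) N L k : (N <= L)%N ->
  chain_probability N k = chain_coef L k N :> R.
Proof.
elim: k N => [|k IH] [|N] NL; rewrite ?chain_probability0 ?chain_probabilityS0//.
rewrite chain_probabilitySS /=; apply: eq_big => [j|j _].
  by rewrite (leq_trans (leq_subr _ _) NL).
by rewrite IH// (leq_trans (ltnW (ltn_ord j)) NL).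
Qed.

Lemma betaE (R : realType) (lam : R) : 0 < lam ->
  beta lam = ln 2 + 2 + rate lam (r_ lam).
Proof.
move=> lam0; have [r0 _] := r_Psi lam0.
have h0 : 0 < tanh (r_ lam) by rewrite divr_gt0 ?sinh_gt0 ?cosh_gt0.
rewrite /beta /rate /th2 lnM ?posrE ?powR_gt0//; last first.
  by rewrite !mulr_gt0 ?expR_gt0 ?exprn_gt0.
rewrite [ln (_ * r_ lam ^+ 2)]lnM ?posrE; last 2 first.
- exact: mulr_gt0 (expR_gt0 _).
- exact: exprn_gt0.
rewrite lnM ?posrE ?expR_gt0// expRK ln_powR !lnXn//.
by rewrite -[ln (r_ lam) *+ 2]mulr_natl -[ln (tanh _) *+ 2]mulr_natl; ring.
Qed.

Theorem theorem1p2 (R : realType)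
    (d : nat -> measure_display) (T : forall N : nat, measurableType (d N))
    (P : forall N : nat, probability (T N) R)
    (U : forall N : nat, 'I_N -> {RV (P N) >-> (R * R)%type})
    (U_uniform : forall (N : nat) (i : 'I_N), uniform_on (triangle R) (U N i))
    (U_indep : forall N : nat, mutually_independent (U N))
    (lambda : R) (lambda_gt0 : 0 < lambda) :
  (fun n : nat =>
     (ln (Q (U (n + Num.truncn (n%:R * lambda))%N)) + 2 * n%:R * ln n%:R)
       / n%:R) @ \oo
    --> beta lambda.
Proof.
have QE n m : Q (U (n + m)%N) = chain_coef (n + m) n (n + m).
  by rewrite /Q nb_vertices_probability//= (chain_probabilityE _ _ (leqnn _)).
apply/cvgrPdist_le => e e0.
have [r0 _] := r_Psi lambda_gt0.
pose C := 2 * ln (r_ lambda) - ln (th2 (r_ lambda)).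
have hC : \forall n \near \oo, C <= n%:R * e.
  have := nbhs_infty_ger (C / e); apply: filterS => n.
  by rewrite ler_pdivrMr.
have hlow := near_ln_chain_coef_ge lambda_gt0 e0.
near=> n; rewrite QE.
have n0 : (0 < n)%N by near: n; exact: nbhs_infty_gt.
have nR : 0 < n%:R :> R by rewrite ltr0n.
have Cn : C <= n%:R * e by near: n.
set N := (n + _)%N.
have nl0 : 0 <= n%:R * lambda by rewrite mulr_ge0// ltW.
have hN1 : N%:R <= n%:R * (1 + lambda).
  by rewrite mulrDr mulr1 natrD lerD2l truncn_le.
have hN2 : n%:R * (1 + lambda) <= N.+1%:R.
  by rewrite mulrDr mulr1 -addnS natrD lerD2l ltW// truncnS_gt.
have hn : forall M, (n <= M)%N -> M%:R <= n%:R * (1 + lambda) ->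
    n%:R * (1 + lambda) <= M.+1%:R -> 0 < chain_coef M n M :> R /\
    n%:R * (ln 2 + 2 + rate lambda (r_ lambda)) - n%:R * e <=
    ln (chain_coef M n M) + 2 * n%:R * ln n%:R by near: n.
have [q0] := hn N (leq_addr _ _) hN1 hN2.
have := ln_chain_coef_le r0 hN1 q0.
rewrite -addrA -/C betaE//.
set A := ln (chain_coef _ _ _) + _; set b := ln 2 + 2 + _ => hup hlo.
rewrite ler_distlC; apply/andP; split.
  by rewrite ler_pdivlMr// mulrC mulrBr.
by rewrite ler_pdivrMr// mulrC mulrDr; lra.
Unshelve. all: by end_near.
Qed.
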